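(* Let $\Omega\subset\mathbb{R}^N$ be a domain and $L$ an elliptic operator as described in the context. The operator $L$ satisfies the maximum principle (MP) in $\Omega$ (i) if $\lambda_1''(-L,\Omega)>0$ and the coefficients of $L$ satisfy $$\sup_\Omega c<\infty,\qquad \limsup_{x\in\Omega,\ |x|\to\infty}\frac{|a_{ij}(x)|}{|x|^2}<\infty,\qquad \limsup_{x\in\Omega,\ |x|\to\infty}\frac{b(x)\cdot x}{|x|^2}<\infty;$$ (ii) only if $\lambda_1'(-L,\Omega)\ge0$.
   Context: Standing assumptions: $\Omega\subset\mathbb{R}^N$ is a domain (connected open set, possibly unbounded and non-smooth), and $Lu=a_{ij}(x)\partial_{ij}u+b_i(x)\partial_i u+c(x)u$ (summation over repeated indices), where $(a_{ij})$ is symmetric, $a_{ij}\in C^0(\overline\Omega)$ (not necessarily bounded), the smallest eigenvalue of $(a_{ij}(x))$ is positive for every $x\in\overline\Omega$, and $b_i,c\in L^\infty_{\rm loc}(\overline\Omega)$ (bounded on $\Omega\cap B_r$ for every $r>0$); $b=(b_1,\dots,b_N)$. Suprema and upper limits of coefficients defined a.e. are essential ones. Definitions: $\lambda_1'(-L,\Omega):=\inf\{\lambda:\exists\,\phi\in W^{2,N}_{\rm loc}(\Omega)\cap L^\infty(\Omega),\ \phi>0,\ (L+\lambda)\phi\ge0\text{ a.e. in }\Omega,\ \forall\xi\in\partial\Omega,\ \lim_{x\to\xi}\phi(x)=0\}$ ($+\infty$ if the set is empty); $\lambda_1''(-L,\Omega):=\sup\{\lambda:\exists\,\phi\in W^{2,N}_{\rm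 loc}(\Omega),\ \inf_\Omega\phi>0,\ (L+\lambda)\phi\le0\text{ a.e. in }\Omega\}$ ($-\infty$ if the set is empty). Maximum principle: $L$ satisfies the MP in $\Omega$ if every $u\in W^{2,N}_{\rm loc}(\Omega)$ such that $Lu\ge0$ a.e. in $\Omega$, $\sup_\Omega u<\infty$ and $\limsup_{x\to\xi}u(x)\le0$ for all $\xi\in\partial\Omega$, satisfies $u\le0$ in $\Omega$. *)

(* Defs.v *)
From HB Require Import structures.
From mathcomp Require Import all_boot all_order all_algebra.
From mathcomp Require Import all_classical all_reals all_analysis.
From mathcomp Require Import ess_sup_inf hoelder.

Set Implicit Arguments.
Unset Strict Implicit.
Unset Printing Implicit Defensive.
Import Order.TTheory GRing.Theory Num.Theory.
Import numFieldNormedType.Exports.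

Local Open Scope classical_set_scope.
Local Open Scope ring_scope.

(* The sigma-algebra on R^n is the one generated by the coordinates, i.e. the
   Borel one. *)
Definition measure_rV_display : measure_display. Proof. exact. Qed.

Section measurable_rV.
Context (R : realType) (n : nat).

Let coords : 'I_n -> 'rV[R]_n -> R := fun i x => x ord0 i.

Let rV_set0 : g_sigma_preimage coords set0.
Proof. exact: sigma_algebra0. Qed.

Let rV_setC A : g_sigma_preimage coords A -> g_sigma_preimage coords (~` A).
Proof. exact: sigma_algebraC. Qed.

Let rV_bigcup (F : _^nat) : (forall i, g_sigma_preimage coords (F i)) ->
  g_sigma_preimage coords (\bigcup_i (F i)).
Proof. exact: sigma_algebra_bigcup. Qed.

HB.instance Definition _ := @isMeasurable.Build measure_rV_display
  'rV[R]_n (g_sigma_preimage coords) rV_set0 rV_setC rV_bigcup.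

Lemma measurable_coord_rV (i : 'I_n) :
  measurable_fun [set: 'rV[R]_n] (fun x : 'rV[R]_n => x ord0 i : R).
Proof.
move=> _ Y mY; rewrite setTI; apply: sub_sigma_algebra => /=.
rewrite -bigcup_seq/=; exists i => /=; first by rewrite mem_index_enum.
by exists Y => //; rewrite setTI.
Qed.

Lemma measurable_fun_rVP d (T : measurableType d) (f : T -> 'rV[R]_n) :
  (forall i, measurable_fun setT (fun t => f t ord0 i : R)) ->
  measurable_fun setT f.
Proof.
move=> mf; apply: (@measurability _ _ T _ setT f
  (\big[setU/set0]_(i < n) preimage_set_system setT (coords i) measurable)).
  by [].
move=> _ [B + <-]; rewrite -bigcup_seq => -[i /= _ [A mA <-]].
by rewrite setTI -comp_preimage; exact: mf.
Qed.

End measurable_rV.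

Section lebesgue_rV.
Context (R : realType).

Definition cons_rV n (p : measurableTypeR R * 'rV[R]_n) : 'rV[R]_n.+1 :=
  \row_i (if unlift ord0 i is Some j then p.2 ord0 j else p.1).

Definition uncons_rV n (x : 'rV[R]_n.+1) : measurableTypeR R * 'rV[R]_n :=
  (x ord0 ord0, \row_j x ord0 (lift ord0 j)).

Lemma cons_rVK n : cancel (@cons_rV n) (@uncons_rV n).
Proof.
move=> [x v]; rewrite /uncons_rV/= !mxE unlift_none; congr pair.
by apply/rowP => j; rewrite !mxE liftK.
Qed.

Lemma measurable_cons_rV n : measurable_fun setT (@cons_rV n).
Proof.
apply: measurable_fun_rVP => i; rewrite /cons_rV.
under eq_fun do rewrite mxE.
case: unliftP => [j _|_].
- exact: measurableT_comp (@measurable_coord_rV R n j) measurable_snd.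
- exact: measurable_fst.
Qed.

Lemma measurable_uncons_rV n : measurable_fun setT (@uncons_rV n).
Proof.
apply/measurable_fun_pair; first exact: measurable_coord_rV.
apply: measurable_fun_rVP => j.
under eq_fun do rewrite mxE.
exact: measurable_coord_rV.
Qed.

Section step.
Context (n : nat) (mu : {sigma_finite_measure set 'rV[R]_n -> \bar R}).

Definition cons_measure : set 'rV[R]_n.+1 -> \bar R :=
  pushforward (@lebesgue_measure R \x mu)%E (@cons_rV n).

HB.instance Definition _ := Measure.copy cons_measure
  (measure_function_pushforward__canonical__measure_function_Measure
     (@lebesgue_measure R \x mu)%E (@measurable_cons_rV n)).

Let sigma_finite_cons_measure : sigma_finite setT cons_measure.
Proof.
have [F FT Foo] : sigma_finite setT (@lebesgue_measure R \x mu)%E.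
  have /sigma_finiteP[F [TF ndF Foo]] := sigma_finiteT (@lebesgue_measure R).
  have /sigma_finiteP[G [TG ndG Goo]] := sigma_finiteT mu.
  exists (fun k => F k `*` G k).
    rewrite -setXTT TF TG predeqE => -[x y]; split.
      move=> [/= [k _ Fkx] [l _ Gly]]; exists (maxn k l) => //; split.
      - by move: x Fkx; apply/subsetPset/ndF; rewrite leq_maxl.
      - by move: y Gly; apply/subsetPset/ndG; rewrite leq_maxr.
    by move=> [k _ [/= ? ?]]; split; exists k.
  move=> k; have [? ?] := Foo k; have [? ?] := Goo k.
  split; first exact: measurableX.
  by rewrite product_measure1E// lte_mul_pinfty// ge0_fin_numE.
exists (fun k => @uncons_rV n @^-1` F k).
  by rewrite -preimage_bigcup -FT preimage_setT.
move=> k; have [mF Fk] := Foo k; split.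
  by rewrite -[X in measurable X]setTI; exact: measurable_uncons_rV.
rewrite /cons_measure /pushforward -comp_preimage.
by rewrite (_ : _ \o _ = id) ?preimage_id//; apply/funext => x /=; rewrite cons_rVK.
Qed.

HB.instance Definition _ :=
  @Measure_isSigmaFinite.Build _ _ _ cons_measure sigma_finite_cons_measure.

End step.

Fixpoint lebesgue_rV n : {sigma_finite_measure set 'rV[R]_n -> \bar R} :=
  match n with
  | 0 => @dirac _ 'rV[R]_0 0 R
  | m.+1 => cons_measure (lebesgue_rV m)
  end.

Lemma lebesgue_rV_box n (A : 'I_n -> set R) : (forall i, measurable (A i)) ->
  lebesgue_rV n [set x : 'rV[R]_n | forall i, A i (x ord0 i)]
  = (\prod_(i < n) @lebesgue_measure R (A i))%E.
Proof.
elim: n A => [|n IH] A mA.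
  by rewrite big_ord0/= diracE mem_set// => -[].
rewrite big_ord_recl -IH; last by move=> i; exact: mA.
rewrite -product_measure1E//; first last.
  rewrite (_ : [set _ | _] =
      \bigcap_(i in [set: 'I_n]) ((fun x : 'rV[R]_n => x ord0 i) @^-1` A (lift ord0 i))).
    apply: fin_bigcap_measurable => // i _.
    by rewrite -[X in measurable X]setTI; exact: measurable_coord_rV.
  by apply/seteqP; split => [x Ax i _|x Ax i]; [exact: Ax|exact: (Ax i I)].
  exact: mA.
set B := [set x | _]; set C := _ `*` _.
suff -> : C = @cons_rV n @^-1` B by [].
apply/esym/seteqP; split => -[x v] /=.
  move=> Axv; split; first by have := Axv ord0; rewrite mxE unlift_none.
  by move=> i; have := Axv (lift ord0 i); rewrite mxE liftK.
move=> [/= Ax Av] i; rewrite mxE; case: unliftP => [j ->|->//]; exact: Av.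
Qed.

End lebesgue_rV.

Section defs.
Context (R : realType) (N : nat).
Local Notation V := 'rV[R]_N.
Local Notation leb := (@lebesgue_rV R N).
Implicit Types (Omega D : set V) (u phi psi : V -> R).

(* The norm carried by 'rV[R]_N in the library is the sup norm. *)
Definition dotv (x y : V) : R := \sum_(i < N) x ord0 i * y ord0 i.
Definition euclid (x : V) : R := Num.sqrt (dotv x x).

Definition domain Omega := [/\ open Omega, connected Omega & Omega !=set0].

Definition bdry Omega := closure Omega `\` Omega°.

Definition unitv (i : 'I_N) : V := delta_mx ord0 i.

(* d_[:: i; j] psi = d_i (d_j psi) *)
Definition partial (s : seq 'I_N) psi : V -> R :=
  foldr (fun i (g : V -> R) => 'D_(unitv i) g) psi s.

Definition smooth psi := forall s : seq 'I_N,
  continuous (partial s psi) /\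
  forall i x, derivable (partial s psi) x (unitv i).

Definition test_function Omega psi :=
  [/\ smooth psi, compact (closure [set x | psi x != 0])
    & closure [set x | psi x != 0] `<=` Omega].

(* f restricted to D is in L^p(D); as f is only required to be a.e. equal to a
   Borel function, all Lebesgue measurable representatives are allowed. *)
Definition Lp (p : \bar R) D (f : V -> R) :=
  exists2 g, g \in Lfun leb p & {ae leb, forall x, D x -> g x = f x}.

Definition Lp_loc (p : \bar R) Omega (f : V -> R) :=
  forall K : set V, compact K -> K `<=` Omega -> Lp p K f.

Definition Linfty_loc_closure Omega (f : V -> R) :=
  forall r : R, 0 < r -> Lp +oo%E (Omega `&` [set x | euclid x < r]) f.

Definition is_weak_partial Omega (s : seq 'I_N) u (g : V -> R) :=
  [/\ Lp_loc 1%E Omega u, Lp_loc 1%E Omega g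
    & forall psi, test_function Omega psi ->
      \int[leb]_(x in Omega) (u x * partial s psi x)
      = (-1) ^+ size s * \int[leb]_(x in Omega) (g x * psi x)].

(* A representative of the weak derivative, which is unique a.e. in Omega *)
Definition weak_partial Omega (s : seq 'I_N) u : V -> R :=
  xget (fun=> 0) [set g | is_weak_partial Omega s u g].

(* By the Sobolev embedding, every class in W^{2,N}_loc has a unique continuous
   representative: that one is used, so that pointwise conditions make sense. *)
Definition W2N_loc Omega u :=
  {within Omega, continuous u} /\
  forall s : seq 'I_N, (size s <= 2)%N ->
    exists2 g, is_weak_partial Omega s u g & Lp_loc (N%:R)%:E Omega g.

Section operator.
Variables (Omega : set V) (a : V -> 'M[R]_N) (b : V -> V) (c : V -> R).

Definition elliptic_operator :=
  [/\ forall x, closure Omega x -> (a x)^T = a x,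
      forall i j, {within closure Omega, continuous (fun x => a x i j)},
      forall x, closure Omega x -> forall l, eigenvalue (a x) l -> 0 < l,
      forall i, Linfty_loc_closure Omega (fun x => b x ord0 i)
    & Linfty_loc_closure Omega c].

Definition Lop u (x : V) : R :=
  \sum_(i < N) \sum_(j < N) a x i j * weak_partial Omega [:: i; j] u x
  + \sum_(i < N) b x ord0 i * weak_partial Omega [:: i] u x
  + c x * u x.

Definition lambda1' : \bar R := ereal_inf [set l%:E | l in
  [set l : R | exists phi, [/\ W2N_loc Omega phi, Lp +oo%E Omega phi,
    forall x, Omega x -> 0 < phi x,
    {ae leb, forall x, Omega x -> 0 <= Lop phi x + l * phi x}
  & forall xi, bdry Omega xi ->
      phi x @[x --> within Omega (nbhs xi)] --> 0]]].

Definition lambda1'' : \bar R := ereal_sup [set l%:E | l in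
  [set l : R | exists phi, [/\ W2N_loc Omega phi,
    (0 < ereal_inf [set (phi x)%:E | x in Omega])%E
  & {ae leb, forall x, Omega x -> Lop phi x + l * phi x <= 0}]]].

Definition maximum_principle := forall u, W2N_loc Omega u ->
  {ae leb, forall x, Omega x -> 0 <= Lop u x} ->
  (ereal_sup [set (u x)%:E | x in Omega] < +oo)%E ->
  (forall xi, bdry Omega xi ->
    (limf_esup (EFin \o u) (within Omega (nbhs xi)) <= 0)%E) ->
  forall x, Omega x -> u x <= 0.

End operator.

Definition ess_sup_on D (f : V -> R) : \bar R :=
  ess_sup leb (fun x => if x \in D then (f x)%:E else -oo%E).

(* (essential) upper limits as |x| -> +oo, x in Omega; both are -oo when
   Omega is bounded *)
Definition limsup_infty Omega (f : V -> R) : \bar R := ereal_inf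
  [set ereal_sup [set (f x)%:E | x in Omega `&` [set x | r < euclid x]]
  | r in [set: R]].

Definition ess_limsup_infty Omega (f : V -> R) : \bar R := ereal_inf
  [set ess_sup_on (Omega `&` [set x | r < euclid x]) f | r in [set: R]].

End defs.

(* Main.v *)
Require Import Defs.
From mathcomp Require Import all_boot all_order all_algebra.
From mathcomp Require Import all_classical all_reals all_analysis.
From mathcomp Require Import measurable_realfun ess_sup_inf ring lra.
Set Implicit Arguments.
Unset Strict Implicit.
Unset Printing Implicit Defensive.
Import Order.TTheory GRing.Theory Num.Theory.
Import numFieldNormedType.Exports.
Local Open Scope classical_set_scope.
Local Open Scope ring_scope.

(** Necessity is a direct test: a function admissible for [lambda1'] with a
negative [lambda] is a bounded positive subsolution that tends to zero at the
boundary, which the maximum principle forbids.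

For sufficiency, let [phi] be admissible for [lambda1''] with some [l > 0], so
that [phi] is a supersolution with a positive lower bound, and let [u] be a
subsolution that is positive somewhere. The growth of the coefficients gives
[L chi <= C chi] for [chi = 1 + |x|^2] (lemma [chi_growth]). Choose an integer
[k > C / l]. The ratio [u^(k+1) / (phi^k chi)] does not approach its positive
values near the boundary, where [limsup u <= 0], nor at infinity, where [chi]
blows up while [u] is bounded above; so it has a maximum point [x0]
([exists_max_ratio]). By the weighted arithmetic-geometric inequality, being
maximal there means that [u <= p phi + q chi], with equality at [x0], for
weights [p] and [q] such that [p phi : q chi = k : 1] at [x0]
([le_combination_of_max_ratio]). The nonnegative function
[W = p phi + q chi - u] therefore vanishes at [x0], whereas
[L W <= - l p phi + C q chi], which is negative near [x0] because [k > C / l].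

What is left is a strong minimum principle for functions whose second
derivatives are only in [L^N] (theorem [no_touching]). It is the
Alexandrov-Bakelman-Pucci argument, carried out on mollifications. Adding a
small paraboloid to [W] makes the minimum at [x0] strict; after mollification
the function [P] is regular, and every vector [p] of a small cube of side
[2 eta] is the slope of an affine function that touches [P] from below near
[x0] ([exists_contact]). At a contact point the gradient is small and the
Hessian [D] is nonnegative, so that the differential inequality at a nearby
point [z], whose coefficients are bounded, bounds the trace of [D] by the error
made at [z] in replacing the derivatives by their mollifications; the sign of
[L W] absorbs all the other errors. In a cell of a fine grid the contact slopes
differ by at most the trace of [D] times the side of the cell
([contact_slope_le]), hence they occupy a cube whose volume is at most the
integral over the cell of the [N]-th power of that error. Adding up the cells
([grid_cover]) bounds the fixed number [(2 eta)^N] by the [L^N] distance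
between the weak derivatives and their mollifications, which tends to zero
([Lp_err_mollify]).

The mollifiers belong to an algebra of functions built from
[t |-> P (1/t) exp (- 1/t)], with [P] a polynomial, on which derivatives of all
orders and Taylor estimates are obtained by induction. *)

(** * Nonnegative matrices and coercivity *)

Section linear_algebra.
Variable R : realType.

(** The Frobenius product of two matrices; with the coefficients of the
operator and a Hessian as arguments it is the second-order part, and with
[fun i j => y i * y j] it is the quadratic form at [y]. *)
Definition contract n (A D : 'I_n -> 'I_n -> R) : R :=
  \sum_(i < n) \sum_(j < n) A i j * D i j.

Definition psd n (D : 'I_n -> 'I_n -> R) :=
  forall y : 'I_n -> R, 0 <= contract (fun i j => y i * y j) D.

(** Completing the square in the first variable: what remains of [A] is its
Schur complement. *)
Lemma contract_schur n (A D : 'I_n.+1 -> 'I_n.+1 -> R) :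
  (forall i j, A i j = A j i) -> A ord0 ord0 != 0 ->
  contract A D = (A ord0 ord0)^-1 * contract (fun i j => A i ord0 * A j ord0) D
    + contract (fun i j : 'I_n => A (lift ord0 i) (lift ord0 j)
         - A (lift ord0 i) ord0 * A (lift ord0 j) ord0 / A ord0 ord0)
       (fun i j => D (lift ord0 i) (lift ord0 j)).
Proof.
move=> sA A0; apply/eqP; rewrite addrC -subr_eq; apply/eqP.
transitivity (contract (fun i j => A i j - A i ord0 * A j ord0 / A ord0 ord0) D).
  rewrite /contract mulr_sumr -sumrB; apply: eq_bigr => i _.
  rewrite mulr_sumr -sumrB; apply: eq_bigr => j _; ring.
rewrite {1}/contract big_ord_recl big1 ?add0r; last first.
  by move=> j _; rewrite [A j ord0]sA mulrAC divff// mul1r subrr mul0r.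
apply: eq_bigr => i _; rewrite big_ord_recl mulfK// subrr mul0r add0r.
by [].
Qed.

(** The trace of a product of nonnegative matrices is nonnegative. The
induction splits [A] into a rank-one part, on which the claim is the
nonnegativity of a quadratic form, and a Schur complement of smaller size. *)
Lemma contract_psd_ge0 n (A D : 'I_n -> 'I_n -> R) :
  (forall i j, A i j = A j i) ->
  (forall y : 'I_n -> R, (exists i, y i != 0) ->
     0 < contract A (fun i j => y i * y j)) ->
  psd D -> 0 <= contract A D.
Proof.
elim: n A D => [|n IH] A D sA pA pD; first by rewrite /contract big_ord0.
have A0 : 0 < A ord0 ord0.
  have /pA : exists i : 'I_n.+1, (i == ord0)%:R != 0 :> R.
    by exists ord0; rewrite eqxx oner_neq0.
  rewrite /contract big_ord_recl big_ord_recl !eqxx !mulr1 big1 ?addr0.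
    by rewrite big1 ?addr0// => i _; rewrite big1// => j _; rewrite mul0r mulr0.
  by move=> j _; rewrite mulr0 mulr0.
rewrite contract_schur// ?gt_eqF// addr_ge0// ?mulr_ge0 ?invr_ge0 ?(ltW A0)//.
apply: IH => [i j|y [k yk]|y].
- by rewrite sA [A (lift ord0 i) ord0 * _]mulrC.
- pose s := \sum_(i < n) A (lift ord0 i) ord0 * y i.
  (* The first coordinate that minimizes the quadratic form of [A] when the other
     ones are [y]; the minimum is the quadratic form of the Schur complement. *)
  pose z i := if unlift ord0 i is Some j then y j else - (s / A ord0 ord0).
  have zl i : z (lift ord0 i) = y i by rewrite /z liftK.
  have z0 : z ord0 = - (s / A ord0 ord0) by rewrite /z unlift_none.
  have /pA : exists i, z i != 0 by exists (lift ord0 k); rewrite zl.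
  rewrite contract_schur// ?gt_eqF//.
  rewrite [X in _ * X](_ : _ = (\sum_i A i ord0 * z i) ^+ 2); last first.
    rewrite expr2 big_distrlr/=; apply: eq_bigr => i _; apply: eq_bigr => j _.
    ring.
  rewrite big_ord_recl z0 (eq_bigr (fun i => A (lift ord0 i) ord0 * y i)).
    rewrite mulrN [A ord0 ord0 * (s / _)]mulrC divfK ?gt_eqF// addNr expr0n/=.
    rewrite mulr0 add0r.
    congr (_ < _); apply: eq_bigr => i _; apply: eq_bigr => j _.
    by rewrite !zl.
  by move=> i _; rewrite zl.
- have := pD (fun i => if unlift ord0 i is Some j then y j else 0).
  congr (_ <= _); rewrite /contract big_ord_recl big1 ?add0r => [|j _]; last first.
    by rewrite unlift_none/= !mul0r.
  apply: eq_bigr => i _; rewrite big_ord_recl unlift_none/= mulr0 mul0r add0r.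
  by apply: eq_bigr => j _; rewrite !liftK.
Qed.

Lemma psd_diag_ge0 n (D : 'I_n -> 'I_n -> R) i : psd D -> 0 <= D i i.
Proof.
move=> /(_ (fun k => (k == i)%:R)); congr (_ <= _).
rewrite /contract (bigD1 i)//= [X in _ + X]big1 ?addr0.
  rewrite (bigD1 i)//= !eqxx !mul1r big1 ?addr0// => j /negPf ->.
  by rewrite mulr0 mul0r.
by move=> k /negPf kj; rewrite big1// => j _; rewrite kj !mul0r.
Qed.

(** Test the quadratic form on the sum and on the difference of two basis
vectors. *)
Lemma psd_offdiag n (D : 'I_n -> 'I_n -> R) i j : psd D ->
  `|D i j + D j i| <= D i i + D j j.
Proof.
move=> pD; have [->|ij] := eqVneq i j.
  by rewrite ger0_norm// addr_ge0// psd_diag_ge0.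
have H s : contract (fun k l => ((k == i)%:R + s * (k == j)%:R) *
    ((l == i)%:R + s * (l == j)%:R)) D
    = D i i + s ^+ 2 * D j j + s * (D i j + D j i).
  have sumE (f : 'I_n -> R) : \sum_k ((k == i)%:R + s * (k == j)%:R) * f k
      = f i + s * f j.
    have ji : (j == i) = false by rewrite eq_sym (negPf ij).
    rewrite (bigD1 i)//= (bigD1 j) ?ji//= big1 ?addr0; last first.
      by move=> k /andP[/negPf -> /negPf ->]; rewrite mulr0 addr0 mul0r.
    by rewrite !eqxx (negPf ij) mulr0 addr0 add0r mulr1 mul1r.
  rewrite /contract; under eq_bigr => k _.
    under eq_bigr => l _ do rewrite -mulrA.
    rewrite -mulr_sumr sumE; over.
  rewrite sumE; ring.
have := pD (fun k => (k == i)%:R + 1 * (k == j)%:R).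
have := pD (fun k => (k == i)%:R + (-1) * (k == j)%:R).
rewrite !H ler_norml sqrrN expr1n => h1 h2; apply/andP; split; lra.
Qed.

Definition trace n (D : 'I_n -> 'I_n -> R) := \sum_(i < n) D i i.

Lemma psd_diag_le_trace n (D : 'I_n -> 'I_n -> R) i : psd D ->
  D i i <= trace D.
Proof.
move=> pD; rewrite /trace (bigD1 i)//= lerDl sumr_ge0// => j _.
exact: psd_diag_ge0.
Qed.

Lemma psd_trace_ge0 n (D : 'I_n -> 'I_n -> R) : psd D -> 0 <= trace D.
Proof. by move=> pD; rewrite sumr_ge0// => j _; exact: psd_diag_ge0. Qed.

Lemma psd_quad_le n (D : 'I_n -> 'I_n -> R) (y : 'I_n -> R) (r : R) : psd D ->
  (forall i, `|y i| <= r) ->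
  contract (fun i j => y i * y j) D <= r ^+ 2 * n%:R ^+ 2 * trace D.
Proof.
move=> pD yr.
apply: (@le_trans _ _ (\sum_(i < n) \sum_(j < n) r ^+ 2 * trace D)); last first.
  by rewrite !sumr_const card_ord -mulrnA -[leLHS]mulr_natr natrM; lra.
rewrite [leLHS](_ : _ = \sum_(i < n) \sum_(j < n)
    y i * y j * ((D i j + D j i) / 2)); last first.
  under [RHS]eq_bigr => i _ do under eq_bigr => j _ do
    rewrite mulrDl mulrDr.
  under [RHS]eq_bigr => i _ do rewrite big_split/=.
  rewrite big_split/= [X in _ + X]exchange_big/= -big_split/=.
  apply: eq_bigr => i _; rewrite -big_split/=.
  by apply: eq_bigr => j _; field.
apply: ler_sum => i _; apply: ler_sum => j _.
apply: le_trans (ler_norm _) _; rewrite normrM.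
have r0 : 0 <= r by apply: le_trans (yr i); rewrite normr_ge0.
apply: ler_pM => //.
  by rewrite normrM expr2 ler_pM.
rewrite normrM [X in _ * X]ger0_norm ?invr_ge0// ler_pdivrMr//.
apply: le_trans (psd_offdiag _ _ pD) _.
by rewrite mulr_natr mulr2n lerD// psd_diag_le_trace.
Qed.

(** The entries of a nonnegative matrix are dominated by its trace, so the
second-order part depends on the coefficients in a way controlled by the trace
of the Hessian alone. *)
Lemma contract_perturb n (A A0 D : 'I_n -> 'I_n -> R) (e : R) : psd D ->
  (forall i j, A i j = A j i) -> (forall i j, A0 i j = A0 j i) ->
  (forall i j, `|A i j - A0 i j| <= e) ->
  contract A0 D - e * n%:R ^+ 2 * trace D <= contract A D.
Proof.
move=> pD sA sA0 AA0; rewrite lerBlDl -lerBlDr.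
have -> : contract A0 D - contract A D =
    \sum_(i < n) \sum_(j < n) (A0 i j - A i j) * ((D i j + D j i) / 2).
  under [RHS]eq_bigr => i _ do under eq_bigr => j _ do
    rewrite [X in _ * X]mulrDl mulrDr.
  under [RHS]eq_bigr => i _ do rewrite big_split/=.
  rewrite [RHS]big_split/= [X in _ = _ + X]exchange_big/= -big_split/=.
  rewrite -sumrB; apply: eq_bigr => i _; rewrite -big_split/= -sumrB.
  by apply: eq_bigr => j _; rewrite (sA j) (sA0 j); field.
apply: (@le_trans _ _ (\sum_(i < n) \sum_(j < n) e * trace D)).
  apply: ler_sum => i _; apply: ler_sum => j _.
  apply: le_trans (ler_norm _) _; rewrite normrM ler_pM// 1?distrC//.
  rewrite normrM [X in _ * X]ger0_norm ?invr_ge0// ler_pdivrMr//.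
  apply: le_trans (psd_offdiag _ _ pD) _.
  by rewrite mulr_natr mulr2n lerD// psd_diag_le_trace.
by rewrite !sumr_const card_ord -mulrnA -[leLHS]mulr_natr natrM; lra.
Qed.

(** Apply [contract_psd_ge0] to [A - m/2], which is still positive
definite. *)
Lemma contract_ge_trace n (A D : 'I_n -> 'I_n -> R) (m : R) :
  (forall i j, A i j = A j i) -> 0 < m ->
  (forall y : 'I_n -> R,
     m * \sum_(i < n) y i ^+ 2 <= contract A (fun i j => y i * y j)) ->
  psd D -> m / 2 * trace D <= contract A D.
Proof.
move=> sA m0 mA pD.
pose B i j := A i j - m / 2 * (i == j)%:R.
have BE (E : 'I_n -> 'I_n -> R) : contract B E = contract A E - m / 2 * trace E.
  rewrite /contract /trace mulr_sumr -sumrB; apply: eq_bigr => i _.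
  under eq_bigr => j _ do rewrite mulrBl.
  rewrite sumrB; congr (_ - _); rewrite (bigD1 i)//= eqxx mulr1 big1 ?addr0//.
  by move=> j /negPf; rewrite eq_sym => ->; rewrite mulr0 mul0r.
rewrite -subr_ge0 -BE; apply: contract_psd_ge0 => // [i j|y [k yk]].
  by rewrite /B sA eq_sym.
rewrite BE subr_gt0; apply: lt_le_trans (mA y).
rewrite /trace (eq_bigr (fun i => y i ^+ 2))//.
have ? : m / 2 < m by lra.
rewrite ltr_pM2r// (bigD1 k)//= ltr_pwDl//; first by rewrite exprn_even_gt0.
by rewrite sumr_ge0// => i _; rewrite sqr_ge0.
Qed.

Lemma cvg_sumr (T : Type) (F : set_system T) {FF : Filter F} n
    (f : 'I_n -> T -> R) (l : 'I_n -> R) :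
  (forall i, f i x @[x --> F] --> l i) ->
  \sum_(i < n) f i x @[x --> F] --> \sum_(i < n) l i.
Proof.
elim: n f l => [|n IH] f l fl.
  rewrite big_ord0; under eq_fun do rewrite big_ord0; exact: cvg_cst.
rewrite big_ord_recl; under eq_fun do rewrite big_ord_recl.
by apply: cvgD; [exact: fl|apply: IH => i; exact: fl].
Qed.

Lemma continuous_sumr (T : topologicalType) n (f : 'I_n -> T -> R) :
  (forall i, continuous (f i)) -> continuous (fun x => \sum_(i < n) f i x).
Proof. by move=> cf x; apply: cvg_sumr => i; exact: cf. Qed.

Lemma continuous_coord n (i : 'I_n) : continuous (fun y : 'rV[R]_n => y ord0 i).
Proof. exact: coord_continuous. Qed.

Lemma continuous_mulr (T : topologicalType) (f g : T -> R) :
  continuous f -> continuous g -> continuous (fun x => f x * g x).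
Proof. by move=> cf cg x; apply: cvgM; [exact: cf|exact: cg]. Qed.

Lemma rV_norm_le n (y : 'rV[R]_n) (r : R) : 0 <= r ->
  (forall i, `|y ord0 i| <= r) -> `|y| <= r.
Proof.
move=> r0 yr; rewrite [leLHS]/Num.norm/= mx_normrE.
by apply: bigmax_le => // -[i j] _ /=; rewrite ord1.
Qed.

Lemma coord_norm_le n (y : 'rV[R]_n) i : `|y ord0 i| <= `|y|.
Proof.
rewrite [leRHS]/Num.norm/= mx_normrE.
exact: (le_bigmax _ (fun ij => `|y ij.1 ij.2|) (ord0, i)).
Qed.

Lemma linear_coef_eq0 (a C s : R) : 0 < s ->
  (forall t, `|t| <= s -> 0 <= t * a + C * t ^+ 2) -> a = 0.
Proof.
move=> s0 H; apply/eqP/negPn/negP => a0.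
have na : 0 < `|a| by rewrite normr_gt0.
pose k := Num.min (s / `|a|) (2 * (`|C| + 1))^-1.
have C1 : 0 < 2 * (`|C| + 1) by rewrite mulr_gt0// ltr_wpDl.
have k0 : 0 < k by rewrite lt_min divr_gt0// invr_gt0.
have /H : `|- (a * k)| <= s.
  by rewrite normrN normrM (gtr0_norm k0) mulrC -ler_pdivlMr// ge_min lexx.
rewrite (_ : _ + _ = (k * a ^+ 2) * (C * k - 1)); last by ring.
apply/negP; rewrite -ltNge pmulr_rlt0; last by rewrite mulr_gt0// exprn_even_gt0.
have : k * (2 * (`|C| + 1)) <= 1.
  by rewrite -ler_pdivlMr// div1r ge_min lexx orbT.
have := ler_wpM2r (ltW k0) (ler_norm C); lra.
Qed.

(** The minimum of the Rayleigh quotient is attained, by compactness of the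
sphere, and the vanishing of its first variation says that it is an
eigenvalue. *)
Lemma sym_eigenvalue_coercive n (M : 'M[R]_n) : M^T = M ->
  (forall l, eigenvalue M l -> 0 < l) ->
  exists2 m : R, 0 < m & forall y : 'I_n -> R,
    m * \sum_(i < n) y i ^+ 2 <= contract M (fun i j => y i * y j).
Proof.
case: n M => [|n] M sM eM.
  by exists 1 => // y; rewrite /contract !big_ord0 mulr0.
pose q (y : 'rV[R]_n.+1) := contract M (fun i j => y ord0 i * y ord0 j).
pose nrm (y : 'rV[R]_n.+1) := \sum_(i < n.+1) y ord0 i * y ord0 i.
have cnrm : continuous nrm.
  apply: continuous_sumr => i.
  by apply: continuous_mulr; exact: continuous_coord.
have cq : continuous q.
  apply: continuous_sumr => i; apply: continuous_sumr => j.
  apply: continuous_mulr; first exact: cst_continuous.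
  by apply: continuous_mulr; exact: continuous_coord.
pose S := [set y : 'rV[R]_n.+1 | nrm y = 1].
have S0 : S !=set0.
  exists (delta_mx ord0 ord0); rewrite /S/= /nrm big_ord_recl big1 ?addr0.
    by rewrite mxE !eqxx mulr1.
  by move=> i _; rewrite mxE andbC/= mulr0.
have cS : compact S.
  apply: bounded_closed_compact.
    exists 1; split => // e e1 y Sy; apply/ltW; apply: le_lt_trans e1.
    apply: rV_norm_le => // j.
    rewrite -(@expr_le1 _ 2)// real_normK ?num_real// -Sy /nrm (bigD1 j)//=.
    by rewrite expr2 lerDl sumr_ge0// => k _; rewrite -expr2 sqr_ge0.
  rewrite (_ : S = nrm @^-1` [set 1]) //.
  apply: preimage_closed => // y _; exact: cnrm.
have [z zS qz] := EVT_min_rV S0 cS (continuous_subspaceT cq).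
rewrite inE /S/= in zS.
have qhom t (y : 'rV[R]_n.+1) : q (t *: y) = t ^+ 2 * q y.
  rewrite /q /contract mulr_sumr; apply: eq_bigr => i _; rewrite mulr_sumr.
  by apply: eq_bigr => j _; rewrite !mxE; ring.
have nhom t (y : 'rV[R]_n.+1) : nrm (t *: y) = t ^+ 2 * nrm y.
  rewrite /nrm mulr_sumr; apply: eq_bigr => i _; rewrite !mxE; ring.
have nrm_ge0 y : 0 <= nrm y by rewrite sumr_ge0// => i _; rewrite -expr2 sqr_ge0.
have qge (y : 'rV[R]_n.+1) : q z * nrm y <= q y.
  have [y0|y0] := eqVneq (nrm y) 0.
    rewrite y0 mulr0 (_ : y = 0).
      by have := qhom 0 0; rewrite scale0r expr0n mul0r => ->.
    apply/rowP => i; rewrite mxE; apply/eqP; rewrite -sqrf_eq0 expr2.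
    apply/eqP; apply: (psumr_eq0P _ y0) => // j _; rewrite -expr2; exact: sqr_ge0.
  have yp : 0 < nrm y by rewrite lt_def y0 nrm_ge0.
  pose t := (Num.sqrt (nrm y))^-1.
  have t2 : t ^+ 2 = (nrm y)^-1 by rewrite exprVn sqr_sqrtr.
  have := qz (t *: y); rewrite inE /S/= nhom t2 mulVf// => /(_ erefl).
  by rewrite qhom t2 ler_pdivlMl// mulrC.
exists (q z); last first.
  move=> y; have := qge (\row_i y i); rewrite /nrm /q.
  congr (_ * _ <= _); first by apply: eq_bigr => i _; rewrite mxE.
  by apply: eq_bigr => i _; apply: eq_bigr => j _; rewrite !mxE.
apply: eM; apply/eigenvalueP; exists z; last first.
  apply: contra_eq_neq zS => ->.
  rewrite /nrm big1 1?eq_sym ?oner_neq0// => i _; by rewrite mxE mulr0.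
apply/rowP => k; rewrite !mxE.
set L := \sum_j _.
have sMij i j : M i j = M j i by rewrite -{1}sM mxE.
(* First variation of the Rayleigh quotient at its minimum [z], in the direction
   of the k-th axis: the linear coefficient has to vanish. *)
have H t : 0 <= 2 * t * (L - q z * z ord0 k) + t ^+ 2 * (M k k - q z).
  have := qge (z + t *: delta_mx ord0 k).
  have -> : nrm (z + t *: delta_mx ord0 k) = nrm z + 2 * t * z ord0 k + t ^+ 2.
    rewrite /nrm (bigD1 k)//= [in RHS](bigD1 k)//= !mxE !eqxx/= mulr1.
    rewrite (eq_bigr (fun i => z ord0 i * z ord0 i)); first ring.
    by move=> i /negPf ik; rewrite !mxE ik andbF mulr0 addr0.
  have -> : q (z + t *: delta_mx ord0 k) = q z + 2 * t * L + t ^+ 2 * M k k.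
    have sumE (f : 'I_n.+1 -> R) : \sum_i f i * (i == k)%:R = f k.
      rewrite (bigD1 k)//= eqxx mulr1 big1 ?addr0// => i /negPf ->.
      by rewrite mulr0.
    have LE : \sum_i \sum_j M i j * ((i == k)%:R * z ord0 j) = L.
      under eq_bigr => i _ do
        (under eq_bigr => j _ do rewrite mulrCA; rewrite -mulr_sumr mulrC).
      by rewrite sumE; apply: eq_bigr => j _; rewrite sMij mulrC.
    have LE' : \sum_i \sum_j M i j * (z ord0 i * (j == k)%:R) = L.
      by apply: eq_bigr => i _; under eq_bigr => j _ do rewrite mulrA;
        rewrite sumE mulrC.
    have ME : \sum_i \sum_j M i j * ((i == k)%:R * (j == k)%:R) = M k k.
      under eq_bigr => i _ do
        (under eq_bigr => j _ do rewrite mulrA; rewrite sumE).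
      exact: sumE.
    rewrite (_ : 2 * t * L = t * L + t * L); last by ring.
    rewrite -{1}LE -LE' -ME /q /contract !mulr_sumr -!big_split/=.
    apply: eq_bigr => i _; rewrite !mulr_sumr -!big_split/=.
    by apply: eq_bigr => j _; rewrite !mxE/=; ring.
  rewrite zS -subr_ge0; congr (_ <= _); ring.
have /eqP : 2 * (L - q z * z ord0 k) = 0.
  apply: (@linear_coef_eq0 _ (M k k - q z) 1 ltr01) => t _.
  by apply: le_trans (H t) _; rewrite le_eqVlt; apply/orP; left; apply/eqP; ring.
by rewrite mulf_eq0 pnatr_eq0/= subr_eq0 => /eqP.
Qed.

End linear_algebra.

(** * An algebra of flat smooth functions *)

Section flat_functions.
Variable R : realType.
Implicit Types (P : {poly R}) (t : R).

(** These functions are smooth, including at the origin, because the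
exponential beats every power of [t^-1]. *)
Definition flat P t : R := if 0 < t then P.[t^-1] * expR (- t^-1) else 0.

Lemma expr_expRN_le (s : R) n : 0 <= s -> s ^+ n * expR (- s) <= n`!%:R.
Proof.
move=> s0; rewrite expRN ler_pdivrMr ?expR_gt0//.
case: n => [|n]; first by rewrite expr0 mul1r -expR0 ler_expR.
rewrite mulrC -ler_pdivrMr ?ltr0n ?fact_gt0//.
by apply: le_trans (expR_ge1Dxn n s0); rewrite lerDr.
Qed.

Lemma flat_bounded P : exists C, forall t, `|flat P t| <= C.
Proof.
exists (\sum_(i < size P) `|P`_i| * i`!%:R) => t; rewrite /flat.
case: ifPn => t0; last first.
  by rewrite normr0 sumr_ge0// => i _; rewrite mulr_ge0.
rewrite horner_coef mulr_suml; apply: le_trans (ler_norm_sum _ _ _) _.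
apply: ler_sum => i _; rewrite -mulrA normrM ler_wpM2l//.
have ti0 : 0 <= t^-1 by rewrite invr_ge0 ltW.
rewrite ger0_norm; first exact: expr_expRN_le.
by apply: mulr_ge0; [exact: exprn_ge0|exact: expR_ge0].
Qed.

(** A factor [t] can be extracted at will; two of them give the quadratic bound
that makes every flat function differentiable at the origin. *)
Lemma flat_mulX P t : flat P t = t * flat ('X * P) t.
Proof.
rewrite /flat; case: ifPn => t0; last by rewrite mulr0.
by rewrite hornerM hornerX !mulrA divff ?gt_eqF// mul1r.
Qed.

Definition flat_deriv P := 'X^2 * (P - P^`()).

Lemma is_derive_quadratic0 (f : R -> R) (C : R) : f 0 = 0 ->
  (forall t, `|f t| <= C * t ^+ 2) -> is_derive (0 : R) 1 f 0.
Proof.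
move=> f0 fC.
have H : (fun h : R => h^-1 *: ((f \o shift 0) (h *: 1) - f 0)) @ 0^' --> (0 : R).
  apply/cvgr0Pnorm_le => e e0.
  have C1 : 0 < (`|C| + 1)^-1 * e by rewrite mulr_gt0// invr_gt0 ltr_wpDl.
  near=> h.
  have h0 : h != 0 by near: h; exact: nbhs_dnbhs_neq.
  rewrite /= addr0 [h *: _]mulr1 f0 subr0 [_ *: _]/(_ * _) normrM normfV.
  rewrite ler_pdivrMl ?normr_gt0//.
  apply: le_trans (fC h) _; rewrite -real_normK ?num_real// expr2 mulrCA.
  rewrite ler_wpM2l//; apply: (@le_trans _ _ ((`|C| + 1) * `|h|)).
    by rewrite ler_wpM2r//; apply: le_trans (ler_norm _) _; rewrite lerDl.
  rewrite -ler_pdivlMl ?ltr_wpDl//; near: h.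
  exact: dnbhs0_le.
by apply: DeriveDef; [apply/cvg_ex; exists 0|exact/cvg_lim].
Unshelve. all: by end_near. Qed.

Lemma is_derive_flat P t : is_derive t 1 (flat P) (flat (flat_deriv P) t).
Proof.
have [t0|t0|->] := ltgtP t 0.
- rewrite [X in is_derive _ _ _ X]/flat ltNge (ltW t0)/=.
  apply: (@near_eq_is_derive _ _ _ (cst 0)).
  near=> s; rewrite /flat/= ifF//; apply/negbTE; rewrite -leNgt ltW//.
  by near: s; exact: lt_nbhsl.
- have dV : is_derive t 1 (fun s : R => s^-1) (- t ^- 2).
    have := @is_deriveV R id t 1 1; rewrite gt_eqF// => /(_ isT (is_derive_id _ _)).
    by rewrite [_ *: _]mulr1.
  have dP := @is_derive1_comp R (horner P) (fun s : R => s^-1) t _ _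
    (is_derive_poly _ _) dV.
  have dN : is_derive t 1 (fun s : R => - s^-1) (t ^- 2).
    by rewrite -[t ^- 2]opprK; exact: is_deriveN.
  have dE := @is_derive1_comp R expR (fun s : R => - s^-1) t _ _
    (is_derive_expR _) dN.
  have d : is_derive t 1 (fun s => P.[s^-1] * expR (- s^-1)) (flat (flat_deriv P) t).
    apply: is_derive_eq; rewrite /flat t0 /flat_deriv !hornerE.
    have sE (x y : R) : x *: (y : R^o) = x * y by [].
    by rewrite !sE exprVn; ring.
  apply: (near_eq_is_derive _ d); near=> s; rewrite /flat ifT//.
  by near: s; exact: lt_nbhsr.
- have [C fC] := flat_bounded ('X * ('X * P)).
  rewrite [flat (flat_deriv _) _]/flat ltxx.
  apply: (@is_derive_quadratic0 _ C); first by rewrite /flat ltxx.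
  move=> s; rewrite flat_mulX flat_mulX mulrA -expr2 normrM mulrC.
  by rewrite [`|s ^+ 2|]ger0_norm ?sqr_ge0// ler_wpM2r ?sqr_ge0.
Unshelve. all: by end_near. Qed.

Lemma continuous_flat P : continuous (flat P).
Proof.
move=> t; apply: differentiable_continuous; apply/derivable1_diffP.
by have [] := is_derive_flat P t.
Qed.

End flat_functions.

Lemma lipschitz_continuousR (R : realType) (V : normedModType R) (F : V -> R)
    (C : R) : 0 < C -> (forall x y, `|F x - F y| <= C * `|x - y|) -> continuous F.
Proof.
move=> C0 FC x; apply/cvgrPdist_le => e e0.
near=> y; apply: le_trans (FC _ _) _; rewrite -ler_pdivlMl//.
near: y; apply: cvgr_dist_le; first exact: cvg_id.
by rewrite mulr_gt0// invr_gt0.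
Unshelve. all: by end_near. Qed.

Section bump_algebra.
Variables (R : realType) (N : nat).
Local Notation V := 'rV[R]_N.
Implicit Types (F G : V -> R) (x y v : V).

(** An inductive description is chosen so that boundedness and stability under
derivatives follow by structural induction. Localized members are obtained as
products, see [box_bump]. *)
Inductive bump_alg : (V -> R) -> Prop :=
| bump_flat i (a b : R) P : bump_alg (fun x => flat P (a * x ord0 i + b))
| bump_cst (r : R) : bump_alg (fun=> r)
| bump_add F G : bump_alg F -> bump_alg G -> bump_alg (fun x => F x + G x)
| bump_mul F G : bump_alg F -> bump_alg G -> bump_alg (fun x => F x * G x).

Lemma bump_sum I (s : seq I) (F : I -> V -> R) :
  (forall i, bump_alg (F i)) -> bump_alg (fun x => \sum_(i <- s) F i x).
Proof.
move=> bF; elim: s => [|i s IH].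
  by under eq_fun do rewrite big_nil; exact: bump_cst.
by under eq_fun do rewrite big_cons; exact: bump_add.
Qed.

Lemma bump_prod I (s : seq I) (F : I -> V -> R) :
  (forall i, bump_alg (F i)) -> bump_alg (fun x => \prod_(i <- s) F i x).
Proof.
move=> bF; elim: s => [|i s IH].
  by under eq_fun do rewrite big_nil; exact: bump_cst.
by under eq_fun do rewrite big_cons; exact: bump_mul.
Qed.

Lemma bump_bounded F : bump_alg F -> exists2 C, 0 < C & forall x, `|F x| <= C.
Proof.
elim=> [i a b P|r|{}F G _ [C C0 FC] _ [C' C'0 GC]|{}F G _ [C C0 FC] _ [C' C'0 GC]].
- have [C PC] := flat_bounded P; exists (`|C| + 1); first by rewrite ltr_wpDl.
  move=> x; apply: le_trans (PC _) _.
  by apply: le_trans (ler_norm _) _; rewrite lerDl.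
- by exists (`|r| + 1); [rewrite ltr_wpDl|move=> _; rewrite lerDl].
- exists (C + C'); first exact: addr_gt0.
  by move=> x; apply: le_trans (ler_normD _ _) _; rewrite lerD.
- exists (C * C'); first exact: mulr_gt0.
  by move=> x; rewrite normrM ler_pM.
Qed.

(** Directional derivatives are reduced to derivatives in one real variable,
where the chain rule and the mean value theorem are available. *)
Lemma is_derive_lineP F x v (l : R) :
  is_derive x v F l <-> is_derive (0 : R) 1 (fun t : R => F (x + t *: v)) l.
Proof.
have E : (fun h => h^-1 *: (((fun t => F (x + t *: v)) \o shift 0) (h *: 1) -
      F (x + 0 *: v))) = (fun h : R => h^-1 *: ((F \o shift x) (h *: v) - F x)).
  apply/funext => h /=.
  by rewrite scale0r !addr0 [h *: 1]mulr1 [x + _]addrC.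
by split=> -[dF <-]; apply: DeriveDef; rewrite /derivable /derive ?E// -E.
Qed.

Lemma bump_deriv F : bump_alg F -> exists2 F' : 'I_N -> V -> R,
  forall i, bump_alg (F' i) &
  forall x v, is_derive x v F (\sum_(i < N) v ord0 i * F' i x).
Proof.
elim=> [i a b P|r|{}F G _ [F' bF' dF] _ [G' bG' dG]|
        {}F G bF [F' bF' dF] bG [G' bG' dG]].
- exists (fun j x => a * (j == i)%:R * flat (flat_deriv P) (a * x ord0 i + b)).
    move=> j; apply: bump_mul; [exact: bump_cst|exact: bump_flat].
  move=> x v; apply/is_derive_lineP.
  have -> : (fun t : R => flat P (a * (x + t *: v) ord0 i + b)) =
      flat P \o (fun t : R => a * v ord0 i * t + (a * x ord0 i + b)).
    by apply/funext => t /=; rewrite !mxE; congr flat; ring.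
  have dL : is_derive (0 : R) 1
      (fun t : R => a * v ord0 i * t + (a * x ord0 i + b)) (a * v ord0 i).
    rewrite -[a * v ord0 i in X in is_derive _ _ _ X]mulr1 -[X in is_derive _ _ _ X]addr0.
    exact: is_deriveD.
  have := is_derive1_comp (is_derive_flat P _) dL.
  rewrite mulr0 add0r; congr is_derive.
  rewrite (bigD1 i)//= eqxx mulr1 big1 ?addr0; first by ring.
  by move=> j /negPf ->; rewrite !(mulr0, mul0r).
- exists (fun _ _ => 0) => [i|x v]; first exact: bump_cst.
  by rewrite big1 => [|i _]; [exact: is_derive_cst|rewrite mulr0].
- exists (fun i x => F' i x + G' i x) => [i|x v]; first exact: bump_add.
  under eq_bigr do rewrite mulrDr; rewrite big_split/=.
  exact: is_deriveD.
- exists (fun i x => F x * G' i x + G x * F' i x) => [i|x v].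
    by apply: bump_add; apply: bump_mul.
  have := is_deriveM (dF x v) (dG x v); congr is_derive.
  rewrite ![_ *: _]mulr_sumr -big_split/=.
  by apply: eq_bigr => i _; ring.
Qed.

Lemma sum_unitv (f : 'I_N -> R) i : \sum_(j < N) unitv R i ord0 j * f j = f i.
Proof.
rewrite (bigD1 i)//= mxE !eqxx mul1r big1 ?addr0// => j /negPf ji.
by rewrite mxE ji andbF mul0r.
Qed.

Lemma is_derive_bump F x v : bump_alg F ->
  is_derive x v F (\sum_(i < N) v ord0 i * partial [:: i] F x).
Proof.
move=> /bump_deriv[F' _ dF]; have := dF x v; congr is_derive.
apply: eq_bigr => i _; congr (_ * _).
by have [_ /= ->] := dF x (unitv R i); rewrite sum_unitv.
Qed.

Lemma bump_partial F s : bump_alg F -> bump_alg (partial s F).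
Proof.
elim: s => [//|i s IH] /IH /bump_deriv[F' bF' dF].
rewrite (_ : partial (i :: s) F = F' i)//; apply/funext => x /=.
by have [_ ->] := dF x (unitv R i); rewrite sum_unitv.
Qed.

Lemma is_derive_bump_line F x v (t : R) : bump_alg F ->
  is_derive t 1 (fun t : R => F (x + t *: v))
    (\sum_(i < N) v ord0 i * partial [:: i] F (x + t *: v)).
Proof.
move=> bF; have := is_derive_bump (x + t *: v) v bF.
move=> /is_derive_lineP dF.
have dF' : is_derive (t - t) 1 (fun s : R => F (x + t *: v + s *: v))
   (\sum_(i < N) v ord0 i * partial [:: i] F (x + t *: v)) by rewrite subrr.
have dS : is_derive t 1 (fun s : R => s - t) 1.
  by rewrite -[X in is_derive _ _ _ X]subr0; exact: is_deriveB.
have := @is_derive1_comp R (fun s : R => F (x + t *: v + s *: v))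
  (fun s : R => s - t) t _ _ dF' dS.
rewrite mulr1; congr is_derive; apply/funext => s /=.
by rewrite -addrA -scalerDl [t + _]addrC subrK.
Qed.

Lemma bump_lipschitz F : bump_alg F ->
  exists2 C, 0 < C & forall x y, `|F x - F y| <= C * `|x - y|.
Proof.
move=> bF; have [C C0 FC] : exists2 C, 0 < C &
    forall i x, `|partial [:: i] F x| <= C.
  have /(_ _)/cid2-/all_sig2[C C0 FC] := fun i =>
    bump_bounded (bump_partial [:: i] bF).
  exists (1 + \sum_i C i); first by rewrite ltr_pwDl// sumr_ge0// => i _; exact/ltW.
  move=> i x; apply: le_trans (FC i x) _; rewrite (bigD1 i)//= addrCA lerDl.
  by rewrite addr_ge0// sumr_ge0// => j _; exact/ltW.
exists (N.+1%:R * C); first by rewrite mulr_gt0.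
move=> x y.
have D (t : R) : is_derive t 1 (fun t : R => F (y + t *: (x - y)))
    (\sum_(i < N) (x - y) ord0 i * partial [:: i] F (y + t *: (x - y))).
  exact: is_derive_bump_line.
have [|c _] := @MVT_segment R (fun t => F (y + t *: (x - y))) _ 0 1 ler01
  (fun t _ => D t).
  apply: derivable_within_continuous => t _; by have [] := D t.
rewrite scale1r scale0r addr0 [y + _]addrC subrK subr0 mulr1 => ->.
apply: le_trans (ler_norm_sum _ _ _) _.
apply: (@le_trans _ _ (\sum_(i < N) `|x - y| * C)).
  by apply: ler_sum => i _; rewrite normrM ler_pM ?coord_norm_le.
rewrite sumr_const card_ord -[leLHS]mulr_natr.
have := mulr_ge0 (normr_ge0 (x - y)) (ltW C0); rewrite -natr1; lra.
Qed.

Lemma bump_taylor1 F : bump_alg F -> exists2 C, 0 < C & forall x v,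
  `|F (x + v) - F x - \sum_(i < N) v ord0 i * partial [:: i] F x|
    <= C * `|v| ^+ 2.
Proof.
move=> bF; have [C C0 FC] : exists2 C, 0 < C &
    forall i x y, `|partial [:: i] F x - partial [:: i] F y| <= C * `|x - y|.
  have /(_ _)/cid2-/all_sig2[C C0 FC] := fun i =>
    bump_lipschitz (bump_partial [:: i] bF).
  exists (1 + \sum_i C i); first by rewrite ltr_pwDl// sumr_ge0// => i _; exact/ltW.
  move=> i x y; apply: le_trans (FC i x y) _; rewrite ler_wpM2r//.
  rewrite (bigD1 i)//= addrCA lerDl.
  by rewrite addr_ge0// sumr_ge0// => j _; exact/ltW.
exists (N.+1%:R * C); first by rewrite mulr_gt0.
move=> x v.
have D (t : R) : is_derive t 1 (fun t : R => F (x + t *: v))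
    (\sum_(i < N) v ord0 i * partial [:: i] F (x + t *: v)).
  exact: is_derive_bump_line.
have [|c] := @MVT_segment R (fun t => F (x + t *: v)) _ 0 1 ler01
  (fun t _ => D t).
  apply: derivable_within_continuous => t _; by have [] := D t.
rewrite in_itv/= => /andP[c0 c1].
rewrite scale1r scale0r addr0 subr0 mulr1 => ->.
rewrite -sumrB; apply: le_trans (ler_norm_sum _ _ _) _.
apply: (@le_trans _ _ (\sum_(i < N) `|v| * (C * `|v|))).
  apply: ler_sum => i _; rewrite -mulrBr normrM ler_pM ?coord_norm_le//.
  apply: le_trans (FC _ _ _) _; rewrite ler_wpM2l ?(ltW C0)//.
  by rewrite addrC addKr normrZ ger0_norm// ler_piMl.
rewrite sumr_const card_ord -[leLHS]mulr_natr.
have := mulr_ge0 (mulr_ge0 (normr_ge0 v) (normr_ge0 v)) (ltW C0).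
rewrite -natr1 expr2; lra.
Qed.

(** The centered second difference has no first-order term, and its third-order
remainder comes from the boundedness of third derivatives, which are again in
the algebra. *)
Lemma bump_taylor2 F : bump_alg F -> exists2 C, 0 < C & forall x v,
  `|F (x + v) + F (x - v) - 2 * F x
    - contract (fun i j => v ord0 i * v ord0 j) (fun i j => partial [:: i; j] F x)|
    <= C * `|v| ^+ 3.
Proof.
move=> bF; have [C C0 FC] : exists2 C, 0 < C & forall i x v,
    `|partial [:: i] F (x + v) - partial [:: i] F x -
      \sum_(j < N) v ord0 j * partial [:: j; i] F x| <= C * `|v| ^+ 2.
  have /(_ _)/cid2-/all_sig2[C C0 FC] := fun i =>
    bump_taylor1 (bump_partial [:: i] bF).
  exists (1 + \sum_i C i); first by rewrite ltr_pwDl// sumr_ge0// => i _; exact/ltW.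
  move=> i x v; apply: le_trans (FC i x v) _; rewrite ler_wpM2r ?exprn_ge0//.
  rewrite (bigD1 i)//= addrCA lerDl.
  by rewrite addr_ge0// sumr_ge0// => j _; exact/ltW.
exists (2 * N.+1%:R * C); first by rewrite !mulr_gt0.
move=> x v; set Q := contract _ _.
have D (t : R) : is_derive t 1 (fun t : R => F (x + t *: v))
    (\sum_(i < N) v ord0 i * partial [:: i] F (x + t *: v)).
  exact: is_derive_bump_line.
have D' (t : R) : is_derive t 1 (fun t : R => F (x + t *: - v))
    (\sum_(i < N) (- v) ord0 i * partial [:: i] F (x + t *: - v)).
  exact: is_derive_bump_line.
have E (t : R) : is_derive t 1
   (fun t : R => F (x + t *: v) + F (x + t *: - v) - Q * (t * t))
   (\sum_(i < N) v ord0 i * partial [:: i] F (x + t *: v) +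
    \sum_(i < N) (- v) ord0 i * partial [:: i] F (x + t *: - v) - Q * (2 * t)).
  have dq : is_derive t 1 (fun t : R => Q * (t * t)) (Q * (2 * t)).
    have := @is_deriveZ _ _ _ _ Q t 1 _
      (@is_deriveM _ _ id id t 1 1 1 (is_derive_id _ _) (is_derive_id _ _)).
    congr is_derive; have tA : t%:A = t :> R by exact: mulr1.
    by rewrite tA (_ : t + t = 2 * t :> R)//; ring.
  exact: is_deriveB.
have [|c] := @MVT_segment R
  (fun t : R => F (x + t *: v) + F (x + t *: - v) - Q * (t * t)) _ 0 1 ler01
  (fun t _ => E t).
  apply: derivable_within_continuous => t _; by have [] := E t.
rewrite in_itv/= => /andP[c0 c1].
rewrite !scale1r !scale0r !addr0 !subr0 !(mulr1, mulr0) subr0.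
set S := _ - Q * (2 * c) => SE.
have -> : F (x + v) + F (x - v) - 2 * F x - Q = S by rewrite -SE; ring.
have -> : S = \sum_(i < N) v ord0 i *
   ((partial [:: i] F (x + c *: v) - partial [:: i] F x -
      \sum_(j < N) (c *: v) ord0 j * partial [:: j; i] F x)
   - (partial [:: i] F (x + c *: - v) - partial [:: i] F x -
      \sum_(j < N) (c *: - v) ord0 j * partial [:: j; i] F x)).
  rewrite /S /Q /contract exchange_big/= mulr_suml -big_split/= -sumrB.
  apply: eq_bigr => i _.
  have -> : \sum_(j < N) (c *: v) ord0 j * partial [:: j; i] F x =
     c * \sum_(j < N) v ord0 j * partial [:: j; i] F x.
    by rewrite mulr_sumr; apply: eq_bigr => j _; rewrite mxE; ring.
  have -> : \sum_(j < N) (c *: - v) ord0 j * partial [:: j; i] F x =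
     - c * \sum_(j < N) v ord0 j * partial [:: j; i] F x.
    by rewrite mulr_sumr; apply: eq_bigr => j _; rewrite !mxE; ring.
  have -> : \sum_(j < N) v ord0 j * v ord0 i * partial [:: j; i] F x =
     v ord0 i * \sum_(j < N) v ord0 j * partial [:: j; i] F x.
    by rewrite mulr_sumr; apply: eq_bigr => j _; rewrite /=; ring.
  by rewrite mxE; ring.
apply: le_trans (ler_norm_sum _ _ _) _.
have mollify : `|c *: v| <= `|v| by rewrite normrZ ger0_norm// ler_piMl.
have mollify' : `|c *: - v| <= `|v| by rewrite scalerN normrN.
apply: (@le_trans _ _ (\sum_(i < N) `|v| * (2 * (C * `|v| ^+ 2)))).
  apply: ler_sum => i _; rewrite normrM ler_pM ?coord_norm_le//.
  apply: le_trans (ler_normB _ _) _; rewrite mulr_natl mulr2n.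
  apply: lerD; (apply: le_trans (FC _ _ _) _; rewrite ler_wpM2l ?(ltW C0)//).
    by rewrite lerXn2r ?nnegrE.
  by rewrite lerXn2r ?nnegrE.
rewrite sumr_const card_ord -[leLHS]mulr_natr.
have := mulr_ge0 (exprn_ge0 3 (normr_ge0 v)) (ltW C0).
have -> : `|v| * (2 * (C * `|v| ^+ 2)) = 2 * (`|v| ^+ 3 * C) by ring.
by rewrite -natr1; lra.
Qed.

Lemma bump_continuous F : bump_alg F -> continuous F.
Proof. by move=> /bump_lipschitz[C C0 FC]; exact: lipschitz_continuousR FC. Qed.

Lemma bump_smooth F : bump_alg F -> smooth F.
Proof.
move=> bF s; have bsF := bump_partial s bF.
split=> [|i x]; first exact: bump_continuous.
by have [] := is_derive_bump x (unitv R i) bsF.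
Qed.

Lemma bump_measurable F : bump_alg F -> measurable_fun setT F.
Proof.
elim=> [i a b P|r|{}F G _ mF _ mG|{}F G _ mF _ mG].
- apply: measurableT_comp; last first.
    apply: measurable_funD; last exact: measurable_cst.
    by apply: measurable_funM; [exact: measurable_cst|exact: measurable_coord_rV].
  by apply: continuous_measurable_fun; exact: continuous_flat.
- exact: measurable_cst.
- exact: measurable_funD.
- exact: measurable_funM.
Qed.

(** As the factor [k] grows these functions increase to the indicator of the
open box with corners [l] and [u]; see [box_bump_cvg]. *)
Definition box_bump (k : R) (l u : 'I_N -> R) x : R := \prod_(i < N)
  (flat 1 (k * (x ord0 i - l i)) * flat 1 (k * (u i - x ord0 i))).

Lemma bump_box_bump k l u : bump_alg (box_bump k l u).
Proof.
apply: bump_prod => i; apply: bump_mul.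
- rewrite (_ : (fun _ => _) = fun x : V => flat 1 (k * x ord0 i + - (k * l i))).
    exact: bump_flat.
  by apply/funext => x; congr flat; ring.
- rewrite (_ : (fun _ => _) = fun x : V => flat 1 (- k * x ord0 i + k * u i)).
    exact: bump_flat.
  by apply/funext => x; congr flat; ring.
Qed.

Lemma flat1_ge0 t : 0 <= flat (1 : {poly R}) t.
Proof. by rewrite /flat; case: ifP => // _; rewrite hornerC mul1r expR_ge0. Qed.

Lemma flat1_neq0 t : (flat (1 : {poly R}) t != 0) = (0 < t).
Proof.
rewrite /flat; case: ifP => [_|_]; last by rewrite eqxx.
by rewrite hornerC mul1r gt_eqF// expR_gt0.
Qed.

Lemma flat1_le1 t : flat (1 : {poly R}) t <= 1.
Proof.
rewrite /flat; case: ifP => // t0.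
by rewrite hornerC mul1r -expR0 ler_expR oppr_le0 invr_ge0 ltW.
Qed.

Lemma box_bump_ge0 k l u x : 0 <= box_bump k l u x.
Proof. by apply: prodr_ge0 => i _; rewrite mulr_ge0 ?flat1_ge0. Qed.

Lemma box_bump_le1 k l u x : box_bump k l u x <= 1.
Proof.
have -> : 1 = \prod_(i < N) 1 :> R by rewrite big1.
apply: ler_prod => i _; rewrite mulr_ge0 ?flat1_ge0//=.
by rewrite mulr_ile1 ?flat1_ge0 ?flat1_le1.
Qed.

Lemma box_bump_neq0 k l u x : 0 < k ->
  (box_bump k l u x != 0) = [forall i, l i < x ord0 i < u i].
Proof.
move=> k0; rewrite /box_bump prodf_seq_neq0; apply/allP/forallP => [H i|H i _].
  have := H i (mem_index_enum _); rewrite mulf_eq0 negb_or/= => /andP[].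
  by rewrite !flat1_neq0 !pmulr_rgt0// !subr_gt0 => -> ->.
have /andP[h1 h2] := H i.
by rewrite /= mulf_neq0// flat1_neq0 pmulr_rgt0// subr_gt0.
Qed.

End bump_algebra.

(** * Translation invariance and null sets for integrals on row vectors *)

Section ae_integral.
Context d (T : measurableType d) (R : realType).
Variable mu : {measure set T -> \bar R}.
Local Open Scope ereal_scope.
Import HBNNSimple.

(** The integral of a nonnegative function is defined as a supremum over simple
functions below it, whether or not the function is measurable. Restricting a
simple function to the complement of the null set makes it admissible for the
other function. *)
Lemma ge0_le_integral_ae_nonmeasurable (f g : T -> \bar R) :
  (forall x, 0 <= f x) -> (forall x, 0 <= g x) ->
  {ae mu, forall x, f x = g x} -> \int[mu]_x f x <= \int[mu]_x g x.
Proof.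
move=> f0 g0 [Z [mZ Z0 fgZ]].
rewrite ge0_integralTE// [leRHS]ge0_integralTE//.
apply: ge_ereal_sup => _ [h hf <-].
apply: ereal_sup_ubound; exists (proj_nnsfun h (measurableC mZ)).
  move=> x; rewrite /= mindicE.
  have [Zx|Zx] := pselect (Z x).
    by rewrite memNset ?mulr0//= => -[].
  rewrite mem_set// mulr1; apply: le_trans (hf x) _.
  have [->//|fg] := pselect (f x = g x); exfalso; apply: Zx; exact: fgZ.
rewrite -!integralT_nnsfun; apply: ge0_ae_eq_integral => //.
- by apply/measurable_EFinP; exact: measurable_funP.
- by apply/measurable_EFinP; exact: measurable_funP.
- by move=> x _; rewrite lee_fin.
- by move=> x _; rewrite lee_fin.
exists Z; split => // x /= /not_implyP[_ H]; apply: contrapT => Zx; apply: H.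
by rewrite /= mindicE mem_set// mulr1.
Qed.

(** Functions in a Lebesgue class are only almost everywhere equal to Borel
functions, and need not be Borel measurable themselves; integrals of both can
be compared all the same. *)
Lemma eq_integral_ae_nonmeasurable (f g : T -> \bar R) :
  {ae mu, forall x, f x = g x} -> \int[mu]_x f x = \int[mu]_x g x.
Proof.
move=> fg; rewrite integralE [RHS]integralE; congr (_ - _).
  apply/eqP; rewrite eq_le; apply/andP; split;
  apply: ge0_le_integral_ae_nonmeasurable => //; apply: filterS fg => x;
  by rewrite !funeposE => ->.
apply/eqP; rewrite eq_le; apply/andP; split;
apply: ge0_le_integral_ae_nonmeasurable => //; apply: filterS fg => x;
by rewrite !funenegE => ->.
Qed.

End ae_integral.

Lemma lebesgue_measure_shift (R : realType) (z : R)
    (A : set (measurableTypeR R)) : measurable A ->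
  @lebesgue_measure R ((fun x : measurableTypeR R => x + z) @^-1` A) = lebesgue_measure A.
Proof.
have ms : measurable_fun setT
   ((fun x : measurableTypeR R => x + z) : measurableTypeR R -> measurableTypeR R).
  by apply: measurable_funD => //; exact: measurable_cst.
move=> mA; apply/esym.
pose mu := measure_function_pushforward__canonical__measure_function_Measure
     (@lebesgue_measure R) ms.
apply: (@lebesgue_measure_unique R mu) => // _ [[a b] _ <-]/=.
rewrite /pushforward/= (_ : _ @^-1` _ = `]a - z, b - z]%classic).
  rewrite !lebesgue_measure_itv/= !lte_fin ltrD2r; case: ifP => // _.
  by rewrite -!EFinD; congr EFin; ring.
by apply/seteqP; split => x /=; rewrite !in_itv/= ltrBlDr lerBrDr.
Qed.

Section lebesgue_rV_theory.
Variables (R : realType) (N : nat).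
Local Notation V := 'rV[R]_N.
Local Notation leb := (@lebesgue_rV R N).
Implicit Types (x y z : V).

(** A pi-system of generators: it allows measures to be compared on products of
measurable sets only. *)
Definition mboxes : set (set V) := [set B | exists2 A : 'I_N -> set R,
  (forall i, measurable (A i)) & B = [set x : V | forall i, A i (x ord0 i)]].

Lemma measurable_box (A : 'I_N -> set R) : (forall i, measurable (A i)) ->
  measurable [set x : V | forall i, A i (x ord0 i)].
Proof.
move=> mA; rewrite (_ : [set _ | _] =
    \bigcap_(i in [set: 'I_N]) ((fun x : V => x ord0 i) @^-1` A i)).
  apply: fin_bigcap_measurable => // i _.
  by rewrite -[X in measurable X]setTI; exact: measurable_coord_rV.
by apply/seteqP; split => [x Ax i _|x Ax i]; [exact: Ax|exact: (Ax i I)].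
Qed.

Lemma lebesgue_rV_itv (b0 b1 : bool) (l u : 'I_N -> R) :
  (forall i, l i <= u i) ->
  leb [set x : V | forall i,
    [set` Interval (BSide b0 (l i)) (BSide b1 (u i))] (x ord0 i)]
  = (\prod_(i < N) (u i - l i))%:E.
Proof.
move=> lu; rewrite (@lebesgue_rV_box R N
  (fun i => [set` Interval (BSide b0 (l i)) (BSide b1 (u i))]))//.
rewrite [RHS](big_morph EFin EFinM erefl); apply: eq_bigr => i _.
rewrite lebesgue_measure_itv/= lte_fin; case: ltP => [_|ul].
  by rewrite -EFinB.
by have /eqP : u i = l i by [apply/eqP; rewrite eq_le ul lu];
  move=> /eqP ->; rewrite subrr.
Qed.

Lemma measurable_itv_box (b0 b1 : bool) (l u : 'I_N -> R) :
  measurable [set x : V | forall i,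
    [set` Interval (BSide b0 (l i)) (BSide b1 (u i))] (x ord0 i)].
Proof.
exact: (@measurable_box (fun i => [set` Interval (BSide b0 (l i)) (BSide b1 (u i))])).
Qed.

Lemma measurable_rVE : @measurable _ V = <<s mboxes >>.
Proof.
rewrite eqEsubset; split; last first.
  apply: smallest_sub; first exact: sigma_algebra_measurable.
  by move=> _ [A mA ->]; exact: measurable_box.
apply: smallest_sub; first exact: smallest_sigma_algebra.
move=> B; rewrite /= -bigcup_seq/= => -[i _ [C mC <-]].
apply: sub_sigma_algebra; exists (fun j => if j == i then C else setT).
  by move=> j; case: ifP.
rewrite setTI; apply/seteqP; split => x /= Cx.
  by move=> j; case: eqP => // ->.
by have := Cx i; rewrite eqxx.
Qed.

Lemma setI_closed_mboxes : setI_closed mboxes.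
Proof.
move=> _ _ [A mA ->] [B mB ->]; exists (fun i => A i `&` B i).
  by move=> i; exact: measurableI.
apply/seteqP; split => x /=; first by move=> [Ax Bx] i; split.
by move=> AB; split => i; have [] := AB i.
Qed.

Lemma measurable_addr z : measurable_fun setT (fun x : V => x + z).
Proof.
apply: measurable_fun_rVP => i; under eq_fun do rewrite mxE.
by apply: measurable_funD; [exact: measurable_coord_rV|exact: measurable_cst].
Qed.

Lemma measurable_add2 : measurable_fun setT (fun p : V * V => p.1 + p.2).
Proof.
apply: measurable_fun_rVP => i; under eq_fun do rewrite mxE.
apply: measurable_funD.
- exact: measurableT_comp (@measurable_coord_rV R N i) measurable_fst.
- exact: measurableT_comp (@measurable_coord_rV R N i) measurable_snd.
Qed.

(** Both sides are measures, and they agree on boxes by translation invariance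
on the line. *)
Lemma lebesgue_rV_shift z (A : set V) : measurable A ->
  leb ((fun x => x + z) @^-1` A) = leb A.
Proof.
move=> mA.
pose mu := measure_function_pushforward__canonical__measure_function_Measure
     leb (measurable_addr z).
apply/esym; apply: (@measure_unique _ R V mboxes
  (fun k => [set x | forall i, `]- k%:R, k%:R[%classic (x ord0 i : R)])
  measurable_rVE setI_closed_mboxes _ _ leb mu) => //.
- by move=> k; exists (fun=> `]- k%:R, k%:R[%classic).
- apply/seteqP; split => // x _; have := archi_boundP (normr_ge0 x).
  set k := Num.bound _ => xk; exists k => // i /=.
  rewrite in_itv/= -ltr_norml; apply: le_lt_trans xk; exact: coord_norm_le.
- move=> _ [B mB ->].
  transitivity (\prod_(i < N) @lebesgue_measure R (B i))%E.
    exact: lebesgue_rV_box.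
  rewrite /mu/= /pushforward.
  rewrite (_ : _ @^-1` _ = [set x : V | forall i,
      ((fun y : measurableTypeR R => y + z ord0 i) @^-1` B i) (x ord0 i)]).
    rewrite (@lebesgue_rV_box R N
      (fun i => (fun y : measurableTypeR R => y + z ord0 i) @^-1` B i)); last first.
      move=> i; rewrite -[X in measurable X]setTI.
      by apply: measurable_funD => //; exact: measurable_cst.
    by apply: eq_bigr => i _; apply/esym; exact: lebesgue_measure_shift (mB i).
  by apply/seteqP; split => x /= Bx i; have := Bx i; rewrite mxE.
- move=> k; apply: (@le_lt_trans _ _ (\prod_(i < N) (k%:R - - k%:R) : R)%:E); last exact: ltry.
  by rewrite -(@lebesgue_rV_itv false true (fun=> - k%:R) (fun=> k%:R))// => i; rewrite (@le_trans _ _ 0)// oppr_le0.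
Qed.

Lemma ge0_integral_rV_shift z (f : V -> \bar R) : measurable_fun setT f ->
  (forall x, 0 <= f x)%E ->
  (\int[leb]_x f (x + z)%R = \int[leb]_x f x)%E.
Proof.
move=> mf f0.
have := @ge0_integral_pushforward _ _ _ _ R _ (measurable_addr z) leb setT f
  measurableT mf (fun y _ => f0 y).
rewrite preimage_setT => <-.
apply: eq_measure_integral; first exact: measurable_addr.
by move=> mz A mA _; exact: (lebesgue_rV_shift z mA).
Qed.

Lemma integrable_rV_shift z (f : V -> R) : leb.-integrable setT (EFin \o f) ->
  leb.-integrable setT (fun x => (f (x + z))%:E).
Proof.
move=> /integrableP[mf fi]; apply/integrableP; split.
  by apply: (measurableT_comp mf); exact: measurable_addr.
have := @ge0_integral_rV_shift z (fun x => `|(f x)%:E|)%E.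
by move=> ->//; exact: measurableT_comp.
Qed.

Lemma Rintegral_shift z (f : V -> R) : leb.-integrable setT (EFin \o f) ->
  \int[leb]_x f (x + z) = \int[leb]_x f x.
Proof.
move=> fi; have /integrableP[mf _] := fi; rewrite /Rintegral; congr fine.
have := @integral_pushforward _ _ _ _ R _ (measurable_addr z) leb setT (EFin \o f) mf.
rewrite preimage_setT => /(_ (integrable_rV_shift z fi) measurableT) <-.
apply: eq_measure_integral; first exact: measurable_addr.
by move=> mz A mA _; exact: (lebesgue_rV_shift z mA).
Qed.

(** An open set is a countable union of boxes with rational centers and inverse
integer radii. *)
Lemma measurable_open_rV (U : set V) : open U -> measurable U.
Proof.
move=> oU.
pose box (q : 'rV[rat]_N) (n : nat) := [set x : V | forall i,
  `]ratr (q ord0 i) - n.+1%:R^-1, ratr (q ord0 i) + n.+1%:R^-1[%classic (x ord0 i : R)].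
pose F (p : 'rV[rat]_N * nat) := if `[< box p.1 p.2 `<=` U >] then box p.1 p.2 else set0.
rewrite (_ : U = \bigcup_p F p).
  apply: countable_bigcupT_measurable => [|p]; first exact: countableP.
  by rewrite /F; case: ifP => // _; exact: measurable_itv_box.
apply/seteqP; split => [x Ux|x [p _]]; last first.
  by rewrite /F; case: ifPn => // /asboolP; apply.
have /nbhs_ballP[e /= e0 eU] : nbhs x U by exact: open_nbhs_nbhs.
pose n := Num.bound (2 / e).
have ne : n.+1%:R^-1 <= e / 2.
  rewrite -[e / 2]invf_div lef_pV2 ?posrE ?divr_gt0//.
  apply/ltW; apply: lt_trans (archi_boundP _) _; first by rewrite divr_ge0// ltW.
  by rewrite ltr_nat.
have n0 : 0 < n.+1%:R^-1 :> R by rewrite invr_gt0.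
have /(_ _)/cid2-/all_sig2[q qx1 qx2] : forall i, exists2 q : rat,
    x ord0 i - n.+1%:R^-1 < ratr q & ratr q < x ord0 i + n.+1%:R^-1.
  move=> i; have [|q] := @rat_in_itvoo R (x ord0 i - n.+1%:R^-1) (x ord0 i + n.+1%:R^-1).
    by rewrite ltrBlDr -addrA ltrDl addr_gt0.
  by rewrite in_itv/= => /andP[]; exists q.
exists (\row_i q i, n) => //; rewrite /F/= ifT.
  move=> i /=; rewrite mxE in_itv/=; have := qx1 i; have := qx2 i.
  by move: (n.+1%:R^-1 : R) => r h1 h2; apply/andP; split; lra.
apply/asboolP => y /= By; apply: eU; rewrite mx_norm_ball /ball_/=.
apply: le_lt_trans (_ : _ <= Num.max 0 (\big[Num.max/0]_i `|(x - y) ord0 i|)) _.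
  by apply: rV_norm_le => [|i]; rewrite le_max ?lexx// le_bigmax orbT.
rewrite gt_max e0/=; apply/bigmax_ltP; split => // i _.
have : `](ratr ((\row_i q i) ord0 i) : R) - n.+1%:R^-1,
   ratr ((\row_i q i) ord0 i) + n.+1%:R^-1[%classic (y ord0 i) := By i.
rewrite /= !mxE in_itv/= => /andP[].
have := qx1 i; have := qx2 i; move: ne; move: (n.+1%:R^-1 : R) => r.
by move=> h0 h1 h2 h3 h4; rewrite ltr_norml; apply/andP; split; lra.
Qed.

Lemma continuous_measurable_rV (f : V -> R) : continuous f ->
  measurable_fun setT f.
Proof.
move=> /continuousP cf; apply: (measurability _ (RGenOpens.measurableE R)).
move=> _ [_ [a [b ->] <-]]; rewrite setTI; apply: measurable_open_rV.
exact/cf/interval_open.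
Qed.

End lebesgue_rV_theory.

(** * Approximation of p-integrable functions by Lipschitz functions *)

Lemma expr_sum_le (R : realType) (I : finType) (x : I -> R) p : (0 < p)%N ->
  (forall i, 0 <= x i) ->
  (\sum_i x i) ^+ p <= #|I|%:R ^+ p * \sum_i x i ^+ p.
Proof.
move=> p0 x0; have [I0|/card_gt0P[i0 _]] := posnP #|I|.
  by rewrite !big_pred0 ?expr0n ?mulr0 ?gtn_eqF// => i; have := fintype0 i I0.
have [j _ xj] := @Order.TotalTheory.arg_maxP _ _ _ i0 xpredT x isT.
apply: (@le_trans _ _ ((#|I|%:R * x j) ^+ p)).
  rewrite lerXn2r ?nnegrE ?sumr_ge0 ?mulr_ge0//.
  apply: (@le_trans _ _ (\sum_(i : I) x j)); first by apply: ler_sum => i _; exact: xj.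
  by rewrite sumr_const mulr_natl.
rewrite exprMn ler_wpM2l ?exprn_ge0// (bigD1 j)//= lerDl sumr_ge0// => i _.
by rewrite exprn_ge0.
Qed.

Lemma exprD_le (R : realType) (x y : R) p : (0 < p)%N -> 0 <= x -> 0 <= y ->
  (x + y) ^+ p <= 2 ^+ p * (x ^+ p + y ^+ p).
Proof.
move=> p0 x0 y0.
have := @expr_sum_le R bool (fun b => if b then x else y) p p0.
by rewrite !big_bool card_bool; apply => -[].
Qed.

(** By convexity the graph lies above its tangent line at [m]. Integrated, this
is Jensen's inequality; with a suitable [t] it is the weighted
arithmetic-geometric inequality. *)
Lemma expr_tangent_le (R : realType) (m t : R) p : 0 <= m -> 0 <= t ->
  m ^+ p.+1 + p.+1%:R * m ^+ p * (t - m) <= t ^+ p.+1.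
Proof.
move=> m0 t0; rewrite -subr_ge0.
have -> : t ^+ p.+1 - (m ^+ p.+1 + p.+1%:R * m ^+ p * (t - m)) =
    (t - m) * \sum_(i < p.+1) (t ^+ (p - i) * m ^+ i - m ^+ p).
  have := subrXX t m p.+1 => /= E.
  rewrite sumrB sumr_const card_ord [RHS]mulrBr -E.
  by rewrite -[m ^+ p *+ _]mulr_natl; ring.
rewrite mulr_sumr sumr_ge0// => i _.
have ip : (i <= p)%N by rewrite -ltnS.
have -> : m ^+ p = m ^+ (p - i) * m ^+ i by rewrite -exprD subnK.
rewrite -mulrBl mulrA mulr_ge0 ?exprn_ge0//.
have [tm|mt] := leP m t.
  by rewrite mulr_ge0 ?subr_ge0// lerXn2r.
by rewrite mulr_le0 ?subr_le0 ?(ltW mt)// lerXn2r ?nnegrE// ltW.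
Qed.

Lemma measurable_norm_expr d (T : measurableType d) (R : realType) (f : T -> R) p :
  measurable_fun setT f -> measurable_fun setT (fun x => (`|f x| ^+ p)%:E).
Proof.
by move=> mf; apply/measurable_EFinP; apply: measurable_funX; exact: measurableT_comp.
Qed.

Lemma cvg_prodr (R : realType) (T : Type) (F : set_system T) {FF : Filter F} n
    (f : 'I_n -> T -> R) (l : 'I_n -> R) :
  (forall i, f i x @[x --> F] --> l i) ->
  \prod_(i < n) f i x @[x --> F] --> \prod_(i < n) l i.
Proof.
elim: n f l => [|n IH] f l fl.
  rewrite big_ord0; under eq_fun do rewrite big_ord0; exact: cvg_cst.
rewrite big_ord_recl; under eq_fun do rewrite big_ord_recl.
by apply: cvgM; [exact: fl|apply: IH => i; exact: fl].
Qed.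

Section open_boxes.
Variables (R : realType) (N : nat).
Local Notation V := 'rV[R]_N.

(** Generators of the sigma-algebra whose indicators are limits of functions of
the bump algebra. *)
Definition open_boxes : set (set V) := [set B | exists2 A : 'I_N -> set R,
  (forall i, A i = setT \/ exists a b, A i = `]a, b[%classic) &
  B = [set x : V | forall i, A i (x ord0 i)]].

Lemma setI_closed_open_boxes : setI_closed open_boxes.
Proof.
move=> _ _ [A oA ->] [B oB ->]; exists (fun i => A i `&` B i).
  move=> i; have [->|[a [b ->]]] := oA i; first by rewrite setTI; exact: oB.
  have [->|[c [e ->]]] := oB i; first by rewrite setIT; right; exists a, b.
  right; exists (Num.max a c), (Num.min b e).
  apply/seteqP; split => x /=; rewrite !in_itv/= gt_max lt_min.
    by move=> [/andP[-> ->] /andP[-> ->]].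
  by move=> /andP[/andP[-> ->] /andP[-> ->]].
apply/seteqP; split => x /=; first by move=> [Ax Bx] i; split.
by move=> AB; split => i; have [] := AB i.
Qed.

Lemma measurable_rV_open_boxes : @measurable _ V = <<s open_boxes >>.
Proof.
rewrite eqEsubset; split; last first.
  apply: smallest_sub; first exact: sigma_algebra_measurable.
  move=> _ [A oA ->]; apply: measurable_box => i.
  by have [->|[a [b ->]]] := oA i.
apply: smallest_sub; first exact: smallest_sigma_algebra.
move=> B; rewrite /= -bigcup_seq/= => -[i _ [C mC <-]].
pose f (x : g_sigma_algebraType open_boxes) := (x : V) ord0 i.
suff /(_ measurableT C mC) : measurable_fun setT f by [].
apply: (measurability _ (RGenOpens.measurableE R)).
move=> _ [_ [a [b ->]] <-]; apply: sub_sigma_algebra.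
exists (fun j => if j == i then `]a, b[%classic else setT).
  by move=> j; case: ifP => _; [right; exists a, b|left].
rewrite setTI; apply/seteqP; split => x /= Cx.
  by move=> j; case: eqP => // ->.
by have := Cx i; rewrite eqxx.
Qed.

End open_boxes.

Section Lp_approximation.
Variables (R : realType) (N : nat) (p : nat).
Hypothesis p_gt0 : (0 < p)%N.
Local Notation V := 'rV[R]_N.
Local Notation leb := (@lebesgue_rV R N).
Implicit Types (f g h : V -> R).

Definition lip_supp f := [/\ measurable_fun setT f,
  exists2 L, 0 < L & forall x y, `|f x - f y| <= L * `|x - y|
  & exists M, forall x, f x != 0 -> `|x| <= M].

Definition Lp_err f g := (\int[leb]_x (`|f x - g x| ^+ p)%:E)%E.

(** The closure of the Lipschitz functions of bounded support for the [p]-th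
power of the [L^p] distance; the measurability of [f] is kept so that the
triangle inequality applies. *)
Definition lip_approx f := measurable_fun setT f /\
  forall e, 0 < e -> exists2 g, lip_supp g & (Lp_err f g <= e%:E)%E.

Lemma measurable_Lp_err f g : measurable_fun setT f -> measurable_fun setT g ->
  measurable_fun setT (fun x => (`|f x - g x| ^+ p)%:E).
Proof.
move=> mf mg; apply/measurable_EFinP; apply: measurable_funX.
by apply: measurableT_comp => //; exact: measurable_funB.
Qed.

Lemma le_Lp_err2 f f1 g1 f2 g2 g : measurable_fun setT f1 ->
  measurable_fun setT f2 -> measurable_fun setT g1 -> measurable_fun setT g2 ->
  measurable_fun setT f -> measurable_fun setT g ->
  (forall x, `|f x - g x| <= `|f1 x - g1 x| + `|f2 x - g2 x|) ->
  (Lp_err f g <= (2 ^+ p)%:E * (Lp_err f1 g1 + Lp_err f2 g2))%E.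
Proof.
move=> mf1 mf2 mg1 mg2 mf mg H.
have m1 := measurable_Lp_err mf1 mg1; have m2 := measurable_Lp_err mf2 mg2.
have pos1 x : setT x -> (0 <= (`|f1 x - g1 x| ^+ p)%:E)%E.
  by move=> _; rewrite lee_fin exprn_ge0.
have pos2 x : setT x -> (0 <= (`|f2 x - g2 x| ^+ p)%:E)%E.
  by move=> _; rewrite lee_fin exprn_ge0.
rewrite /Lp_err -ge0_integralD// -ge0_integralZl//; last 2 first.
- exact: emeasurable_funD.
- by move=> x _; rewrite adde_ge0// lee_fin exprn_ge0.
apply: ge0_le_integral => //.
- exact: measurable_Lp_err.
- apply: emeasurable_funM; [exact: measurable_cst|exact: emeasurable_funD].
move=> x _; rewrite -EFinD -EFinM lee_fin.
apply: le_trans (exprD_le p_gt0 _ _) => //.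
by rewrite lerXn2r ?nnegrE ?addr_ge0.
Qed.

Lemma lip_approx_closed f : measurable_fun setT f ->
  (forall e, 0 < e -> exists2 g, lip_approx g & (Lp_err f g <= e%:E)%E) ->
  lip_approx f.
Proof.
move=> mf H; split => // e e0.
pose e' := e / 2 ^+ p / 2.
have e'0 : 0 < e' by rewrite !divr_gt0// exprn_gt0.
have [g [mg ag] fg] := H _ e'0; have [h nh gh] := ag _ e'0.
exists h => //; have [mh _ _] := nh.
apply: (@le_trans _ _ ((2 ^+ p)%:E * (Lp_err f g + Lp_err g h))%E).
  by apply: le_Lp_err2 => // x; exact: ler_distD.
apply: (@le_trans _ _ ((2 ^+ p)%:E * (e'%:E + e'%:E))%E).
  by rewrite lee_pmul2l ?lte_fin ?exprn_gt0// leeD.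
rewrite -EFinD -EFinM lee_fin /e' -splitr mulrC divfK// gt_eqF// exprn_gt0//.
Qed.

Lemma lip_suppD f g : lip_supp f -> lip_supp g -> lip_supp (fun x => f x + g x).
Proof.
move=> [mf [L L0 fL] [M fM]] [mg [L' L'0 gL] [M' gM]]; split.
- exact: measurable_funD.
- exists (L + L'); first exact: addr_gt0.
  move=> x y; rewrite mulrDl (_ : _ - _ = (f x - f y) + (g x - g y)); last by ring.
  by apply: le_trans (ler_normD _ _) _; rewrite lerD.
- exists (Num.max M M') => x; rewrite le_max.
  have [->|/fM ->//] := eqVneq (f x) 0.
  by rewrite add0r => /gM ->; rewrite orbT.
Qed.

Lemma lip_suppZ (r : R) f : lip_supp f -> lip_supp (fun x => r * f x).
Proof.
move=> [mf [L L0 fL] [M fM]]; split.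
- by apply: measurable_funM => //; exact: measurable_cst.
- exists ((`|r| + 1) * L); first by rewrite mulr_gt0// ltr_wpDl.
  move=> x y; rewrite -mulrBr normrM -mulrA ler_pM// ?fL//.
  by rewrite lerDl.
- by exists M => x; rewrite mulf_eq0 negb_or => /andP[_ /fM].
Qed.

Lemma lip_approx_lip_supp f : lip_supp f -> lip_approx f.
Proof.
move=> nf; have [mf _ _] := nf; split => // e e0; exists f => //.
rewrite /Lp_err (eq_integral (cst 0%E)) ?integral0 ?lee_fin ?ltW// => x _.
by rewrite subrr normr0 expr0n gtn_eqF.
Qed.

Lemma lip_approxD f g : lip_approx f -> lip_approx g ->
  lip_approx (fun x => f x + g x).
Proof.
move=> [mf af] [mg ag]; have mfg := measurable_funD mf mg; split => // e e0.
pose e' := e / 2 ^+ p / 2.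
have e'0 : 0 < e' by rewrite !divr_gt0// exprn_gt0.
have [f' nf' ff'] := af _ e'0; have [g' ng' gg'] := ag _ e'0.
have [mf' _ _] := nf'; have [mg' _ _] := ng'.
exists (fun x => f' x + g' x); first exact: lip_suppD.
apply: (@le_trans _ _ ((2 ^+ p)%:E * (Lp_err f f' + Lp_err g g'))%E).
  apply: le_Lp_err2 => //; first exact: measurable_funD.
  move=> x; rewrite (_ : _ - _ = (f x - f' x) + (g x - g' x)); last by ring.
  exact: ler_normD.
apply: (@le_trans _ _ ((2 ^+ p)%:E * (e'%:E + e'%:E))%E).
  by rewrite lee_pmul2l ?lte_fin ?exprn_gt0// leeD.
rewrite -EFinD -EFinM lee_fin /e' -splitr mulrC divfK// gt_eqF// exprn_gt0//.
Qed.

Lemma lip_approxZ (r : R) f : lip_approx f -> lip_approx (fun x => r * f x).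
Proof.
move=> [mf af]; split.
  by apply: measurable_funM => //; exact: measurable_cst.
move=> e e0; have [r0|r0] := eqVneq r 0.
  exists (fun=> 0).
    split; first exact: measurable_cst.
    + by exists 1 => // x y; rewrite subrr normr0 mul1r.
    + by exists 0 => x; rewrite eqxx.
  rewrite /Lp_err (eq_integral (cst 0%E)) ?integral0 ?lee_fin ?ltW// => x _.
  by rewrite r0 mul0r subrr normr0 expr0n gtn_eqF.
have rp : 0 < `|r| ^+ p by rewrite exprn_gt0// normr_gt0.
have [|g ng fg] := af (e / `|r| ^+ p); first by rewrite divr_gt0.
exists (fun x => r * g x); first exact: lip_suppZ.
have [mg _ _] := ng.
rewrite /Lp_err (eq_integral (fun x => (`|r| ^+ p)%:E * (`|f x - g x| ^+ p)%:E)%E).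
  rewrite ge0_integralZl//; last exact: measurable_Lp_err.
  apply: (@le_trans _ _ ((`|r| ^+ p)%:E * (e / `|r| ^+ p)%:E)%E).
    by rewrite lee_pmul2l.
  by rewrite -EFinM mulrC divfK// gt_eqF.
by move=> x _; rewrite -mulrBr normrM exprMn EFinM.
Qed.

Lemma lip_approx_sum I (s : seq I) (F : I -> V -> R) :
  (forall i, lip_approx (F i)) -> lip_approx (fun x => \sum_(i <- s) F i x).
Proof.
move=> aF; elim: s => [|i s IH].
  under eq_fun do rewrite big_nil.
  apply: lip_approx_lip_supp; split.
  - exact: measurable_cst.
  - by exists 1 => // x y; rewrite subrr normr0 mul1r.
  - by exists 0 => x; rewrite eqxx.
by under eq_fun do rewrite big_cons; exact: lip_approxD.
Qed.

(** The closure is stable under dominated limits. This gives the passage from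
smooth functions to boxes, to measurable sets and finally to arbitrary
functions. *)
Lemma lip_approx_dominated (f_ : nat -> V -> R) f (H : V -> \bar R) :
  (forall n, lip_approx (f_ n)) -> measurable_fun setT f ->
  (forall x, f_ ^~ x @ \oo --> f x) -> leb.-integrable setT H ->
  (forall n x, (`|f x - f_ n x| ^+ p)%:E <= H x)%E -> lip_approx f.
Proof.
move=> af mf fcvg iH fH; apply: lip_approx_closed => // e e0.
have mE n : measurable_fun setT (fun x => (`|f x - f_ n x| ^+ p)%:E).
  by apply: measurable_Lp_err => //; have [] := af n.
have [] := @dominated_convergence _ _ _ leb setT measurableT
  (fun n x => (`|f x - f_ n x| ^+ p)%:E) (cst 0%E) H mE.
- exact: measurable_cst.
- apply/aeW => x _ /=; apply: cvg_EFin; first by apply: nearW.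
  rewrite (_ : fine \o _ = (fun n => `|f x - f_ n x| ^+ p))//.
  have c0 : `|f x - f_ n x| @[n --> \oo] --> (0 : R).
    rewrite -(normr0 R) -(subrr (f x)); apply: cvg_norm.
    by apply: cvgB; [exact: cvg_cst|exact: fcvg].
  have -> : 0 = 0 ^+ p :> R by rewrite expr0n gtn_eqF.
  exact: (cvg_comp _ _ c0 (@exprn_continuous _ p 0)).
- exact: iH.
- by apply/aeW => x n _; rewrite gee0_abs ?fH// lee_fin exprn_ge0.
move=> _ _; rewrite integral0 => /fine_cvgP[fin /cvgrPdist_le /(_ _ e0) lim].
near \oo => n.
exists (f_ n) => //; rewrite /Lp_err -[leLHS]fineK; last by near: n.
rewrite lee_fin; apply: le_trans (ler_norm _) _.
by rewrite -normrN -sub0r; near: n.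
Unshelve. all: by end_near. Qed.

Lemma integrable_indic_lty (A : set V) : measurable A -> (leb A < +oo)%E ->
  leb.-integrable setT (fun x => (\1_A x)%:E).
Proof.
move=> mA Aoo; apply/integrableP; split; first exact/measurable_EFinP.
rewrite (eq_integral (fun x => (\1_A x)%:E)) => [|x _].
  by rewrite integral_indic// setIT.
by rewrite gee0_abs// lee_fin.
Qed.

Lemma sum_indic_trivIset (F : (set V)^nat) n x : trivIset setT F ->
  \sum_(k < n) \1_(F k) x = \1_(\bigcup_(k in `I_n) F k) x :> R.
Proof.
move=> tF; rewrite indicE; have [[k /= kn Fkx]|H] := pselect ((\bigcup_(k in `I_n) F k) x).
  rewrite mem_set; last by exists k.
  rewrite (bigD1 (Ordinal kn))//= indicE mem_set// big1 ?addr0// => j jk.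
  rewrite indicE memNset// => Fjx; move/eqP: jk; apply; apply/val_inj => /=.
  by apply: tF => //; exists x.
rewrite memNset// big1// => k _; rewrite indicE memNset// => Fkx; apply: H.
by exists k => //=.
Qed.

Definition open_box (l u : 'I_N -> R) :=
  [set x : V | forall i, `]l i, u i[%classic (x ord0 i : R)].

Lemma measurable_open_box l u : measurable (open_box l u).
Proof. exact: (@measurable_itv_box R N false true). Qed.

Lemma lebesgue_open_box_lty l u : (leb (open_box l u) < +oo)%E.
Proof.
have [lu|/existsNP[i /negP]] := pselect (forall i, l i <= u i).
  by rewrite (@lebesgue_rV_itv R N false true)// ltry.
rewrite -ltNge => ul; rewrite (_ : open_box l u = set0) ?measure0//.
apply/seteqP; split => // x /(_ i); rewrite /= in_itv/= => /andP[h1 h2].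
by have := lt_trans (lt_trans h1 h2) ul; rewrite ltxx.
Qed.

Lemma open_box_bump_neq0 n l u x :
  (box_bump n.+1%:R l u x != 0) = (x \in open_box l u).
Proof.
rewrite box_bump_neq0//; apply/forallP/idP => [H|].
  by apply/mem_set => i /=; rewrite in_itv/= H.
by rewrite inE => H i; have := H i; rewrite /= in_itv.
Qed.

Lemma lip_supp_bump F : bump_alg F -> (exists M, forall x, F x != 0 -> `|x| <= M) ->
  lip_supp F.
Proof.
move=> bF FM; split => //; first exact: bump_measurable.
exact: bump_lipschitz.
Qed.

Lemma box_bump_cvg l u x :
  box_bump n.+1%:R l u x @[n --> \oo] --> (\1_(open_box l u) x : R).
Proof.
have H t : 0 < t -> flat (1 : {poly R}) (n.+1%:R * t) @[n --> \oo] --> (1 : R).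
  move=> t0; under eq_fun => n do
    rewrite /flat mulr_gt0// hornerC mul1r invfM -mulrN.
  suff : expR (n.+1%:R^-1 * - t^-1) @[n --> \oo] --> expR (0 * - t^-1).
    by rewrite mul0r expR0.
  apply: continuous_cvg; first exact: continuous_expR.
  by apply: cvgM; [exact: cvg_harmonic|exact: cvg_cst].
rewrite indicE; have [xB|xB] := boolP (x \in _); last first.
  under eq_fun => n.
    have := open_box_bump_neq0 n l u x; rewrite (negbTE xB) => /negbFE/eqP ->.
    over.
  exact: cvg_cst.
rewrite (_ : true%:R = \prod_(i < N) (1 * 1)); last by rewrite big1// => i _; rewrite mulr1.
apply: cvg_prodr => i; move: xB; rewrite inE => /(_ i); rewrite /= in_itv/=.
by move=> /andP[h1 h2]; apply: cvgM; apply: H; rewrite subr_gt0.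
Qed.

Lemma lip_approx_box l u : lip_approx (\1_(open_box l u)).
Proof.
apply: (@lip_approx_dominated (fun n => box_bump n.+1%:R l u) _
    (fun x => (\1_(open_box l u) x)%:E)).
- move=> n; apply: lip_approx_lip_supp; apply: lip_supp_bump; first exact: bump_box_bump.
  exists (\sum_(i < N) (`|l i| + `|u i|)) => x; rewrite open_box_bump_neq0 inE.
  move=> xB; apply: rV_norm_le => [|i]; first by apply: sumr_ge0 => i _; rewrite addr_ge0.
  rewrite (bigD1 i)//=; apply: (@le_trans _ _ (`|l i| + `|u i|)); last first.
    by rewrite lerDl sumr_ge0// => j _; rewrite addr_ge0.
  have := xB i; rewrite /= in_itv/= => /andP[h1 h2].
  have := ler_norm (u i); have := ler_norm (- l i); rewrite normrN.
  have := normr_ge0 (u i); have := normr_ge0 (l i).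
  by move=> a1 a2 a3 a4; rewrite ler_norml; apply/andP; split; lra.
- exact: measurable_indic (measurable_open_box l u).
- exact: box_bump_cvg.
- apply: integrable_indic_lty; first exact: measurable_open_box.
  exact: lebesgue_open_box_lty.
- move=> n x; rewrite lee_fin indicE.
  have := open_box_bump_neq0 n l u x; case: (x \in _) => [_|/negbFE/eqP ->]; last first.
    by rewrite subrr normr0 expr0n gtn_eqF.
  rewrite ger0_norm ?subr_ge0 ?box_bump_le1//; rewrite exprn_ile1//.
    by rewrite subr_ge0 box_bump_le1.
  by rewrite lerBlDr lerDl box_bump_ge0.
Qed.

Definition cube (M : R) := open_box (fun=> - M) (fun=> M).

(** Dynkin's theorem: the sets with approximable trace on a fixed cube form a
lambda-system that contains the boxes. *)
Lemma lip_approx_set M E : measurable E -> lip_approx (\1_(E `&` cube M)).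
Proof.
rewrite measurable_rV_open_boxes; move: E.
apply: (dynkin_induction (@measurable_rV_open_boxes R N)).
- exact: setI_closed_open_boxes.
- by rewrite setTI; exact: lip_approx_box.
- move=> _ [A oA ->].
  have /(_ _)/cid2-/all_sig2[l _ /(_ _)/cid-/all_sig[u lu]] : forall i,
      exists2 l : R, True & exists u : R, A i `&` `]- M, M[%classic = `]l, u[%classic.
    move=> i; have [->|[a [b ->]]] := oA i.
      by exists (- M) => //; exists M; rewrite setTI.
    exists (Num.max a (- M)) => //; exists (Num.min b M).
    apply/seteqP; split => x /=; rewrite !in_itv/= gt_max lt_min.
      by move=> [/andP[-> ->] /andP[-> ->]].
    by move=> /andP[/andP[-> ->] /andP[-> ->]].
  rewrite (_ : _ `&` _ = open_box l u); first exact: lip_approx_box.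
  apply/seteqP; split => x /= => [[Ax Mx] i|lux].
    by rewrite -lu; split; [exact: Ax|exact: Mx].
  by split=> i; have := lux i; rewrite -lu => -[].
- move=> E mE aE.
  have -> : \1_(~` E `&` cube M) = (fun x => \1_(cube M) x + (-1) * \1_(E `&` cube M) x) :> (V -> R).
    apply/funext => x; rewrite !indicE !in_setI in_setC.
    by case: (x \in E); case: (x \in cube M); rewrite /=; lra.
  by apply: lip_approxD; [exact: lip_approx_box|exact: lip_approxZ].
- move=> F mF tF aF.
  have tF' : trivIset setT (fun k => F k `&` cube M).
    exact: trivIset_setIr.
  apply: (@lip_approx_dominated
    (fun n x => \sum_(k < n) \1_(F k `&` cube M) x) _
    (fun x => (\1_(cube M) x)%:E)).
  + by move=> n; exact: lip_approx_sum.
  + apply: measurable_indic; apply: measurableI; last exact: measurable_open_box.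
    exact: bigcup_measurable.
  + move=> x; under eq_fun do rewrite (sum_indic_trivIset _ _ tF').
    have [[k _ Fkx]|H] := pselect ((\bigcup_k (F k `&` cube M)) x).
      apply: cvg_near_cst; exists k.+1 => // n /= kn; rewrite !indicE.
      rewrite mem_set; last by exists k.
      rewrite mem_set//; have [? ?] := Fkx; split => //; by exists k.
    apply: cvg_near_cst; apply: nearW => n; rewrite !indicE.
    rewrite memNset; last by move=> [k _ Fkx]; apply: H; exists k.
    by rewrite memNset// => -[[k _ Fkx] Cx]; apply: H; exists k.
  + apply: integrable_indic_lty; first exact: measurable_open_box.
    exact: lebesgue_open_box_lty.
  + move=> n x; rewrite (sum_indic_trivIset _ _ tF') lee_fin !indicE.
    have [Cx|Cx] := boolP (x \in cube M); last first.
      rewrite in_setI (negbTE Cx) andbF memNset ?subrr ?normr0 ?expr0n ?gtn_eqF//.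
      by move=> [k _ [_ Cx']]; move: Cx; rewrite mem_set.
    rewrite exprn_ile1// ler_norml; apply/andP.
    by case: (x \in _); case: (x \in _); split; rewrite /=; lra.
Qed.

Import HBNNSimple.

Lemma lip_approx_nnsfun M (s : {nnsfun V >-> R}) :
  (forall x, s x != 0 -> cube M x) -> lip_approx s.
Proof.
move=> sM.
rewrite (_ : (s : V -> R) = (fun x => \sum_(y <- finmap.enum_fset (fset_set (range s)))
    (y * \1_(s @^-1` [set y] `&` cube M) x))).
  apply: lip_approx_sum => y; apply: lip_approxZ; apply: lip_approx_set.
  by rewrite -[X in measurable X]setTI; exact: measurable_funP.
apply/funext => x; rewrite {1}fimfunE fsbig_finite//=; apply: eq_bigr => y _.
have [->|y0] := eqVneq y 0; first by rewrite !mul0r.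
congr (_ * _); rewrite !indicE; congr (nat_of_bool _)%:R.
apply/idP/idP; rewrite !inE/=; last by case.
by move=> sx; split => //; apply: sM; rewrite sx.
Qed.

Lemma lip_approx_ge0 M f : measurable_fun setT f -> (forall x, 0 <= f x) ->
  (forall x, f x != 0 -> cube M x) ->
  (\int[leb]_x (`|f x| ^+ p)%:E < +oo)%E -> lip_approx f.
Proof.
move=> mf f0 fM foo.
have mEf : measurable_fun setT (EFin \o f) by exact/measurable_EFinP.
pose s := nnsfun_approx measurableT mEf.
have sf x : s ^~ x @ \oo --> f x.
  have /fine_cvgP[_] : EFin \o s ^~ x @ \oo --> (f x)%:E.
    by apply: (cvg_nnsfun_approx measurableT mEf) => // y _; rewrite lee_fin.
  exact.
have nds x : nondecreasing_seq (s ^~ x).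
  by move=> m n mn; have /lefP := nd_nnsfun_approx measurableT mEf mn; exact.
have s_le n x : s n x <= f x.
  rewrite -(cvg_lim _ (sf x))//; apply: nondecreasing_cvgn_le => //.
  by apply/cvg_ex; exists (f x).
apply: (@lip_approx_dominated (fun n => s n) _ (fun x => (`|f x| ^+ p)%:E)) => //.
- move=> n; apply: (@lip_approx_nnsfun M) => x sx; apply: fM.
  apply: contra_neq sx => fx0; apply/eqP; rewrite eq_le.
  by rewrite -{1}fx0 s_le/=.
- apply/integrableP; split.
    exact: measurable_norm_expr.
  under eq_integral => x _ do rewrite gee0_abs ?lee_fin ?exprn_ge0//.
  exact: foo.
- move=> n x; rewrite lee_fin lerXn2r ?nnegrE//.
  by rewrite !ger0_norm ?subr_ge0// lerBlDr lerDl.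
Qed.

(** Positive and negative parts are monotone limits of simple functions. *)
Lemma lip_approx_Lp M f : measurable_fun setT f ->
  (forall x, f x != 0 -> cube M x) ->
  (\int[leb]_x (`|f x| ^+ p)%:E < +oo)%E -> lip_approx f.
Proof.
move=> mf fM foo.
have H g : measurable_fun setT g -> (forall x, 0 <= g x <= `|f x|) -> lip_approx g.
  move=> mg gf; apply: (@lip_approx_ge0 M) => // [x|x gx|].
  - by have /andP[] := gf x.
  - apply: fM; apply: contra_neq gx => fx0; apply/eqP; rewrite eq_le andbC.
    by have := gf x; rewrite fx0 normr0.
  apply: le_lt_trans foo; apply: ge0_le_integral => //.
  - exact: measurable_norm_expr.
  - exact: measurable_norm_expr.
  - move=> x _; have /andP[g0 gfx] := gf x.
    by rewrite lee_fin lerXn2r ?nnegrE// ger0_norm.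
rewrite (_ : f = (fun x => Num.max (f x) 0 + (-1) * Num.max (- f x) 0)).
  apply: lip_approxD; last apply: lip_approxZ; apply: H.
  - by apply: measurable_maxr => //; exact: measurable_cst.
  - move=> x; rewrite le_max lexx orbT ge_max ler_norm/=; exact: normr_ge0.
  - by apply: measurable_maxr => //; exact: measurable_funN.
  - by move=> x; rewrite le_max lexx orbT ge_max -normrN ler_norm normrN/=.
apply/funext => x; have [fx|fx] := leP (f x) 0.
  by rewrite max_l ?oppr_ge0//; ring.
by rewrite max_r ?oppr_le0 ?(ltW fx)// mulr0 addr0.
Qed.

End Lp_approximation.

(** * Mollification *)

Section convolution.
Variables (R : realType) (N : nat).
Local Notation V := 'rV[R]_N.
Local Notation leb := (@lebesgue_rV R N).
Implicit Types (f g w F G K rho : V -> R) (x y v : V).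
Local Notation integrable f := (leb.-integrable setT (EFin \o f)).

Lemma bump_shift F x : bump_alg F -> bump_alg (fun y => F (y - x)).
Proof.
elim=> [i a b P|r|{}F G _ IF _ IG|{}F G _ IF _ IG].
- rewrite (_ : (fun _ => _) = fun y : V => flat P (a * y ord0 i + (b - a * x ord0 i))).
    exact: bump_flat.
  by apply/funext => y; rewrite !mxE; congr flat; ring.
- exact: bump_cst.
- exact: bump_add.
- exact: bump_mul.
Qed.

Lemma partial_shift F x s :
  partial s (fun y => F (y - x)) = (fun y => partial s F (y - x)).
Proof.
elim: s => [//|i s /= ->]; apply/funext => y; rewrite /derive.
set f := (X in lim (X @ _) = _); set h := (X in _ = lim (X @ _)).
suff -> : f = h by [].
by apply/funext => t; rewrite /f /h /= addrA.
Qed.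

Lemma le_integrable_EFin f g : measurable_fun setT f ->
  (forall x, `|f x| <= `|g x|) -> integrable g -> integrable f.
Proof.
move=> mf fg; apply: le_integrable => //; first exact/measurable_EFinP.
by move=> x _; rewrite lee_fin.
Qed.

Lemma integrableZ (r : R) f : integrable f -> integrable (fun x => r * f x).
Proof. exact: integrableZl. Qed.

Lemma integrableD_EFin f g : integrable f -> integrable g ->
  integrable (fun x => f x + g x).
Proof. exact: integrableD. Qed.

Lemma integrable_meas f : integrable f -> measurable_fun setT f.
Proof. by move=> /integrableP[/measurable_EFinP]. Qed.

Lemma integrable_norm f : integrable f -> integrable (fun x => `|f x|).
Proof.
move=> fi; apply: (le_integrable_EFin _ _ fi) => [|x].
  by apply: measurableT_comp => //; exact: integrable_meas.
by rewrite /= normr_id.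
Qed.

Lemma integrable_mul_bounded g K (k : R) : integrable g -> measurable_fun setT K ->
  (forall y, `|K y| <= k) -> integrable (fun y => g y * K y).
Proof.
move=> gi mK Kk; apply: (@le_integrable_EFin _ (fun y => k * g y)).
- by apply: measurable_funM => //; exact: integrable_meas.
- move=> y; rewrite !normrM mulrC ler_wpM2r//.
  by apply: le_trans (Kk y) _; exact: ler_norm.
- exact: integrableZ.
Qed.

Lemma integrable_mul_bump g F : integrable g -> bump_alg F ->
  integrable (fun y => g y * F y).
Proof.
move=> gi bF; have [k _ Fk] := bump_bounded bF.
by apply: (integrable_mul_bounded gi _ Fk); exact: bump_measurable.
Qed.

Lemma Rintegral_mul_le g K (k : R) : integrable g -> measurable_fun setT K ->
  (forall y, `|K y| <= k) ->
  `|\int[leb]_y (g y * K y)| <= (\int[leb]_y `|g y|) * k.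
Proof.
move=> gi mK Kk; have gKi := integrable_mul_bounded gi mK Kk.
apply: le_trans (le_normr_Rintegral measurableT gKi) _.
rewrite -RintegralZr//; last exact: integrable_norm.
apply: le_Rintegral => //; first exact: integrable_norm.
  under [X in _ _ X]eq_fun do rewrite mulrC.
  by apply: integrableZ; exact: integrable_norm.
by move=> y _; rewrite normrM ler_wpM2l.
Qed.

(** The convolution of [g] with the reflection of [rho]. With this sign the
definition of a weak derivative applies without any reflection. *)
Definition mollify g rho x := \int[leb]_y (g y * rho (y - x)).

Section mollify_kernel.
Variable g : V -> R.
Hypothesis gi : integrable g.

(** Pairing with [g] commutes with the linear operations of the bump algebra,
so Taylor estimates of the kernel pass to the mollified function. *)
Lemma pairing_add F G : bump_alg F -> bump_alg G ->
  \int[leb]_y (g y * (F y + G y)) = \int[leb]_y (g y * F y) + \int[leb]_y (g y * G y).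
Proof.
move=> bF bG; rewrite -RintegralD//; try exact: integrable_mul_bump.
by apply: eq_Rintegral => y _; rewrite mulrDr.
Qed.

Lemma pairing_scale (r : R) F : bump_alg F ->
  \int[leb]_y (g y * (r * F y)) = r * \int[leb]_y (g y * F y).
Proof.
move=> bF; rewrite -RintegralZl//; last exact: integrable_mul_bump.
by apply: eq_Rintegral => y _; rewrite mulrCA.
Qed.

Lemma pairing_sum n (F : 'I_n -> V -> R) : (forall i, bump_alg (F i)) ->
  \int[leb]_y (g y * \sum_(i < n) F i y) = \sum_(i < n) \int[leb]_y (g y * F i y).
Proof.
move=> bF; elim: n F bF => [|n IH] F bF.
  under eq_Rintegral do rewrite big_ord0 mulr0.
  by rewrite big_ord0 Rintegral_cst// mul0r.
rewrite big_ord_recl -IH//.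
under eq_Rintegral do rewrite big_ord_recl.
rewrite pairing_add//; exact: bump_sum.
Qed.

Lemma mollify_lipschitz rho : bump_alg rho ->
  exists2 C, 0 < C & forall x y, `|mollify g rho x - mollify g rho y| <= C * `|x - y|.
Proof.
move=> br; have [C C0 rC] := bump_lipschitz br.
pose I := \int[leb]_y `|g y|.
have I0 : 0 <= I by apply: Rintegral_ge0.
exists (I * C + 1); first by rewrite ltr_wpDl// mulr_ge0// ltW.
move=> x y.
have -> : mollify g rho x - mollify g rho y =
    \int[leb]_z (g z * (rho (z - x) + (-1) * rho (z - y))).
  rewrite pairing_add ?pairing_scale ?mulN1r//; try exact: bump_shift.
  apply: bump_mul; [exact: bump_cst|exact: bump_shift].
apply: (@le_trans _ _ (I * (C * `|x - y|))); last first.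
  by rewrite mulrA ler_wpM2r// lerDl.
apply: Rintegral_mul_le => //.
  apply: bump_measurable; apply: bump_add; first exact: bump_shift.
  apply: bump_mul; [exact: bump_cst|exact: bump_shift].
move=> z; rewrite mulN1r; apply: le_trans (rC _ _) _.
by rewrite opprB [z - x + _]addrC addrA subrK distrC.
Qed.

Lemma mollify_continuous rho : bump_alg rho -> continuous (mollify g rho).
Proof.
by move=> /mollify_lipschitz[C C0 cvC]; exact: lipschitz_continuousR cvC.
Qed.

Lemma mollify_measurable rho : bump_alg rho -> measurable_fun setT (mollify g rho).
Proof. by move=> br; apply: continuous_measurable_rV; exact: mollify_continuous. Qed.

(** The sign of the first-order term reflects that [rho] is evaluated at
[y - x]. *)
Lemma mollify_taylor1 rho : bump_alg rho -> exists2 C, 0 < C & forall x v,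
  `|mollify g rho (x + v) - mollify g rho x
    + \sum_(i < N) v ord0 i * mollify g (partial [:: i] rho) x| <= C * `|v| ^+ 2.
Proof.
move=> br; have [C C0 rC] := bump_taylor1 br.
pose I := \int[leb]_y `|g y|.
have I0 : 0 <= I by apply: Rintegral_ge0.
exists (I * C + 1); first by rewrite ltr_wpDl// mulr_ge0// ltW.
move=> x v.
have bp i : bump_alg (fun y => partial [:: i] rho (y - x)).
  by apply: bump_shift; exact: (bump_partial [:: i]).
have bvp : bump_alg (fun z => \sum_(i < N) v ord0 i * partial [:: i] rho (z - x)).
  by apply: bump_sum => i; apply: bump_mul => //; exact: bump_cst.
have bm (F : V -> R) : bump_alg F -> bump_alg (fun z => -1 * F z).
  by move=> bF; apply: bump_mul => //; exact: bump_cst.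
have bs y : bump_alg (fun z => rho (z - y)) by exact: bump_shift.
have -> : mollify g rho (x + v) - mollify g rho x
    + \sum_(i < N) v ord0 i * mollify g (partial [:: i] rho) x =
    \int[leb]_z (g z * ((rho (z - (x + v)) + (-1) * rho (z - x)) +
       \sum_(i < N) v ord0 i * partial [:: i] rho (z - x))).
  rewrite pairing_add//; last by apply: bump_add => //; exact: bm.
  rewrite pairing_add ?pairing_scale ?mulN1r//; last exact: bm.
  rewrite pairing_sum; last by move=> i; apply: bump_mul => //; exact: bump_cst.
  by congr (_ + _); apply: eq_bigr => i _; rewrite pairing_scale.
apply: (@le_trans _ _ (I * (C * `|v| ^+ 2))); last first.
  by rewrite mulrA ler_wpM2r ?exprn_ge0// lerDl.
apply: Rintegral_mul_le => //.
  by apply: bump_measurable; apply: bump_add => //; apply: bump_add => //; exact: bm.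
move=> z; have := rC (z - x) (- v); rewrite normrN; apply: le_trans.
rewrite opprD addrA mulN1r [X in _ + X](_ : _ =
    - \sum_(i < N) (- v) ord0 i * partial [:: i] rho (z - x))//.
by rewrite -sumrN; apply: eq_bigr => i _; rewrite mxE mulNr opprK.
Qed.

Lemma mollify_taylor2 rho : bump_alg rho -> exists2 C, 0 < C & forall x v,
  `|mollify g rho (x + v) + mollify g rho (x - v) - 2 * mollify g rho x
    - contract (fun i j => v ord0 i * v ord0 j)
        (fun i j => mollify g (partial [:: i; j] rho) x)| <= C * `|v| ^+ 3.
Proof.
move=> br; have [C C0 rC] := bump_taylor2 br.
pose I := \int[leb]_y `|g y|.
have I0 : 0 <= I by apply: Rintegral_ge0.
exists (I * C + 1); first by rewrite ltr_wpDl// mulr_ge0// ltW.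
move=> x v.
have bp i j : bump_alg (fun y => partial [:: i; j] rho (y - x)).
  by apply: bump_shift; exact: (bump_partial [:: i; j]).
have bZ r (F : V -> R) : bump_alg F -> bump_alg (fun z => r * F z).
  by move=> bF; apply: bump_mul => //; exact: bump_cst.
have bq : bump_alg (fun z => contract (fun i j => v ord0 i * v ord0 j)
   (fun i j => partial [:: i; j] rho (z - x))).
  by apply: bump_sum => i; apply: bump_sum => j; exact: bZ.
have bs y : bump_alg (fun z => rho (z - y)) by exact: bump_shift.
have -> : mollify g rho (x + v) + mollify g rho (x - v) - 2 * mollify g rho x
    - contract (fun i j => v ord0 i * v ord0 j)
        (fun i j => mollify g (partial [:: i; j] rho) x) =
    \int[leb]_z (g z * (((rho (z - (x + v)) + rho (z - (x - v)))
        + (- 2) * rho (z - x)) + (-1) * contract (fun i j => v ord0 i * v ord0 j)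
        (fun i j => partial [:: i; j] rho (z - x)))).
  rewrite pairing_add//; last 2 first.
  - by apply: bump_add; [exact: bump_add|exact: bZ].
  - exact: bZ.
  rewrite pairing_add ?pairing_scale ?mulNr ?mul1r//; last 2 first.
  - exact: bump_add.
  - exact: bZ.
  rewrite pairing_add//; congr (_ - _).
  rewrite pairing_sum => [|i]; last by apply: bump_sum => j; exact: bZ.
  apply: eq_bigr => i _; rewrite pairing_sum => [|j]; last exact: bZ.
  by apply: eq_bigr => j _; rewrite pairing_scale.
apply: (@le_trans _ _ (I * (C * `|v| ^+ 3))); last first.
  by rewrite mulrA ler_wpM2r ?exprn_ge0// lerDl.
apply: Rintegral_mul_le => //.
  apply: bump_measurable; apply: bump_add; last exact: bZ.
  by apply: bump_add; [exact: bump_add|exact: bZ].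
move=> z; have := rC (z - x) v; congr (`|_| <= _).
rewrite opprD opprB !addrA !mulNr mul1r [z - x - v]addrAC.
rewrite [X in _ = X - _ - _]addrC; congr (_ + rho _ - _ - _).
by rewrite addrAC.
Qed.

End mollify_kernel.
Definition mollifier (k : R) rho := [/\ bump_alg rho, forall x, 0 <= rho x,
  forall x, rho x != 0 -> `|x| <= k & \int[leb]_x rho x = 1].

Lemma cube_norm_lt (M : R) x : `|x| < M -> cube M x.
Proof.
move=> xM i; rewrite /= in_itv/= -ltr_norml.
by apply: le_lt_trans xM; exact: coord_norm_le.
Qed.

Lemma cube_norm_le (M : R) x : 0 <= M -> cube M x -> `|x| <= M.
Proof.
move=> M0 cx; apply: rV_norm_le => // i; have := cx i.
by rewrite /= in_itv/= -ltr_norml => /ltW.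
Qed.

Lemma integrable_bounded_cube f (M C : R) : measurable_fun setT f ->
  (forall x, f x != 0 -> `|x| <= M) -> (forall x, `|f x| <= C) -> integrable f.
Proof.
move=> mf fM fC; apply: (@le_integrable_EFin _ (fun x => C * \1_(cube (M + 1)) x)).
- exact: mf.
- move=> x; have [->|fx] := eqVneq (f x) 0; first by rewrite normr0.
  rewrite indicE mem_set; first by rewrite mulr1; apply: le_trans (fC x) (ler_norm _).
  by apply: cube_norm_lt; apply: le_lt_trans (fM x fx) _; rewrite ltrDl.
- apply: integrableZ; apply: integrable_indic_lty; first exact: measurable_open_box.
  exact: lebesgue_open_box_lty.
Qed.

Lemma integrable_bump F : bump_alg F ->
  (exists M, forall x, F x != 0 -> `|x| <= M) -> integrable F.
Proof.
move=> bF [M FM]; have [C _ FC] := bump_bounded bF.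
by apply: (integrable_bounded_cube _ FM FC); exact: bump_measurable.
Qed.

Lemma exists_mollifier (k : R) : 0 < k -> exists rho, mollifier k rho.
Proof.
move=> k0; pose r := @box_bump R N 1 (fun=> - k) (fun=> k).
have br : bump_alg r := bump_box_bump _ _ _.
have rN0 x : (r x != 0) = (x \in cube k).
  exact: (open_box_bump_neq0 0 (fun=> - k) (fun=> k) x).
have rk x : r x != 0 -> `|x| <= k.
  by rewrite rN0 inE => /cube_norm_le; apply; exact: ltW.
have ri : integrable r by apply: integrable_bump => //; exists k.
have r0 x : 0 <= r x by exact: box_bump_ge0.
pose J := \int[leb]_x r x.
have J0 : 0 < J.
  rewrite lt_def Rintegral_ge0// andbT; apply/eqP => J0.
  have : (\int[leb]_x `|(r x)%:E| = 0)%E.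
    under eq_integral do rewrite gee0_abs ?lee_fin//.
    rewrite -[LHS]fineK; first by congr EFin.
    exact: integrable_fin_num.
  move=> /ae_eq_integral_abs -/(_ measurableT).
  have mr : measurable_fun setT (EFin \o r) by apply/measurable_EFinP; exact: integrable_meas.
  move=> /(_ mr) [Z [mZ Z0 rZ]].
  have : (leb (cube k) <= 0)%E.
    rewrite -Z0; apply: le_measure; rewrite ?inE//; first exact: measurable_open_box.
    move=> x kx; apply: rZ => /= /(_ I)[] /eqP; apply/negP.
    by rewrite rN0 mem_set.
  rewrite (@lebesgue_rV_itv R N false true).
    rewrite lee_fin leNgt => /negP; apply; apply: prodr_gt0 => i _.
    by rewrite opprK addr_gt0.
  by move=> _; rewrite -subr_ge0 opprK addr_ge0 ?ltW.
exists (fun x => J^-1 * r x); split.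
- by apply: bump_mul => //; exact: bump_cst.
- by move=> x; rewrite mulr_ge0 ?invr_ge0 ?(ltW J0).
- by move=> x; rewrite mulf_eq0 negb_or => /andP[_]; exact: rk.
- by rewrite RintegralZl// mulVf// gt_eqF.
Qed.

Lemma mollifier_integrable k rho : mollifier k rho -> integrable rho.
Proof. by move=> [br _ rk _]; apply: integrable_bump => //; exists k. Qed.

Lemma mollify_shift g rho x : integrable g -> bump_alg rho ->
  mollify g rho x = \int[leb]_y (g (y + x) * rho y).
Proof.
move=> gi br.
rewrite /mollify -(@Rintegral_shift R N x (fun y => g y * rho (y - x))).
  by apply: eq_Rintegral => y _; rewrite addrK.
by apply: integrable_mul_bump => //; exact: bump_shift.
Qed.

Lemma integrable_shift g x : integrable g -> integrable (fun y => g (y + x)).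
Proof. exact: integrable_rV_shift. Qed.

(** Integrate the tangent line inequality [expr_tangent_le] at the mean value
[m] against the probability density [rho]. *)
Lemma mollify_jensen g rho k x p : integrable g -> mollifier k rho ->
  ((`|mollify g rho x| ^+ p.+1)%:E <=
    \int[leb]_y (`|g (y + x)| ^+ p.+1 * rho y)%:E)%E.
Proof.
move=> gi mr; have [br r0 rk r1] := mr.
have ri := mollifier_integrable mr.
pose d y := `|g (y + x)|; have d0 y : 0 <= d y by exact: normr_ge0.
have di : integrable d by apply: integrable_norm; exact: integrable_shift.
have md : measurable_fun setT d by exact: integrable_meas.
have dri : integrable (fun y => d y * rho y) by exact: integrable_mul_bump.
pose m := \int[leb]_y (d y * rho y).
have m0 : 0 <= m by apply: Rintegral_ge0 => y _; rewrite mulr_ge0.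
have cvm : `|mollify g rho x| <= m.
  rewrite mollify_shift//; apply: le_trans.
    apply: le_normr_Rintegral => //; apply: integrable_mul_bump => //.
    exact: integrable_shift.
  apply: le_Rintegral => //.
    apply: integrable_norm; apply: integrable_mul_bump => //; exact: integrable_shift.
  by move=> y _; rewrite normrM (ger0_norm (r0 y)).
have mh : measurable_fun setT (fun y => (d y ^+ p.+1 * rho y)).
  by apply: measurable_funM; [exact: measurable_funX|exact: bump_measurable].
have [oo|oo] := leP +oo%E (\int[leb]_y (`|g (y + x)| ^+ p.+1 * rho y)%:E)%E.
  by apply: le_trans oo; rewrite leey.
have hi : integrable (fun y => d y ^+ p.+1 * rho y).
  apply/integrableP; split; first exact/measurable_EFinP.
  rewrite (eq_integral (fun y => (`|g (y + x)| ^+ p.+1 * rho y)%:E))// => y _.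
  by rewrite /= ger0_norm// mulr_ge0 ?exprn_ge0.
rewrite -[leRHS]fineK; last exact: integrable_fin_num.
rewrite lee_fin; apply: (@le_trans _ _ (m ^+ p.+1)); first by rewrite lerXn2r ?nnegrE.
(* The tangent line of [t ^+ p.+1] at [m] is [A * t + B]. *)
pose A := p.+1%:R * m ^+ p; pose B := m ^+ p.+1 - A * m.
have <- : \int[leb]_y (A * (d y * rho y) + B * rho y) = m ^+ p.+1.
  rewrite RintegralD//; try exact: integrableZ.
  by rewrite !RintegralZl// r1 -/m /B; ring.
apply: le_Rintegral => //; first by apply: integrableD_EFin; exact: integrableZ.
move=> y _; rewrite mulrA -mulrDl ler_wpM2r//.
apply: le_trans (expr_tangent_le p m0 (normr_ge0 (g (y + x)))).
by rewrite /B /A /d; lra.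
Qed.

(** Mollification does not increase the [L^p] norm: integrate [mollify_jensen],
exchange the integrals and use translation invariance. *)
Lemma mollify_young g rho k p : integrable g -> mollifier k rho ->
  (\int[leb]_x (`|mollify g rho x| ^+ p.+1)%:E <= \int[leb]_x (`|g x| ^+ p.+1)%:E)%E.
Proof.
move=> gi mr; have [br r0 rk r1] := mr; have mg := integrable_meas gi.
have ri := mollifier_integrable mr.
pose F (z : V * V) := (`|g (z.2 + z.1)| ^+ p.+1 * rho z.2)%:E.
have mgp : measurable_fun setT (fun x => (`|g x| ^+ p.+1)%:E).
  exact: measurable_norm_expr.
have mF : measurable_fun setT F.
  apply/measurable_EFinP; apply: measurable_funM; last first.
    by apply: measurableT_comp (bump_measurable br) _; exact: measurable_snd.
  apply: measurable_funX; apply: measurableT_comp => //.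
  apply: (measurableT_comp mg); under eq_fun do rewrite addrC.
  exact: measurable_add2.
have F0 z : (0 <= F z)%E by rewrite lee_fin mulr_ge0 ?exprn_ge0.
apply: (@le_trans _ _ (\int[leb]_x \int[leb]_y F (x, y))%E).
  apply: ge0_le_integral => //.
  - by apply: measurable_norm_expr; exact: mollify_measurable.
  - exact: measurable_fun_fubini_tonelli_F.
  - by move=> x _; exact: (mollify_jensen x p gi mr).
rewrite (@fubini_tonelli _ _ _ _ R leb leb F mF F0).
rewrite (eq_integral (fun y => (\int[leb]_x (`|g x| ^+ p.+1)%:E) * (rho y)%:E)%E).
  have mrE : measurable_fun setT (EFin \o rho).
    by apply/measurable_EFinP; exact: bump_measurable.
  have r0E y : setT y -> (0 <= (EFin \o rho) y)%E by move=> _; rewrite lee_fin.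
  have I0 : (0 <= \int[leb]_x (`|g x| ^+ p.+1)%:E)%E.
    by apply: integral_ge0 => x _; rewrite lee_fin exprn_ge0.
  rewrite (ge0_integralZl leb measurableT mrE r0E I0).
  rewrite [X in (_ * X)%E](_ : _ = 1%E) ?mule1//.
  by rewrite -[LHS]fineK ?integrable_fin_num//; congr EFin.
move=> y _; rewrite -(@ge0_integral_rV_shift R N y)//.
rewrite muleC -ge0_integralZl//; last 2 first.
- by apply: (measurableT_comp mgp); exact: measurable_addr.
- by rewrite lee_fin.
by apply: eq_integral => x _; rewrite /F/= -EFinM mulrC [y + x]addrC.
Qed.

Lemma lip_supp_integrable f : lip_supp f -> integrable f.
Proof.
move=> [mf [L L0 fL] [M fM]].
apply: (@integrable_bounded_cube f M (`|f 0| + L * `|M|)) => // x.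
have [->|fx] := eqVneq (f x) 0.
  by rewrite normr0 addr_ge0// mulr_ge0// ltW.
rewrite -[f x](subrK (f 0)) addrC; apply: le_trans (ler_normD _ _) _.
rewrite lerD2l; apply: le_trans (fL _ _) _; rewrite ler_wpM2l ?(ltW L0)// subr0.
by apply: le_trans (fM x fx) (ler_norm _).
Qed.

Lemma mollifyB f g rho : integrable f -> integrable g -> bump_alg rho ->
  forall x, mollify f rho x - mollify g rho x = mollify (fun y => f y - g y) rho x.
Proof.
move=> fi gi br x; rewrite /mollify -RintegralB//.
- by apply: eq_Rintegral => y _; rewrite mulrBl.
- by apply: integrable_mul_bump => //; exact: bump_shift.
- by apply: integrable_mul_bump => //; exact: bump_shift.
Qed.

(** Mollification at scale [k] moves a Lipschitz function by at most a multiple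
of [k], uniformly, and the difference has bounded support. *)
Lemma Lp_err_mollify_lip_supp f p e : lip_supp f -> 0 < e -> exists2 k0, 0 < k0 &
  forall k rho, k <= k0 -> mollifier k rho ->
    (Lp_err p.+1 (mollify f rho) f <= e%:E)%E.
Proof.
move=> nf e0; have fi := lip_supp_integrable nf; have [mf [L L0 fL] [M fM]] := nf.
pose c := fine (leb (cube (`|M| + 2))).
have c0 : 0 <= c by rewrite fine_ge0.
have cE : leb (cube (`|M| + 2)) = c%:E.
  by rewrite fineK// ge0_fin_numE//; exact: lebesgue_open_box_lty.
exists (Num.min 1 (Num.min L^-1 (e / (L * (c + 1))))).
  by rewrite !lt_min ltr01 invr_gt0 L0 divr_gt0// mulr_gt0// ltr_wpDl.
move=> k rho; rewrite !le_min => /and3P[k1 kL ke] mr.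
have ri := mollifier_integrable mr; have [br r0 rk r1] := mr.
have k_ge0 : 0 <= k.
  rewrite leNgt; apply/negP => kl0; have : \int[leb]_x rho x = 0.
    rewrite (@eq_Rintegral _ _ _ leb setT (cst 0)); first by rewrite Rintegral_cst// mul0r.
    move=> x _ /=; apply/eqP/negPn/negP => /rk; apply/negP; rewrite -ltNge.
    exact: lt_le_trans kl0 (normr_ge0 x).
  by rewrite r1 => /eqP; rewrite oner_eq0.
have fi' x : integrable (fun y => f (y + x) * rho y).
  by apply: integrable_mul_bump => //; exact: integrable_shift.
have H x : `|mollify f rho x - f x| <= L * k * \1_(cube (`|M| + 2)) x.
  rewrite indicE; have [xM|xM] := boolP (x \in _).
    rewrite mulr1 mollify_shift//.
    have {1}-> : f x = \int[leb]_y (f x * rho y) by rewrite RintegralZl// r1 mulr1.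
    rewrite -RintegralB//; last exact: integrableZ.
    apply: le_trans (le_normr_Rintegral measurableT _) _.
      have := integrableD_EFin (fi' x) (integrableZ (- f x) ri).
      by congr (_.-integrable _ _); apply/funext => y; rewrite /= mulNr.
    have -> : L * k = \int[leb]_y (L * k * rho y) by rewrite RintegralZl// r1 mulr1.
    apply: le_Rintegral => //; last 2 first.
    - exact: integrableZ.
    - move=> y _; rewrite -mulrBl normrM (ger0_norm (r0 y)).
      have [->|ry] := eqVneq (rho y) 0; first by rewrite !mulr0.
      rewrite ler_wpM2r//; apply: le_trans (fL _ _) _.
      by rewrite addrK ler_wpM2l ?(ltW L0)// rk.
    apply: integrable_norm.
    have := integrableD_EFin (fi' x) (integrableZ (- f x) ri).
    by congr (_.-integrable _ _); apply/funext => y; rewrite /= mulNr.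
  rewrite mulr0 mollify_shift// normr_le0 subr_eq0; apply/eqP.
  have xM' : `|M| + 2 <= `|x|.
    by rewrite leNgt; apply: contra xM => xM; rewrite inE; exact: cube_norm_lt.
  have fx0 y : `|x| - 1 <= `|y| -> f y = 0.
    move=> xy; apply/eqP/negPn/negP => /fM yM.
    have := le_trans yM (ler_norm M); move: xM' xy; lra.
  rewrite fx0; last by rewrite lerBlDr lerDl.
  rewrite (@eq_Rintegral _ _ _ leb setT (cst 0)); first by rewrite Rintegral_cst// mul0r.
  move=> y _ /=; have [->|ry] := eqVneq (rho y) 0; first by rewrite mulr0.
  rewrite fx0 ?mul0r// lerBlDr -[x in `|x|](addKr y) addrC.
  apply: le_trans (ler_normD _ _) _; rewrite normrN [y + x]addrC lerD2l.
  exact: le_trans (rk _ ry) k1.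
have Lk1 : L * k <= 1 by rewrite mulrC -ler_pdivlMr// div1r.
apply: (@le_trans _ _ (\int[leb]_x (L * k * \1_(cube (`|M| + 2)) x)%:E)%E).
  apply: ge0_le_integral => //.
  - by apply: measurable_Lp_err => //; exact: mollify_measurable.
  - apply/measurable_EFinP; apply: measurable_funM; first exact: measurable_cst.
    by apply: measurable_indic; exact: measurable_open_box.
  move=> x _; rewrite lee_fin; apply: le_trans (H x).
  rewrite exprS ler_piMr// exprn_ile1//; apply: le_trans (H x) _.
  rewrite indicE; case: (x \in _); rewrite ?mulr1 ?mulr0//.
have LkE : (L * k)%:E = (L * k)%:E by [].
rewrite (eq_integral (fun x => (L * k)%:E * (\1_(cube (`|M| + 2)) x)%:E)%E); last first.
  by move=> x _; rewrite EFinM.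
rewrite ge0_integralZl//; last 2 first.
- by apply/measurable_EFinP; apply: measurable_indic; exact: measurable_open_box.
- by rewrite lee_fin mulr_ge0// ltW.
rewrite [X in (_ * X)%E](_ : _ = c%:E); last first.
  by rewrite integral_indic ?setIT//; exact: measurable_open_box.
rewrite -EFinM lee_fin.
apply: (@le_trans _ _ (L * k * (c + 1))).
  by rewrite ler_wpM2l ?mulr_ge0 ?(ltW L0)// lerDl.
by rewrite mulrAC -ler_pdivlMl ?mulr_gt0 ?ltr_wpDl// mulrC.
Qed.

(** Approximate [g] by a Lipschitz function of bounded support; the difference
is controlled uniformly in the mollifier by [mollify_young]. *)
Lemma Lp_err_mollify g (M : R) p e : integrable g ->
  (forall x, g x != 0 -> cube M x) ->
  (\int[leb]_x (`|g x| ^+ p.+1)%:E < +oo)%E -> 0 < e ->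
  exists2 k0, 0 < k0 & forall k rho, k <= k0 -> mollifier k rho ->
    (Lp_err p.+1 (mollify g rho) g <= e%:E)%E.
Proof.
move=> gi gM goo e0; have mg := integrable_meas gi.
have P0 : 0 < 2 ^+ p.+1 :> R by rewrite exprn_gt0.
pose e1 := e / (2 ^+ p.+1 * (1 + 2 ^+ p.+1 * 2)).
have e10 : 0 < e1 by rewrite divr_gt0// mulr_gt0// addr_gt0// mulr_gt0.
have [_ ag] := lip_approx_Lp (ltn0Sn p) mg gM goo.
have [f nf gf] := ag _ e10.
have fi := lip_supp_integrable nf; have [mf _ _] := nf.
have [k0 k00 H] := Lp_err_mollify_lip_supp p nf e10.
exists k0 => // k rho kk0 mr; have [br _ _ _] := mr.
have mcg := mollify_measurable gi br; have mcf := mollify_measurable fi br.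
apply: (@le_trans _ _ ((2 ^+ p.+1)%:E * (Lp_err p.+1 (mollify g rho) (mollify f rho)
   + Lp_err p.+1 (mollify f rho) g))%E).
  by apply: le_Lp_err2 => // x; exact: ler_distD.
apply: (@le_trans _ _ ((2 ^+ p.+1)%:E * (e1%:E + (2 ^+ p.+1)%:E * (e1%:E + e1%:E)))%E).
  rewrite lee_pmul2l ?lte_fin//; apply: leeD.
    apply: le_trans gf; rewrite /Lp_err.
    under eq_integral => x _ do rewrite mollifyB//.
    apply: mollify_young mr.
    have := integrableD_EFin gi (integrableZ (- 1) fi).
    by congr (_.-integrable _ _); apply/funext => y; rewrite /= mulN1r.
  apply: (@le_trans _ _ ((2 ^+ p.+1)%:E * (Lp_err p.+1 (mollify f rho) f + Lp_err p.+1 f g))%E).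
    by apply: le_Lp_err2 => // x; exact: ler_distD.
  rewrite lee_pmul2l ?lte_fin//; apply: leeD; first exact: H mr.
  apply: le_trans gf; rewrite /Lp_err.
  by under eq_integral => x _ do rewrite distrC.
rewrite -!(EFinD, EFinM) lee_fin.
rewrite (_ : _ * _ = e1 * (2 ^+ p.+1 * (1 + 2 ^+ p.+1 * 2))); last by ring.
by rewrite /e1 divfK// gt_eqF// mulr_gt0// addr_gt0// mulr_gt0.
Qed.

End convolution.

(** * Contact points and their slopes *)

Section grid.
Variables (R : realType) (N : nat).
Local Notation V := 'rV[R]_N.
Local Notation leb := (@lebesgue_rV R N).
Implicit Types (x y z p c : V).

Lemma lebesgue_rV_bigsetU_le (I : Type) (s : seq I) (F : I -> set V) :
  (forall i, measurable (F i)) ->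
  (leb (\big[setU/set0]_(i <- s) F i) <= \sum_(i <- s) leb (F i))%E.
Proof.
move=> mF; elim: s => [|i s IH]; first by rewrite !big_nil measure0.
rewrite !big_cons; apply: le_trans (measureU2 _ _ _) _ => //.
  exact: bigsetU_measurable.
exact: leeD.
Qed.

Definition cell (h : R) c := [set z : V | forall i,
  `[c ord0 i, c ord0 i + h[%classic (z ord0 i : R)].

Lemma measurable_cell h c : measurable (cell h c).
Proof. exact: (@measurable_itv_box R N true true (fun i => c ord0 i)). Qed.

Lemma lebesgue_cell h c : 0 <= h -> leb (cell h c) = (h ^+ N)%:E.
Proof.
move=> h0; rewrite (@lebesgue_rV_itv R N true true (fun i => c ord0 i)).
  rewrite (eq_bigr (fun=> h)) ?prodr_const ?card_ord// => i _.
  by rewrite addrC addKr.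
by move=> i; rewrite lerDl.
Qed.

Lemma lebesgue_closed_box c (r : R) : 0 <= r ->
  leb [set z : V | forall i, `[c ord0 i - r, c ord0 i + r]%classic (z ord0 i : R)]
  = ((2 * r) ^+ N)%:E.
Proof.
move=> r0; rewrite (@lebesgue_rV_itv R N true false (fun i => c ord0 i - r)
   (fun i => c ord0 i + r)).
  rewrite (eq_bigr (fun=> 2 * r)) ?prodr_const ?card_ord// => i _.
  by ring.
by move=> i; rewrite lerD2l; lra.
Qed.

(** A discrete form of the area formula for the relation [S] between slopes [p]
and points [x]. If the slopes attached to the points of each cell lie in a ball
whose volume is at most the integral of [H] over that cell, then the volume of
the set of all slopes is at most the integral of [H]. Balls are cubes here, as
the norm is the maximum norm. *)
Lemma grid_cover (S : V -> V -> Prop) (x0 : V) (rho eta : R) (n : nat)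
    (H : V -> \bar R) : 0 < rho -> 0 <= eta -> (0 < n)%N ->
  measurable_fun setT H -> (forall x, 0 <= H x)%E ->
  (forall p, `|p| <= eta -> exists2 x, `|x - x0| < rho & S p x) ->
  (forall c p x, S p x -> cell (2 * rho / n%:R) c x ->
    exists r, [/\ 0 <= r,
      forall p' x', S p' x' -> cell (2 * rho / n%:R) c x' -> `|p' - p| <= r &
      (((2 * r) ^+ N)%:E <= \int[leb]_(z in cell (2 * rho / n%:R) c) H z)%E]) ->
  (((2 * eta) ^+ N)%:E <= \int[leb]_z H z)%E.
Proof.
move=> rho0 eta0 n0 mH H0 Sx Sc.
set h := 2 * rho / n%:R in Sc.
have n0' : 0 < n%:R :> R by rewrite ltr0n.
have h0 : 0 < h by rewrite divr_gt0// mulr_gt0.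
pose T := {ffun 'I_N -> 'I_n}.
(* The n^N half-open cells of side [h] that tile the cube of radius [rho]. *)
pose c (t : T) : V := \row_i (x0 ord0 i - rho + h * (t i)%:R).
pose Q t := cell h (c t).
have : forall t : T, exists U : set V, [/\ measurable U,
    forall p x, `|p| <= eta -> S p x -> Q t x -> U p &
    (leb U <= \int[leb]_(z in Q t) H z)%E].
  move=> t; have [[p [x [Spx Qx]]]|nS] := pselect (exists p x, S p x /\ Q t x).
    have [r [r0 pr rH]] := Sc _ _ _ Spx Qx.
    exists [set z : V | forall i, `[p ord0 i - r, p ord0 i + r]%classic (z ord0 i : R)].
    split.
    - exact: (@measurable_itv_box R N true false (fun i => p ord0 i - r)).
    - move=> p' x' _ Sp'x' Qx' i; have := pr _ _ Sp'x' Qx'.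
      move=> /(le_trans (coord_norm_le _ i)); rewrite !mxE ler_norml => /andP[h1 h2].
      by rewrite /= in_itv/=; apply/andP; split; lra.
    - by rewrite lebesgue_closed_box.
  exists set0; split=> // [p x _ Spx Qx|]; first by case: nS; exists p, x.
  by rewrite measure0 integral_ge0.
move=> /(_ _)/cid-/all_sig[U HU].
have mU t : measurable (U t) by have [] := HU t.
have cover : [set p : V | forall i, `[(0 : V) ord0 i - eta, (0 : V) ord0 i + eta]%classic (p ord0 i : R)]
    `<=` \big[setU/set0]_(t : T) U t.
  move=> p pe; have pe' : `|p| <= eta.
    apply: rV_norm_le => // i; have := pe i; rewrite /= in_itv/= mxE ler_norml.
    by rewrite !add0r.
  have [x xr Spx] := Sx p pe'.
  have xi i : 0 <= (x ord0 i - x0 ord0 i + rho) / h < n%:R.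
    have := le_lt_trans (coord_norm_le _ i) xr; rewrite !mxE ltr_norml => /andP[h1 h2].
    rewrite ltr_pdivrMr// divr_ge0 ?(ltW h0)//=; last by lra.
    rewrite /h mulrC divfK ?gt_eqF//; lra.
  have tn i : (Num.truncn ((x ord0 i - x0 ord0 i + rho) / h) < n)%N.
    have /andP[h1 h2] := xi i; rewrite -(ltr_nat R); apply: le_lt_trans h2.
    by rewrite truncn_le.
  pose t : T := [ffun i => Ordinal (tn i)].
  have [_ + _] := HU t => /(_ p x pe' Spx) Utp.
  rewrite -bigcup_seq/=; exists t; first by rewrite /= mem_index_enum.
  apply: Utp => i; rewrite /= in_itv/= mxE ffunE/=.
  have /andP[h1 _] := xi i; have /andP[] := truncn_itv h1.
  rewrite -natr1 ler_pdivlMr// ltr_pdivrMr// => h3 h4.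
  by apply/andP; split; lra.
rewrite -(@lebesgue_closed_box 0 eta)//.
apply: (@le_trans _ _ (leb (\big[setU/set0]_(t : T) U t))).
  apply: le_measure; rewrite ?inE//.
    exact: (@measurable_itv_box R N true false (fun i => (0 : V) ord0 i - eta)).
  exact: bigsetU_measurable.
apply: le_trans (lebesgue_rV_bigsetU_le _ _) _ => //.
apply: (@le_trans _ _ (\sum_(t : T) \int[leb]_(z in Q t) H z)%E).
  by apply: lee_sum => t _; have [] := HU t.
rewrite -ge0_integral_bigsetU//.
- apply: ge0_subset_integral => //.
  by apply: bigsetU_measurable => t _; exact: measurable_cell.
- by move=> t; exact: measurable_cell.
- exact: index_enum_uniq.
- move=> t u _ _ [z [Qt Qu]]; apply/ffunP => i; apply/val_inj => /=.
  have := Qt i; have := Qu i; rewrite /= !in_itv/= !mxE => /andP[u1 u2] /andP[t1 t2].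
  have tu : h * (t i)%:R < h * (u i)%:R + h by lra.
  have ut : h * (u i)%:R < h * (t i)%:R + h by lra.
  move: tu ut; rewrite -[X in _ + X]mulr1 -mulrDr ltr_pM2l// natr1 ltr_nat ltnS => tu.
  rewrite -[X in _ + X]mulr1 -mulrDr ltr_pM2l// natr1 ltr_nat ltnS => ut.
  by apply/eqP; rewrite eqn_leq tu ut.
- exact: measurable_funTS.
Qed.

End grid.

Section contact.
Variables (R : realType) (N : nat).
Local Notation V := 'rV[R]_N.
Implicit Types (x y z p v : V) (P : V -> R).

Lemma dotvD p v u : dotv p (v + u) = dotv p v + dotv p u.
Proof.
by rewrite /dotv -big_split/=; apply: eq_bigr => i _; rewrite mxE mulrDr.
Qed.

Lemma dotvN p v : dotv p (- v) = - dotv p v.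
Proof. by rewrite /dotv -sumrN; apply: eq_bigr => i _; rewrite mxE mulrN. Qed.

Lemma dotvBl p q v : dotv (p - q) v = dotv p v - dotv q v.
Proof.
by rewrite /dotv -sumrB; apply: eq_bigr => i _; rewrite !mxE mulrBl.
Qed.

Lemma dotv_unitv p (t : R) i : dotv p (t *: unitv R i) = t * p ord0 i.
Proof.
rewrite /dotv (bigD1 i)//= big1 ?addr0 => [|j /negPf ji].
  by rewrite !mxE !eqxx/= mulr1 mulrC.
by rewrite !mxE ji andbF !mulr0.
Qed.

Lemma norm_unitv_le (t : R) i : `|t *: (unitv R i : V)| <= `|t|.
Proof.
apply: rV_norm_le => // j; rewrite !mxE normrM ler_piMr//.
by case: (_ && _); rewrite ?normr1 ?normr0.
Qed.

Lemma dotv_norm_le p v : `|dotv p v| <= N%:R * (`|p| * `|v|).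
Proof.
apply: le_trans (ler_norm_sum _ _ _) _.
apply: (@le_trans _ _ (\sum_(i < N) `|p| * `|v|)).
  by apply: ler_sum => i _; rewrite normrM ler_pM ?coord_norm_le.
by rewrite sumr_const card_ord mulr_natl.
Qed.

Definition cball x0 (r : R) := [set x : V | `|x - x0| <= r].

Lemma closed_cball x0 r : closed (cball x0 r).
Proof.
have -> : cball x0 r = (fun x : V => `|x - x0|) @^-1` [set t | t <= r] by [].
apply: preimage_closed; last exact: closed_le.
move=> x _; apply: lipschitz_continuousR ltr01 _ x => x y.
rewrite mul1r; apply: le_trans (ler_dist_dist _ _) _.
by rewrite opprB addrA subrK.
Qed.

Lemma compact_cball x0 r : compact (cball x0 r).
Proof.
apply: bounded_closed_compact; last exact: closed_cball.
exists (`|x0| + r); split; first exact: num_real.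
move=> e xe x; rewrite /cball/= => Bx; apply/ltW.
apply: le_lt_trans xe; rewrite -[x](subrK x0) addrC.
by apply: le_trans (ler_normD _ _) _; rewrite lerD2l.
Qed.

(** An affine function of slope [p] touches [P] from below at [x]. The
inequality is required on a ball twice as large as the one that contains [x],
so that all directions around [x] can be tested. *)
Definition contact P x0 (s : R) p x := `|x - x0| < s /\
  forall y, `|y - x0| <= 2 * s -> P x + dotv p (y - x) <= P y.

(** Minimize [P x - p . (x - x0)] on the large ball. The gap between the
values of [P] at [x0] and away from it exceeds the variation of the linear
term, so the minimum is not attained far from [x0]. *)
Lemma exists_contact P x0 (s eta mu0 mu1 : R) p : 0 < s -> continuous P ->
  P x0 <= mu0 -> (forall x, s <= `|x - x0| <= 2 * s -> mu1 <= P x) ->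
  N%:R * (eta * (2 * s)) < mu1 - mu0 -> `|p| <= eta ->
  exists x, contact P x0 s p x.
Proof.
move=> s0 cP P0 P1 small peta.
pose B := cball x0 (2 * s); have cB : compact B := @compact_cball x0 _.
have B0 : B !=set0 by exists x0; rewrite /B/cball/= subrr normr0 mulr_ge0// ltW.
have cF : {within B, continuous (fun x => P x - dotv p (x - x0))}.
  have lp : forall x y, `|dotv p (x - x0) - dotv p (y - x0)| <=
      (N%:R * `|p| + 1) * `|x - y|.
    move=> u y; rewrite -dotvN -dotvD opprB addrA subrK.
    apply: le_trans (dotv_norm_le _ _) _.
    by rewrite mulrA ler_wpM2r// lerDl.
  have cG : continuous (fun x : V => dotv p (x - x0)).
    by apply: lipschitz_continuousR lp; rewrite ltr_wpDl// mulr_ge0.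
  apply: continuous_subspaceT => x; exact: (continuousB (cP x) (cG x)).
have [x xB xmin] := EVT_min_rV B0 cB cF.
exists x; rewrite inE in xB; split; last first.
  move=> y yB; have := xmin y; rewrite inE => /(_ yB).
  have -> : dotv p (y - x) = dotv p (y - x0) - dotv p (x - x0).
    by rewrite -dotvN -dotvD opprB addrA subrK.
  lra.
rewrite ltNge; apply/negP => sx.
have := xmin x0; rewrite inE => /(_ _)/wrap[].
  by rewrite /B/cball/= subrr normr0 mulr_ge0// ltW.
rewrite subrr (_ : dotv p 0 = 0); last first.
  by rewrite /dotv big1// => i _; rewrite mxE mulr0.
have := P1 x; rewrite sx xB => /(_ isT) Px.
have := le_trans (ler_norm _) (dotv_norm_le p (x - x0)).
have : N%:R * (`|p| * `|x - x0|) <= N%:R * (eta * (2 * s)).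
  by rewrite ler_wpM2l// ler_pM.
lra.
Qed.

Lemma contact_gradient P x0 (s C : R) p x (g : 'I_N -> R) : 0 < s ->
  (forall v, `|v| <= s ->
     `|P (x + v) - P x - \sum_(i < N) v ord0 i * g i| <= C * `|v| ^+ 2) ->
  contact P x0 s p x -> forall i, p ord0 i = g i.
Proof.
move=> s0 Pg [xs cx] i; apply/eqP; rewrite eq_sym -subr_eq0; apply/eqP.
apply: (@linear_coef_eq0 R _ `|C| s s0) => t ts.
have vs : `|t *: unitv R i| <= s by apply: le_trans (norm_unitv_le t i) ts.
have := Pg _ vs; have := cx (x + t *: unitv R i).
have -> : \sum_(j < N) (t *: unitv R i) ord0 j * g j = t * g i.
  by under eq_bigr do rewrite mxE -mulrA; rewrite -mulr_sumr sum_unitv.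
rewrite [x + _ - x]addrC addKr dotv_unitv => /(_ _)/wrap[].
  rewrite addrAC; apply: le_trans (ler_normD _ _) _; move: xs vs; lra.
have : C * `|t *: unitv R i| ^+ 2 <= `|C| * t ^+ 2.
  apply: (@le_trans _ _ (`|C| * `|t *: unitv R i| ^+ 2)).
    by rewrite ler_wpM2r ?exprn_ge0// ler_norm.
  by rewrite ler_wpM2l// -[t ^+ 2]real_normK ?num_real// lerXn2r ?nnegrE// norm_unitv_le.
move=> h1 h2 /ler_normlP[h3 h4]; move: h1 h2 h3 h4; lra.
Qed.

Section second_order.
Variables (P : V -> R) (x0 : V) (s C : R) (x : V) (D : 'I_N -> 'I_N -> R).
Hypotheses (s0 : 0 < s) (C0 : 0 <= C).
Hypothesis PD : forall v, `|v| <= s ->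
  `|P (x + v) + P (x - v) - 2 * P x - contract (fun i j => v ord0 i * v ord0 j) D|
  <= C * `|v| ^+ 3.

Let in_ball y : `|x - x0| < s -> `|y| <= s -> `|x + y - x0| <= 2 * s.
Proof.
move=> xs vs; rewrite addrAC; apply: le_trans (ler_normD _ _) _.
move: xs vs; lra.
Qed.

Lemma contact_psd p : contact P x0 s p x -> psd D.
Proof.
move=> [xs cx] y; rewrite leNgt; apply/negP => yD.
pose u : V := \row_i y i.
pose a := - contract (fun i j => y i * y j) D.
have a0 : 0 < a by rewrite oppr_gt0.
have u1 : 0 < `|u| + 1 by rewrite ltr_wpDl.
pose t := Num.min (s / (`|u| + 1)) (a / (2 * (C * `|u| ^+ 3 + 1))).
have CU : 0 < C * `|u| ^+ 3 + 1 by rewrite ltr_wpDl// mulr_ge0// exprn_ge0.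
have t0 : 0 < t by rewrite lt_min !divr_gt0// mulr_gt0.
have tu : `|t *: u| <= s.
  rewrite normrZ (gtr0_norm t0); apply: (@le_trans _ _ (t * (`|u| + 1))).
    by rewrite ler_pM2l// lerDl.
  by rewrite -ler_pdivlMr// ge_min lexx.
have := PD tu.
have -> : contract (fun i j => (t *: u) ord0 i * (t *: u) ord0 j) D = - (t ^+ 2 * a).
  rewrite /a mulrN opprK /contract mulr_sumr; apply: eq_bigr => i _.
  by rewrite mulr_sumr; apply: eq_bigr => j _; rewrite !mxE; ring.
have h1 := cx (x + t *: u) (in_ball xs tu).
have tu' : `|- (t *: u)| <= s by rewrite normrN.
have h2 := cx (x - t *: u) (in_ball xs tu').
move: h1 h2; rewrite ![x + _ - x]addrC !addKr dotvN => h1 h2.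
move=> /ler_normlP[_ h3].
have : t ^+ 2 * a <= C * `|t *: u| ^+ 3 by move: h1 h2 h3; lra.
rewrite (_ : C * _ = t ^+ 2 * (t * (C * `|u| ^+ 3))); last first.
  by rewrite normrZ (gtr0_norm t0); ring.
rewrite ler_pM2l ?exprn_gt0//.
have : t * (2 * (C * `|u| ^+ 3 + 1)) <= a.
  by rewrite -ler_pdivlMr ?mulr_gt0// ge_min lexx orbT.
move: t0 a0; set X := C * _; move=> t0 a0; nra.
Qed.

(** Compare the affine function that touches at [x'] with the second-order
expansion of [P] at [x], along a displacement [v] of length at most [2 * h]
chosen in the direction where the two slopes differ most. So the variation of
the slope is bounded by the Hessian at the single point [x]. *)
Lemma contact_slope_le p x' p' (h tau : R) : contact P x0 s p x ->
  contact P x0 s p' x' -> `|x' - x| <= h -> 0 < h -> 2 * h <= s ->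
  2 * C * h <= tau ->
  `|p' - p| <= 4 * (N%:R ^+ 2 * trace D + tau) * h.
Proof.
move=> cpx cpx' xh h0 hs tauh.
have pD := contact_psd cpx; have K0 := psd_trace_ge0 pD.
have [xs cx] := cpx; have [xs' cx'] := cpx'.
have tau0 : 0 <= tau by apply: le_trans tauh; rewrite !mulr_ge0// ltW.
have B0 : 0 <= N%:R ^+ 2 * trace D + tau by rewrite addr_ge0// mulr_ge0// exprn_ge0.
apply: rV_norm_le => [|i].
  by rewrite mulr_ge0 ?(ltW h0)// mulr_ge0.
pose sg : R := if 0 <= (p' - p) ord0 i then 1 else -1.
have sgE : sg * (p' - p) ord0 i = `|(p' - p) ord0 i|.
  rewrite /sg; case: ifPn => [/ger0_norm ->|]; first by rewrite mul1r.
  by rewrite -ltNge => /ltr0_norm ->; rewrite mulN1r.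
(* From [x'], move by [h] in the coordinate direction where [p' - p] has the
   sign [sg]; the contact at [x'] controls [x + v], and the contact at [x]
   controls [x - v]. *)
pose v := (x' - x) + (h * sg) *: unitv R i.
have v2h : `|v| <= 2 * h.
  apply: le_trans (ler_normD _ _) _; have := norm_unitv_le (h * sg) i.
  have -> : `|h * sg| = h.
    by rewrite normrM (gtr0_norm h0) /sg; case: ifP; rewrite ?normrN normr1 mulr1.
  by move: xh; lra.
have vs : `|v| <= s by apply: le_trans v2h hs.
have xv : x + v - x' = (h * sg) *: unitv R i.
  by rewrite /v addrA [x + (x' - x)]addrC subrK [x' + _]addrC addrK.
have h1 := cx' (x + v) (in_ball xs vs).
have vs' : `|- v| <= s by rewrite normrN.
have h2 := cx (x - v) (in_ball xs vs').
have h3 := cx x' (ltW (lt_trans xs' (_ : s < 2 * s))).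
have {h3} h3 : P x + dotv p (x' - x) <= P x' by apply: h3; move: s0; lra.
have /ler_normlP[_ h4] := PD vs.
have h5 : contract (fun i j => v ord0 i * v ord0 j) D <=
    (2 * h) ^+ 2 * N%:R ^+ 2 * trace D.
  by apply: (psd_quad_le pD) => j; apply: le_trans (coord_norm_le _ _) v2h.
have h6 : C * `|v| ^+ 3 <= (2 * h) ^+ 2 * tau.
  apply: (@le_trans _ _ (C * (2 * h) ^+ 3)).
    by rewrite ler_wpM2l// lerXn2r ?nnegrE// mulr_ge0// ltW.
  rewrite (_ : C * _ = (2 * h) ^+ 2 * (2 * C * h)); last by ring.
  by rewrite ler_wpM2l// sqr_ge0.
rewrite -(ler_pM2l h0) -sgE.
move: h1 h2; rewrite xv [x - v - x]addrC addKr dotvN => h1 h2.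
have h7 : dotv (p' - p) ((h * sg) *: unitv R i) = h * (sg * (p' - p) ord0 i).
  by rewrite dotv_unitv mulrA.
have h8 : dotv p v = dotv p (x' - x) + dotv p ((h * sg) *: unitv R i).
  exact: dotvD.
rewrite -h7 dotvBl; move: h1 h2 h3 h4 h5 h6 h8; clear; lra.
Qed.

End second_order.

End contact.

(** * A strong minimum principle for weak second derivatives *)

(** Bookkeeping of errors: the differential inequality for the derivatives
[gam1] and [gam] at a point is transferred to a Hessian [D] close to [gam],
shifted by the Hessians [2 q] and [2 th] of the two paraboloids. *)
Lemma hessian_trace_le (R : realType) n (A G D gam : 'I_n -> 'I_n -> R)
    (bz gam1 : 'I_n -> R) (q th Abar beta delta e1 e2 : R) :
  (forall i j, `|A i j| <= Abar) -> (forall i, `|bz i| <= beta) ->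
  (forall i j, D i j = G i j + (2 * q + 2 * th) * (i == j)%:R) ->
  (forall i j, `|G i j - gam i j| <= e2) -> (forall i, `|gam1 i| <= e1) ->
  0 <= th -> 0 <= Abar ->
  contract A (fun i j => gam i j + 2 * q * (i == j)%:R)
    + \sum_(i < n) bz i * gam1 i <= - delta ->
  contract A D <= - delta + n%:R * (beta * e1) + n%:R ^+ 2 * (Abar * e2)
                  + n%:R * (Abar * (2 * th)).
Proof.
move=> AA bb DE Ge ge th0 A0 pde.
have -> : contract A D = (contract A (fun i j => gam i j + 2 * q * (i == j)%:R)
    + \sum_(i < n) bz i * gam1 i) - \sum_(i < n) bz i * gam1 i
    + contract A (fun i j => G i j - gam i j)
    + \sum_(i < n) A i i * (2 * th).
  rewrite addrK /contract -!big_split/=; apply: eq_bigr => i _.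
  have -> : A i i * (2 * th) = \sum_(j < n) A i j * (2 * th) * (i == j)%:R.
    rewrite (bigD1 i)//= eqxx mulr1 big1 ?addr0// => j /negPf.
    by rewrite eq_sym => ->; rewrite mulr0.
  by rewrite -!big_split/=; apply: eq_bigr => j _; rewrite DE; ring.
apply: lerD; [apply: lerD; [apply: lerD => //|]|].
- rewrite -sumrN; apply: (@le_trans _ _ (\sum_(i < n) beta * e1)); last first.
    by rewrite sumr_const card_ord mulr_natl.
  apply: ler_sum => i _; apply: le_trans (ler_norm _) _.
  by rewrite normrN normrM ler_pM.
- apply: (@le_trans _ _ (\sum_(i < n) \sum_(j < n) Abar * e2)); last first.
    by rewrite !sumr_const card_ord -mulrnA -[leLHS]mulr_natl natrM expr2.
  apply: ler_sum => i _; apply: ler_sum => j _; apply: le_trans (ler_norm _) _.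
  by rewrite normrM ler_pM.
- apply: (@le_trans _ _ (\sum_(i < n) Abar * (2 * th))); last first.
    by rewrite sumr_const card_ord -[leLHS]mulr_natl.
  apply: ler_sum => i _; rewrite ler_wpM2r ?mulr_ge0//.
  exact: le_trans (ler_norm _) _.
Qed.

Section mollified_bounds.
Variables (R : realType) (N : nat).
Local Notation V := 'rV[R]_N.
Local Notation leb := (@lebesgue_rV R N).
Implicit Types (x y z v : V) (w g rho : V -> R).
Local Notation integrable f := (leb.-integrable setT (EFin \o f)).

Lemma Rintegral_ae_ge0 f : {ae leb, forall y : V, 0 <= f y} ->
  0 <= \int[leb]_y f y.
Proof.
move=> f0; rewrite (_ : \int[leb]_y f y = \int[leb]_y `|f y|).
  exact: Rintegral_ge0.
congr fine; apply: eq_integral_ae_nonmeasurable.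
by apply: filterS f0 => y fy; rewrite ger0_norm.
Qed.

Lemma mollifier_shift_integral k rho x : mollifier k rho ->
  \int[leb]_y rho (y - x) = 1 /\ integrable (fun y => rho (y - x)).
Proof.
move=> mr; have ri := mollifier_integrable mr; have [_ _ _ r1] := mr; split.
  by rewrite -r1 -(@Rintegral_shift R N (- x) rho).
exact: (integrable_shift (- x) ri).
Qed.

(** Mollification with a probability density preserves bounds that hold almost
everywhere on the ball where the density lives. *)
Lemma mollify_ge w rho k x c : integrable w -> mollifier k rho ->
  {ae leb, forall y : V, `|y - x| <= k -> c <= w y} -> c <= mollify w rho x.
Proof.
move=> wi mr cw; have [r1 ri] := mollifier_shift_integral x mr.
have [br r0 rk _] := mr.
have : 0 <= \int[leb]_y (w y * rho (y - x) - c * rho (y - x)).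
  apply: Rintegral_ae_ge0; apply: filterS cw => y cwy.
  rewrite -mulrBl; have [->|ry] := eqVneq (rho (y - x)) 0; first by rewrite mulr0.
  by rewrite mulr_ge0// subr_ge0 cwy// rk.
rewrite RintegralB//; last 2 first.
- by apply: integrable_mul_bump => //; exact: bump_shift.
- exact: integrableZ.
by rewrite RintegralZl// r1 mulr1 subr_ge0.
Qed.

Lemma mollify_le w rho k x c : integrable w -> mollifier k rho ->
  {ae leb, forall y : V, `|y - x| <= k -> w y <= c} -> mollify w rho x <= c.
Proof.
move=> wi mr wc; have [br _ _ _] := mr.
have : - c <= mollify (fun y => -1 * w y) rho x.
  apply: (mollify_ge (k := k)) => //; first exact: integrableZ.
  by apply: filterS wc => y wy /wy; rewrite mulN1r lerN2.
rewrite /mollify; under eq_Rintegral do rewrite -mulrA.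
rewrite RintegralZl ?mulN1r ?lerN2//.
by apply: integrable_mul_bump => //; exact: bump_shift.
Qed.

Lemma dotvC (x y : V) : dotv x y = dotv y x.
Proof. by apply: eq_bigr => i _; rewrite mulrC. Qed.

Lemma dotvv_diff_le x y (r : R) : `|x| <= r -> `|y| <= r ->
  `|dotv x x - dotv y y| <= N%:R * (2 * r) * `|x - y|.
Proof.
move=> xr yr.
have -> : dotv x x - dotv y y = dotv (x - y) (x + y).
  rewrite dotvBl !dotvD [dotv y x]dotvC; ring.
apply: le_trans (dotv_norm_le _ _) _; rewrite -mulrA ler_wpM2l//.
rewrite mulrC ler_wpM2r//; apply: le_trans (ler_normD _ _) _; lra.
Qed.

Lemma dotvv_ge_norm x : (0 < N)%N -> `|x| ^+ 2 <= dotv x x.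
Proof.
move=> N0; have d0 : 0 <= dotv x x by rewrite sumr_ge0// => i _; rewrite -expr2 sqr_ge0.
have : `|x| <= Num.sqrt (dotv x x).
  apply: rV_norm_le => [|i]; first exact: sqrtr_ge0.
  rewrite -sqrtr_sqr ler_sqrt//.
  rewrite /dotv (bigD1 i)//= -expr2 lerDl sumr_ge0// => j _.
  by rewrite -expr2 sqr_ge0.
by move=> h; rewrite -(sqr_sqrtr d0) lerXn2r ?nnegrE// sqrtr_ge0.
Qed.

Lemma dotvv_le_norm x : dotv x x <= N%:R * `|x| ^+ 2.
Proof. by apply: le_trans (ler_norm _) _; rewrite expr2; exact: dotv_norm_le. Qed.

Lemma dotvv_ge0 x : 0 <= dotv x x.
Proof. by rewrite sumr_ge0// => i _; rewrite -expr2 sqr_ge0. Qed.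

Lemma continuous_dotvv x0 : continuous (fun x : V => dotv (x - x0) (x - x0)).
Proof.
have ci i : continuous (fun x : V => (x - x0) ord0 i).
  apply: (@lipschitz_continuousR _ _ _ 1) => // x y.
  rewrite !mxE mul1r opprB addrA subrK.
  by apply: le_trans (coord_norm_le (x - y) i); rewrite !mxE.
by apply: continuous_sumr => i; exact: continuous_mulr.
Qed.

Lemma measurable_mollification_error (K : finType) (G : K -> V -> R) rho :
  (forall k, integrable (G k)) -> bump_alg rho ->
  measurable_fun setT (fun z => \sum_(k : K) `|mollify (G k) rho z - G k z|).
Proof.
move=> Gi br; rewrite (_ : (fun z => _) =
    \sum_(k : K) (fun z => `|mollify (G k) rho z - G k z|)); last first.
  by apply/funext => z; rewrite fct_sumE.
apply: (big_ind (fun f : V -> R => measurable_fun setT f)) => [|f g mf mg|k _].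
- exact: measurable_cst.
- exact: measurable_funD.
apply: measurableT_comp => //; apply: measurable_funB; first exact: mollify_measurable.
exact: integrable_meas.
Qed.

Definition vanish_outside (M : R) g := forall x, g x != 0 -> cube M x.

(** Mollifications converge to [g] in [L^1]. *)
Lemma ae_eq0_of_mollify_eq0 g (M k0 : R) (B : set V) : integrable g ->
  vanish_outside M g -> measurable B -> 0 < k0 ->
  (forall k rho x, k <= k0 -> mollifier k rho -> B x -> mollify g rho x = 0) ->
  {ae leb, forall x, B x -> g x = 0}.
Proof.
move=> gi gM mB k00 g0; have mg := integrable_meas gi.
have mEg : measurable_fun B (EFin \o g).
  by apply: measurable_funTS; exact/measurable_EFinP.
suff /(ae_eq_integral_abs _ mB mEg) : (\int[leb]_(x in B) `|(EFin \o g) x| = 0)%E.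
  by apply: filterS => x H Bx; have /= [] := H Bx.
apply/eqP; rewrite eq_le integral_ge0// andbT; apply/lee_addgt0Pr => e e0.
rewrite add0e.
have goo : (\int[leb]_x (`|g x| ^+ 1)%:E < +oo)%E by have /integrableP[_] := gi.
have [k1 k10 H] := @Lp_err_mollify R N g M 0 e gi gM goo e0.
have kk : 0 < Num.min k0 k1 by rewrite lt_min k00.
have [rho mr] := exists_mollifier N kk.
have [br _ _ _] := mr.
have k01 : Num.min k0 k1 <= k1 by rewrite ge_min lexx orbT.
apply: le_trans (H _ _ k01 mr).
apply: (@le_trans _ _ (\int[leb]_(x in B) (`|mollify g rho x - g x| ^+ 1)%:E)%E).
  rewrite le_eqVlt; apply/orP; left; apply/eqP; apply: eq_integral => x.
  rewrite inE => Bx; rewrite (g0 _ _ _ _ mr Bx) ?ge_min ?lexx//.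
  by rewrite sub0r normrN expr1.
apply: ge0_subset_integral => //.
by apply: measurable_Lp_err => //; exact: mollify_measurable.
Qed.

End mollified_bounds.

Section no_touching.
Variables (R : realType) (n : nat).
Local Notation N := n.+1.
Local Notation V := 'rV[R]_N.
Local Notation leb := (@lebesgue_rV R N).
Implicit Types (x y z v p : V).
Local Notation integrable f := (leb.-integrable setT (EFin \o f)).

(* [w + Qf] is nonnegative near [x0] and vanishes there, in an almost everywhere
   sense; [g1] and [g2] are the weak derivatives of [w]. The paraboloid [Qf] is kept
   apart because its derivatives are explicit and need no mollification. The
   coefficients [a] are close to the constant coercive matrix [A0]. *)
Variables (w : V -> R) (g1 : 'I_N -> V -> R) (g2 : 'I_N -> 'I_N -> V -> R).
Variables (a : V -> 'I_N -> 'I_N -> R) (b : V -> 'I_N -> R).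
Variables (A0 : 'I_N -> 'I_N -> R) (x0 : V) (M r q k0 m delta beta : R).
Hypotheses (r0 : 0 < r) (delta0 : 0 < delta) (m0 : 0 < m) (beta0 : 0 <= beta).
Hypotheses (wi : integrable w) (g1i : forall i, integrable (g1 i))
  (g2i : forall i j, integrable (g2 i j)).
Hypotheses (g1M : forall i, vanish_outside M (g1 i))
  (g2M : forall i j, vanish_outside M (g2 i j)).
Hypotheses (g1N : forall i, (\int[leb]_x (`|g1 i x| ^+ N)%:E < +oo)%E)
  (g2N : forall i j, (\int[leb]_x (`|g2 i j x| ^+ N)%:E < +oo)%E).
Let supported_in_ball (rho : V -> R) := forall y, rho y != 0 -> `|y - x0| <= r.
Hypothesis weak1 : forall rho i, bump_alg rho -> supported_in_ball rho ->
  \int[leb]_y (w y * partial [:: i] rho y) = - \int[leb]_y (g1 i y * rho y).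
Hypothesis weak2 : forall rho i j, bump_alg rho -> supported_in_ball rho ->
  \int[leb]_y (w y * partial [:: i; j] rho y) = \int[leb]_y (g2 i j y * rho y).
Let Qf x := q * dotv x x + k0.
Hypothesis w_ge : {ae leb, forall x, `|x - x0| <= r -> 0 <= w x + Qf x}.
Hypothesis w_touch : forall e, 0 < e -> exists2 s, 0 < s &
  {ae leb, forall x, `|x - x0| <= s -> w x + Qf x <= e}.
Hypothesis a_sym : forall x, `|x - x0| <= r -> forall i j, a x i j = a x j i.
Hypothesis A0_sym : forall i j, A0 i j = A0 j i.
Hypothesis A0_coercive : forall y : 'I_N -> R,
  m * \sum_(i < N) y i ^+ 2 <= contract A0 (fun i j => y i * y j).
Hypothesis a_near : forall x, `|x - x0| <= r -> forall i j,
  `|a x i j - A0 i j| <= m / (4 * N%:R ^+ 2).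
Hypothesis pde : {ae leb, forall x, `|x - x0| <= r ->
  (forall i, `|b x i| <= beta) /\
  contract (a x) (fun i j => g2 i j x + 2 * q * (i == j)%:R)
    + \sum_(i < N) b x i * (g1 i x + 2 * q * x ord0 i) <= - delta}.

Let s := r / 4.
Let s0 : 0 < s. Proof. by rewrite divr_gt0. Qed.

Let N0 : 0 < N%:R :> R. Proof. by []. Qed.

Let Abar := \sum_(i < N) \sum_(j < N) `|A0 i j| + m.

Let Abar0 : 0 < Abar.
Proof. by rewrite ltr_wpDl// sumr_ge0// => i _; rewrite sumr_ge0. Qed.

Let a_le x : `|x - x0| <= r -> forall i j, `|a x i j| <= Abar.
Proof.
move=> xr i j; rewrite -[a x i j](subrK (A0 i j)) addrC.
apply: le_trans (ler_normD _ _) _; apply: lerD.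
  rewrite (bigD1 i)//= (bigD1 j)//= -addrA lerDl addr_ge0 ?sumr_ge0// => k _.
  by rewrite sumr_ge0.
apply: le_trans (a_near xr i j) _; rewrite ler_pdivrMr ?mulr_gt0 ?exprn_gt0//.
rewrite ler_peMr// ?(ltW m0)//.
have : 1 <= N%:R :> R by rewrite ler1n.
by move=> N1; have : 1 * 1 <= N%:R * N%:R :> R by [rewrite ler_pM]; rewrite -expr2; lra.
Qed.

Let a_trace x D : `|x - x0| <= r -> psd D -> m / 4 * trace D <= contract (a x) D.
Proof.
move=> xr pD.
have h1 := contract_ge_trace A0_sym m0 A0_coercive pD.
have := contract_perturb pD (a_sym xr) A0_sym (a_near xr).
rewrite (_ : m / (4 * N%:R ^+ 2) * N%:R ^+ 2 = m / 4); first by lra.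
by field; rewrite gt_eqF.
Qed.

(* A single small parameter [th] serves as the coefficient of the paraboloid that
   makes the minimum strict, and as the tolerance in all the error estimates; [Lam]
   collects their constants, so that together they use up half of [delta]. *)
Let Lam := N%:R * (beta * (4 + 2 * s)) + N%:R ^+ 2 * Abar + N%:R * (Abar * 2) + m.
Let th := delta / (2 * Lam).

Let Lam_ge_m : m <= Lam.
Proof.
have h1 := ltW Abar0; have h2 : 0 <= 4 + 2 * s by move: s0; lra.
rewrite lerDr; apply: addr_ge0; [apply: addr_ge0|]; apply: mulr_ge0 => //.
- exact: mulr_ge0.
- exact: mulr_ge0.
Qed.

Let Lam0 : 0 < Lam.
Proof. exact: lt_le_trans m0 Lam_ge_m. Qed.

Let th0 : 0 < th.
Proof. by rewrite divr_gt0// mulr_gt0. Qed.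

Let eta := Num.min th (th * s / (16 * N%:R)).

Let eta0 : 0 < eta.
Proof. by rewrite lt_min th0/=; apply: divr_gt0; exact: mulr_gt0. Qed.

(* First and second derivatives are mollified in the same way, hence one family. *)
Let K : finType := ('I_N + 'I_N * 'I_N)%type.
Let G (k : K) := match k with inl i => g1 i | inr ij => g2 ij.1 ij.2 end.

Let Gi k : integrable (G k). Proof. by case: k => [i|[i j]]; [exact: g1i|exact: g2i]. Qed.

Let C0 := 4 * (N%:R * beta + N%:R ^+ 2 * Abar) / m.

Let C00 : 0 <= C0.
Proof.
apply: divr_ge0 (ltW m0); apply: mulr_ge0 => //; have h := ltW Abar0.
by apply: addr_ge0; apply: mulr_ge0.
Qed.

Let C1 := 8 * N%:R ^+ 2 * C0.

Section fixed_mollifier.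
Variables (rho : V -> R) (kap : R).
Hypotheses (mrho : mollifier kap rho) (kaps : kap <= 2 * s).

Let brho : bump_alg rho. Proof. by have [] := mrho. Qed.

Let shift_supported x : `|x - x0| <= 2 * s -> supported_in_ball (fun y => rho (y - x)).
Proof.
have [_ _ rk _] := mrho; move=> xs y /rk yx.
rewrite -[y](subrK x) -addrA; apply: le_trans (ler_normD _ _) _.
have -> : r = 2 * s + 2 * s by rewrite /s; field.
by rewrite lerD//; apply: le_trans yx kaps.
Qed.

Let mollify_weak1 x i : `|x - x0| <= 2 * s ->
  mollify w (partial [:: i] rho) x = - mollify (g1 i) rho x.
Proof.
move=> xs; rewrite /mollify -(weak1 i (bump_shift x brho) (shift_supported xs)).
by apply: eq_Rintegral => y _; rewrite partial_shift.
Qed.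

Let mollify_weak2 x i j : `|x - x0| <= 2 * s ->
  mollify w (partial [:: i; j] rho) x = mollify (g2 i j) rho x.
Proof.
move=> xs; rewrite /mollify -(weak2 i j (bump_shift x brho) (shift_supported xs)).
by apply: eq_Rintegral => y _; rewrite partial_shift.
Qed.

Let P x := mollify w rho x + Qf x + th * dotv (x - x0) (x - x0).
Let D x i j := mollify (g2 i j) rho x + (2 * q + 2 * th) * (i == j)%:R.

Let in2s x : `|x - x0| < s -> `|x - x0| <= 2 * s.
Proof. by move: s0 => + h; lra. Qed.

Let P_taylor1 : exists2 C, 0 < C & forall x v, `|x - x0| < s ->
  `|P (x + v) - P x - \sum_(i < N) v ord0 i *
     (mollify (g1 i) rho x + 2 * q * x ord0 i + 2 * th * (x - x0) ord0 i)|
  <= C * `|v| ^+ 2.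
Proof.
have [C C0' HC] := mollify_taylor1 wi brho.
exists (C + (`|q| + th) * N%:R).
  by rewrite ltr_pwDl// mulr_ge0// addr_ge0// ltW.
move=> x v xs; have := HC x v.
under eq_bigr => i _ do rewrite (mollify_weak1 i (in2s xs)).
set X := `|_|; move=> hX.
have -> : P (x + v) - P x - \sum_(i < N) v ord0 i *
     (mollify (g1 i) rho x + 2 * q * x ord0 i + 2 * th * (x - x0) ord0 i) =
   (mollify w rho (x + v) - mollify w rho x + \sum_(i < N) v ord0 i * - mollify (g1 i) rho x)
   + (q + th) * dotv v v.
  have -> : \sum_(i < N) v ord0 i *
     (mollify (g1 i) rho x + 2 * q * x ord0 i + 2 * th * (x - x0) ord0 i) =
     - (\sum_(i < N) v ord0 i * - mollify (g1 i) rho x) + 2 * q * dotv v x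
     + 2 * th * dotv v (x - x0).
    rewrite /dotv -sumrN !mulr_sumr -!big_split/=; apply: eq_bigr => i _; ring.
  rewrite /P /Qf (_ : x + v - x0 = (x - x0) + v); last by rewrite addrAC.
  have E u : dotv (u + v) (u + v) = dotv u u + 2 * dotv v u + dotv v v.
    by rewrite dotvD ![dotv (u + v) _]dotvC !dotvD [dotv u v]dotvC; ring.
  by rewrite !E; ring.
apply: le_trans (ler_normD _ _) _; rewrite [leRHS]mulrDl; apply: lerD => //.
rewrite normrM -mulrA; apply: ler_pM => //; first by apply: le_trans (ler_normD _ _) _; rewrite (gtr0_norm th0).
by rewrite ger0_norm ?dotvv_ge0//; exact: dotvv_le_norm.
Qed.

Let P_taylor2 : exists2 C, 0 < C & forall x v, `|x - x0| < s ->
  `|P (x + v) + P (x - v) - 2 * P x -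
     contract (fun i j => v ord0 i * v ord0 j) (D x)| <= C * `|v| ^+ 3.
Proof.
have [C C0' HC] := mollify_taylor2 wi brho; exists C => // x v xs.
have := HC x v; congr (_ <= _); congr (`|_|).
have -> : contract (fun i j => v ord0 i * v ord0 j) (D x) =
  contract (fun i j => v ord0 i * v ord0 j)
    (fun i j => mollify w (partial [:: i; j] rho) x) + (2 * q + 2 * th) * dotv v v.
  rewrite /contract /dotv mulr_sumr -big_split/=; apply: eq_bigr => i _.
  have -> : (2 * q + 2 * th) * (v ord0 i * v ord0 i) =
     \sum_(j < N) (2 * q + 2 * th) * (v ord0 i * v ord0 j) * (i == j)%:R.
    rewrite (bigD1 i)//= eqxx mulr1 big1 ?addr0// => j /negPf.
    by rewrite eq_sym => ->; rewrite mulr0.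
  rewrite -big_split/=; apply: eq_bigr => j _.
  by rewrite (mollify_weak2 i j (in2s xs)) /D; ring.
rewrite /P /Qf (_ : x + v - x0 = (x - x0) + v); last by rewrite addrAC.
rewrite (_ : x - v - x0 = (x - x0) - v); last by rewrite addrAC.
have E u t : dotv (u + t) (u + t) = dotv u u + 2 * dotv t u + dotv t t.
  by rewrite dotvD ![dotv (u + t) _]dotvC !dotvD [dotv u t]dotvC; ring.
have EN t u : dotv (- t) u = - dotv t u by rewrite dotvC dotvN dotvC.
by rewrite !E !EN !dotvN; ring.
Qed.

Let E z := \sum_(k : K) `|mollify (G k) rho z - G k z|.

Let E_ge k z : `|mollify (G k) rho z - G k z| <= E z.
Proof. by rewrite /E (bigD1 k)//= lerDl sumr_ge0. Qed.

Let CE0 z : 0 <= C1 * E z.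
Proof. by apply: mulr_ge0; [exact: mulr_ge0|exact: sumr_ge0]. Qed.

Let H z := (((C1 * E z) ^+ N)%:E : \bar R).

Let mH : measurable_fun setT H.
Proof.
apply/measurable_EFinP; apply: measurable_funX; apply: measurable_funM => //.
exact: measurable_mollification_error.
Qed.

(* The differential inequality holds almost everywhere, whereas [x] is a single
   point; it is therefore used at almost every point [z] close to [x], where the
   mollified derivatives are almost the same as at [x]. *)
Let trace_le p x (h : R) : contact P x0 s p x -> `|p| <= eta ->
  0 < h -> h <= s -> (forall k z, `|z - x| <= h -> `|mollify (G k) rho x - mollify (G k) rho z| <= th) ->
  2 * `|q| * h <= th ->
  {ae leb, forall z, `|z - x| <= h -> trace (D x) + th <= C0 * E z}.
Proof.
move=> cpx peta h0 hs Gh qh; have [xs _] := cpx.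
have [Ct Ct0 T1] := P_taylor1; have [C2 C20 T2] := P_taylor2.
have pD : psd (D x).
  apply: (@contact_psd R N P x0 s C2 x (D x) s0 (ltW C20) _ p cpx) => v _.
  exact: T2.
have pg i : p ord0 i = mollify (g1 i) rho x + 2 * q * x ord0 i + 2 * th * (x - x0) ord0 i.
  apply: (@contact_gradient R N P x0 s Ct p x
    (fun i => mollify (g1 i) rho x + 2 * q * x ord0 i + 2 * th * (x - x0) ord0 i) s0) => //.
  by move=> v _; exact: T1.
apply: filterS pde => z pz zx.
have zr : `|z - x0| <= r.
  rewrite -[z](subrK x) -addrA; apply: le_trans (ler_normD _ _) _.
  have : r = 4 * s by rewrite /s; field.
  move: zx xs hs s0; lra.
have [bz pz'] := pz zr.
have tr := a_trace zr pD.
have e2P i j : `|mollify (g2 i j) rho x - g2 i j z| <= th + E z.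
  rewrite -[_ - g2 i j z](subrKA (mollify (g2 i j) rho z)).
  apply: le_trans (ler_normD _ _) _; apply: lerD; first exact: (Gh (inr (i, j))).
  exact: (E_ge (inr (i, j))).
have e1P i : `|g1 i z + 2 * q * z ord0 i| <= E z + th * (3 + 2 * s).
  have -> : g1 i z + 2 * q * z ord0 i = - (mollify (g1 i) rho z - g1 i z)
    + - (mollify (g1 i) rho x - mollify (g1 i) rho z) + p ord0 i - 2 * th * (x - x0) ord0 i
    + 2 * q * (z - x) ord0 i by rewrite pg !mxE; ring.
  have n1 := E_ge (inl i) z; have n2 := Gh (inl i) z zx.
  (* The gradient of [P] at a contact point is the slope, which is small. *)
  have n3 : `|p ord0 i| <= th.
    apply: le_trans (coord_norm_le _ _) (le_trans peta _).
    by rewrite ge_min lexx.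
  have n4 : `|2 * th * (x - x0) ord0 i| <= 2 * th * s.
    have th2 : 0 <= 2 * th by rewrite mulr_ge0// ltW.
    rewrite normrM (ger0_norm th2); apply: ler_wpM2l => //.
    by apply: le_trans (coord_norm_le _ _) (ltW xs).
  have n5 : `|2 * q * (z - x) ord0 i| <= th.
    apply: le_trans qh; rewrite !normrM (ger0_norm (ler0n _ 2)).
    apply: ler_wpM2l; first exact: mulr_ge0.
    by apply: le_trans (coord_norm_le _ _) zx.
  apply: le_trans (ler_normD _ _) _.
  rewrite (_ : E z + _ = E z + th + th + 2 * th * s + th); last by ring.
  apply: lerD => //; apply: le_trans (ler_normB _ _) _; apply: lerD => //.
  apply: le_trans (ler_normD _ _) _; apply: lerD => //.
  by apply: le_trans (ler_normD _ _) _; rewrite !normrN; apply: lerD.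
have DE i j : D x i j = mollify (g2 i j) rho x + (2 * q + 2 * th) * (i == j)%:R by [].
have := @hessian_trace_le R N (a z) _ (D x) (fun i j => g2 i j z) (b z) _ q th
  _ _ _ _ _ (a_le zr) bz DE e2P e1P
  (ltW th0) (ltW Abar0) pz'.
move=> /(le_trans tr) tr'.
have dth : delta = th * (2 * Lam) by rewrite /th divfK// gt_eqF// mulr_gt0.
rewrite /C0 mulrAC ler_pdivlMr//.
have tw := ltW th0; have aw := ltW Abar0; have sw := ltW s0; have mw := ltW m0.
have pos1 : 0 <= th * (N%:R * beta) by do ![apply: mulr_ge0 => //].
have pos2 : 0 <= th * m by apply: mulr_ge0.
have pos3 : 0 <= th * (N%:R * (beta * s)) by do ![apply: mulr_ge0 => //].
have pos4 : 0 <= th * (N%:R ^+ 2 * Abar) by do ![apply: mulr_ge0 => //].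
have pos5 : 0 <= th * (N%:R * Abar) by do ![apply: mulr_ge0 => //].
move: tr'; rewrite dth /Lam => tr'.
move: tr' pos1 pos2 pos3 pos4 pos5; lra.
Qed.

Let P_continuous : continuous P.
Proof.
have cq : continuous (fun x : V => dotv x x).
  by have := @continuous_dotvv R N 0; under eq_fun do rewrite subr0.
move=> x; apply: (@continuousD R R V (fun x => mollify w rho x + Qf x)).
  apply: (@continuousD R R V (fun x => mollify w rho x)); first exact: mollify_continuous.
  apply: (@continuousD R R V (fun x => q * dotv x x)); last exact: cst_continuous.
  by apply: continuous_mulr; [exact: cst_continuous|exact: cq].
by apply: continuous_mulr; [exact: cst_continuous|exact: continuous_dotvv].
Qed.

(* [P] has a gap between its values at [x0] and on the outer shell, so every small
   slope has a contact point, and the slopes fill a cube of side [2 * eta]. *)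
Let slopes_le_error (mu0 mu1 : R) : P x0 <= mu0 ->
  (forall x, s <= `|x - x0| <= 2 * s -> mu1 <= P x) ->
  N%:R * (eta * (2 * s)) < mu1 - mu0 ->
  (((2 * eta) ^+ N)%:E <= \int[leb]_z H z)%E.
Proof.
move=> P0 P1 gap; have [C2 C20 T2] := P_taylor2.
have [L L0 GL] : exists2 L, 0 < L & forall k x y,
    `|mollify (G k) rho x - mollify (G k) rho y| <= L * `|x - y|.
  have /(_ _)/cid2-/all_sig2[L L0 HL] := fun k => mollify_lipschitz (Gi k) brho.
  exists (1 + \sum_k L k); first by rewrite ltr_pwDl// sumr_ge0// => k _; exact/ltW.
  move=> k x y; apply: le_trans (HL k x y) _; rewrite ler_wpM2r//.
  rewrite (bigD1 k)//= addrCA lerDl.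
  by rewrite addr_ge0// sumr_ge0// => j _; exact/ltW.
(* The mesh is chosen after the mollifier: the Lipschitz constants [C2] and [L]
   degenerate with it, but only the final, mesh-free inequality is used later. *)
pose h0 := Num.min (s / 2) (Num.min (th / (2 * C2))
  (Num.min (th / L) (th / (2 * `|q| + 1)))).
have q1 : 0 < 2 * `|q| + 1 by rewrite ltr_wpDl// mulr_ge0.
have h00 : 0 < h0.
  rewrite !lt_min; apply/and4P; split; apply: divr_gt0 => //; exact: mulr_gt0.
pose nn := (Num.bound (2 * s / h0)).+1.
pose h := 2 * s / nn%:R.
have hp : 0 < h by apply: divr_gt0 => //; exact: mulr_gt0.
have hh0 : h <= h0.
  rewrite /h ler_pdivrMr ?ltr0n// [h0 * _]mulrC -ler_pdivrMr//; apply/ltW.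
  have sh : 0 <= 2 * s / h0 by rewrite divr_ge0 ?(ltW h00)// mulr_ge0// ltW.
  by apply: lt_trans (archi_boundP sh) _; rewrite ltr_nat.
move: hh0; rewrite !le_min => /and4P[hs hC2 hL hq].
have C22 : 0 < 2 * C2 by exact: mulr_gt0.
have {}hC2 : h * (2 * C2) <= th by rewrite -ler_pdivlMr.
have {}hL : h * L <= th by rewrite -ler_pdivlMr.
have {}hq : h * (2 * `|q| + 1) <= th by rewrite -ler_pdivlMr.
apply: (@grid_cover R N (fun p x => `|p| <= eta /\ contact P x0 s p x) x0 s eta nn H)
  => //.
- exact: ltW.
- by move=> x; rewrite lee_fin; exact: exprn_ge0.
- move=> p peta; have [x cx] := exists_contact s0 P_continuous P0 P1 gap peta.
  by exists x => //; have [] := cx.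
move=> c p x [peta cpx] cellx; rewrite -/h in cellx *; have [xs _] := cpx.
have T2x v : `|v| <= s -> `|P (x + v) + P (x - v) - 2 * P x -
     contract (fun i j => v ord0 i * v ord0 j) (D x)| <= C2 * `|v| ^+ 3.
  by move=> _; exact: T2.
have pD : psd (D x) := contact_psd s0 (ltW C20) T2x cpx.
have K0 := psd_trace_ge0 pD.
have near z : cell h c z -> `|z - x| <= h.
  move=> cellz; apply: rV_norm_le => [|i]; first exact: ltW.
  have := cellz i; have := cellx i; rewrite /= !in_itv/= !mxE ler_norml.
  by move=> /andP[h1 h2] /andP[h3 h4]; apply/andP; split; lra.
have B0 : 0 <= N%:R ^+ 2 * trace (D x) + th.
  by apply: addr_ge0 (ltW th0); apply: mulr_ge0.
exists (4 * (N%:R ^+ 2 * trace (D x) + th) * h); split.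
- by apply: mulr_ge0 (ltW hp); apply: mulr_ge0.
- move=> p' x' [_ cpx'] cellx'.
  apply: (contact_slope_le s0 (ltW C20) T2x cpx cpx' (near _ cellx') hp).
    by move: hs; lra.
  by move: hC2; lra.
rewrite (_ : (2 * _) ^+ N = (8 * (N%:R ^+ 2 * trace (D x) + th)) ^+ N * h ^+ N);
  last by rewrite -exprMn; congr (_ ^+ _); ring.
rewrite EFinM -(@lebesgue_cell R N h c (ltW hp)).
rewrite -integral_cst; last exact: measurable_cell.
have mc := measurable_cell h c.
apply: ae_ge0_le_integral => //.
- by move=> z _; rewrite lee_fin exprn_ge0// mulr_ge0.
- by move=> z _; rewrite lee_fin; exact: exprn_ge0.
- exact: measurable_funTS.
have Gh k z : `|z - x| <= h -> `|mollify (G k) rho x - mollify (G k) rho z| <= th.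
  move=> zx; apply: le_trans (GL _ _ _) _; rewrite distrC.
  by apply: le_trans hL; rewrite mulrC ler_wpM2r// ltW.
have hs' : h <= s by move: hs hp; lra.
have hq' : 2 * `|q| * h <= th by move: hq hp; lra.
have := trace_le cpx peta hp hs' Gh hq'.
apply: filterS => z Hz cz; rewrite lee_fin.
have E0 : 0 <= E z by rewrite /E sumr_ge0.
apply: lerXn2r; rewrite ?nnegrE//; first exact: mulr_ge0.
have {Hz} Hz := Hz (near _ cz).
rewrite /C1 -mulrA -[X in _ <= X]mulrA ler_wpM2l//.
apply: (@le_trans _ _ (N%:R ^+ 2 * (trace (D x) + th))).
  rewrite mulrDr lerD2l ler_peMl ?(ltW th0)//.
  by rewrite exprn_ege1// ler1n.
by rewrite ler_wpM2l.
Qed.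

Hypothesis sig_small : `|q| * (N%:R * (2 * (`|x0| + r)) * kap) <= th * s ^+ 2 / 8.
Hypothesis touch_kap : {ae leb, forall x, `|x - x0| <= kap ->
  w x + Qf x <= th * s ^+ 2 / 8}.

Let Qf_near x y : `|x - x0| <= r -> `|y - x0| <= r -> `|y - x| <= kap ->
  `|Qf y - Qf x| <= th * s ^+ 2 / 8.
Proof.
move=> xr yr yx; apply: le_trans sig_small.
have nb u : `|u - x0| <= r -> `|u| <= `|x0| + r.
  move=> ur; rewrite -[u](subrK x0) addrC; apply: le_trans (ler_normD _ _) _.
  by rewrite lerD2l.
rewrite /Qf (_ : _ - _ = q * (dotv y y - dotv x x)); last by ring.
rewrite normrM ler_wpM2l//.
apply: le_trans (dotvv_diff_le (nb _ yr) (nb _ xr)) _.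
rewrite ler_wpM2l// !mulr_ge0// addr_ge0// ltW//.
Qed.

Lemma slopes_error_bound : (((2 * eta) ^+ N)%:E <= \int[leb]_z H z)%E.
Proof.
have r4 : r = 2 * s + 2 * s by rewrite /s; field.
have s2 : 0 < th * s ^+ 2 by rewrite mulr_gt0// exprn_gt0.
apply: (@slopes_le_error (th * s ^+ 2 / 8 + th * s ^+ 2 / 8)
  (- (th * s ^+ 2 / 8) + th * s ^+ 2)).
- rewrite /P subrr (_ : dotv 0 0 = 0) ?mulr0 ?addr0; last first.
    by rewrite /dotv big1// => i _; rewrite mxE mulr0.
  rewrite -lerBrDr; apply: (mollify_le wi mrho); apply: filterS touch_kap => y ty yx.
  have x0r : `|x0 - x0| <= r by rewrite subrr normr0 ltW.
  have yr : `|y - x0| <= r by apply: le_trans yx _; move: kaps s0 r4; lra.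
  have /ler_normlP[h1 h2] := Qf_near x0r yr yx.
  have := ty yx; move: h1 h2; lra.
- move=> x /andP[sx xs].
  have h1 : - (th * s ^+ 2 / 8) - Qf x <= mollify w rho x.
    apply: (mollify_ge wi mrho); apply: filterS w_ge => y wy yx.
    have xr : `|x - x0| <= r by move: xs s0 r4; lra.
    have yr : `|y - x0| <= r.
      rewrite -[y](subrK x) -addrA; apply: le_trans (ler_normD _ _) _.
      move: xs yx kaps r4; lra.
    have /ler_normlP[h1 h2] := Qf_near xr yr yx.
    have := wy yr; move: h1 h2; lra.
  have h2 : th * s ^+ 2 <= th * dotv (x - x0) (x - x0).
    rewrite ler_pM2l//; apply: le_trans (dotvv_ge_norm (x - x0) (ltn0Sn n)).
    by rewrite lerXn2r ?nnegrE// ltW.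
  rewrite /P; move: h1 h2; lra.
have : eta * (16 * N%:R) <= th * s.
  by rewrite -ler_pdivlMr ?mulr_gt0// ge_min lexx orbT.
move=> /(ler_wpM2r (ltW s0)); move: s2; rewrite expr2; lra.
Qed.

End fixed_mollifier.

(** The error of [slopes_error_bound] is the [L^N] distance between finitely
many fixed functions and their mollifications, so it is smaller than the volume
of the slopes once the mollifier is sharp enough. *)
Theorem no_touching : False.
Proof.
have C10 : 0 <= C1 by exact: mulr_ge0.
pose X := C1 ^+ N * #|K|%:R ^+ N * #|K|%:R.
have X0 : 0 <= X by do ![apply: mulr_ge0 => //]; exact: exprn_ge0.
have eN : 0 < (2 * eta) ^+ N by rewrite exprn_gt0// mulr_gt0.
pose e1 := (2 * eta) ^+ N / (X + 1).
have e10 : 0 < e1 by rewrite divr_gt0// ltr_wpDl.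
have GM k : vanish_outside M (G k).
  by case: k => [i|[i j]]; [exact: g1M|exact: g2M].
have GN k : (\int[leb]_x (`|G k x| ^+ N)%:E < +oo)%E.
  by case: k => [i|[i j]]; [exact: g1N|exact: g2N].
have /(_ _)/cid2-/all_sig2[ka ka0 Hka] :=
  fun k => Lp_err_mollify (Gi k) (GM k) (GN k) e10.
have sg0 : 0 < th * s ^+ 2 / 8 by rewrite divr_gt0// mulr_gt0// exprn_gt0.
have [st st0 tst] := w_touch sg0.
pose Z := `|q| * (N%:R * (2 * (`|x0| + r))).
have Z0 : 0 <= Z by do ![apply: mulr_ge0 => //]; exact: addr_ge0 (ltW r0).
(* Four requirements on the scale of the mollifier: it stays in the ball, [Qf]
   hardly varies over it, [w + Qf] is almost zero there, and the mollification
   errors are small in [L^N]. *)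
pose kap := Num.min (2 * s) (Num.min (th * s ^+ 2 / 8 / (Z + 1))
  (Num.min st (\big[Num.min/1]_(k : K) ka k))).
have kmin0 : 0 < \big[Num.min/1]_(k : K) ka k by apply: lt_bigmin => // k _; exact: ka0.
have kap0 : 0 < kap.
  rewrite !lt_min; apply/and4P; split => //; first exact: mulr_gt0.
  by apply: divr_gt0 => //; rewrite ltr_wpDl.
have [rho mr] := exists_mollifier N kap0; have [br _ _ _] := mr.
have : kap <= kap by []; rewrite {2}/kap !le_min => /and4P[k2s kZ kst kk].
have kZ' : `|q| * (N%:R * (2 * (`|x0| + r)) * kap) <= th * s ^+ 2 / 8.
  rewrite mulrA -/Z; have : kap * (Z + 1) <= th * s ^+ 2 / 8.
    by rewrite -ler_pdivlMr// ltr_wpDl.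
  by move: kap0; lra.
have touch' : {ae leb, forall x, `|x - x0| <= kap -> w x + Qf x <= th * s ^+ 2 / 8}.
  by apply: filterS tst => x H xk; apply: H; exact: le_trans kst.
have := slopes_error_bound mr k2s kZ' touch'.
pose err k z := `|mollify (G k) rho z - G k z|.
have merr k : measurable_fun setT (fun z => (err k z ^+ N)%:E).
  by apply: measurable_Lp_err; [exact: mollify_measurable|exact: integrable_meas].
have cst0' : 0 <= C1 ^+ N * #|K|%:R ^+ N by apply: mulr_ge0; exact: exprn_ge0.
apply/negP; rewrite -ltNge.
apply: (@le_lt_trans _ _ (\int[leb]_z ((C1 ^+ N * #|K|%:R ^+ N)%:E *
    \sum_(k : K) (err k z ^+ N)%:E))%E).
  apply: ge0_le_integral => //.
  - move=> z _; rewrite lee_fin exprn_ge0// mulr_ge0// sumr_ge0//.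
  - apply/measurable_EFinP; apply: measurable_funX; apply: measurable_funM => //.
    exact: measurable_mollification_error.
  - apply: emeasurable_funM; first exact: measurable_cst.
    exact: emeasurable_sum.
  move=> z _; rewrite sumEFin -EFinM lee_fin exprMn -mulrA.
  rewrite ler_wpM2l ?exprn_ge0//.
  by apply: (expr_sum_le (x := fun k => err k z)) => // k; exact: normr_ge0.
have es0 z : setT z -> (0 <= \sum_(k : K) (err k z ^+ N)%:E)%E.
  by move=> _; apply: sume_ge0 => k _; rewrite lee_fin exprn_ge0// normr_ge0.
rewrite ge0_integralZl//; last exact: emeasurable_sum.
rewrite ge0_integral_sum//; last first.
  by move=> k z _; rewrite lee_fin exprn_ge0// normr_ge0.
apply: (@le_lt_trans _ _ ((C1 ^+ N * #|K|%:R ^+ N)%:E * \sum_(k : K) e1%:E)%E).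
  rewrite lee_wpmul2l ?lee_fin//; apply: lee_sum => k _.
  apply: (Hka k _ _ _ mr); apply: le_trans kk _.
  exact: bigmin_le_cond.
rewrite sumEFin -EFinM lte_fin sumr_const -[e1 *+ _]mulr_natl mulrA -/X.
rewrite /e1 mulrCA gtr_pMr// ltr_pdivrMr ?ltr_wpDl// mul1r.
by rewrite ltrDl.
Qed.

End no_touching.

(** * Localization of Sobolev functions *)

Section localization.
Variables (R : realType) (N : nat).
Local Notation V := 'rV[R]_N.
Local Notation leb := (@lebesgue_rV R N).
Implicit Types (x y z : V) (u g h : V -> R) (Omega : set V).
Local Notation integrable f := (leb.-integrable setT (EFin \o f)).

Lemma measurable_closed_rV (A : set V) : closed A -> measurable A.
Proof.
by move=> cA; rewrite -[A]setCK; apply: measurableC; apply: measurable_open_rV;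
  rewrite openC.
Qed.

Lemma measurable_cball x0 r : measurable (cball x0 r).
Proof. by apply: measurable_closed_rV; exact: closed_cball. Qed.

Lemma cball_cube x0 r : cball x0 r `<=` cube (`|x0| + r + 1).
Proof.
move=> x; rewrite /cball/= => xr; apply: cube_norm_lt; rewrite -[x](subrK x0) addrC.
apply: le_lt_trans (ler_normD _ _) _; rewrite -addrA ltrD2l; move: xr; lra.
Qed.

Definition cut x0 r g x : R := \1_(cball x0 r) x * g x.

Lemma cut_in x0 r g x : cball x0 r x -> cut x0 r g x = g x.
Proof. by move=> Bx; rewrite /cut indicE mem_set// mul1r. Qed.

Lemma cut_out x0 r g x : ~ cball x0 r x -> cut x0 r g x = 0.
Proof. by move=> Bx; rewrite /cut indicE memNset// mul0r. Qed.

Lemma cut_le x0 r g x : `|cut x0 r g x| <= `|g x|.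
Proof.
have [Bx|Bx] := pselect (cball x0 r x); first by rewrite cut_in.
by rewrite cut_out// normr0.
Qed.

Lemma measurable_cut x0 r g : measurable_fun setT g ->
  measurable_fun setT (cut x0 r g).
Proof.
move=> mg; apply: measurable_funM => //; apply: measurable_indic.
exact: measurable_cball.
Qed.

Lemma Lp1_cut x0 r g : Lp 1%E (cball x0 r) g -> exists2 h, integrable h &
  (forall x, ~ cball x0 r x -> h x = 0) /\
  {ae leb, forall x, cball x0 r x -> h x = g x}.
Proof.
move=> [h /Lfun1_integrable hi hg]; exists (cut x0 r h).
  apply: (le_integrable_EFin _ _ hi) => [|x]; last exact: cut_le.
  by apply: measurable_cut; exact: integrable_meas.
split => [x|]; first exact: cut_out.
by apply: filterS hg => x H Bx; rewrite cut_in//; exact: H.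
Qed.

(** Turns the norm, defined through real powers and an [N]-th root, into an
integral of integer powers. *)
Lemma Lfun_powern h : (0 < N)%N -> h \in Lfun leb (N%:R)%:E ->
  measurable_fun setT h /\ (\int[leb]_x (`|h x| ^+ N)%:E < +oo)%E.
Proof.
move=> N0 /andP[]; rewrite !inE => mh hN; split => //.
have rN : N%:R != 0 :> R by rewrite pnatr_eq0 -lt0n.
rewrite (eq_integral (fun x => (`|(h x)%:E| `^ N%:R)%E)).
  by rewrite -powR_Lnorm// poweR_lty.
by move=> x _; rewrite /= powR_mulrn.
Qed.

Lemma LpN_cut x0 r g : (0 < N)%N -> 0 <= r -> Lp (N%:R)%:E (cball x0 r) g ->
  exists h, [/\ integrable h, forall x, ~ cball x0 r x -> h x = 0,
    (\int[leb]_x (`|h x| ^+ N)%:E < +oo)%E &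
    {ae leb, forall x, cball x0 r x -> h x = g x}].
Proof.
move=> N0 r0 [h /(Lfun_powern N0)[mh hN] hg]; exists (cut x0 r h); split.
- have mc : measurable_fun setT (cut x0 r h) by exact: measurable_cut.
  apply: (@le_integrable_EFin _ _ _ (fun x => \1_(cube (`|x0| + r + 1)) x + `|h x| ^+ N)) => //.
    move=> x; have [Bx|Bx] := pselect (cball x0 r x); last by rewrite cut_out// normr0.
    rewrite cut_in// indicE mem_set; last exact: cball_cube Bx.
    rewrite [leRHS]ger0_norm ?addr_ge0 ?exprn_ge0//.
    have [h1|h1] := leP `|h x| 1; first by rewrite (le_trans h1)// lerDl exprn_ge0.
    apply: (@le_trans _ _ (`|h x| ^+ N)); last by rewrite lerDr.
    by rewrite ler_eXnr// ltW.
  apply: integrableD_EFin.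
    apply: integrable_indic_lty; first exact: measurable_open_box.
    exact: lebesgue_open_box_lty.
  apply/integrableP; split.
    exact: measurable_norm_expr.
  rewrite (eq_integral (fun x => (`|h x| ^+ N)%:E))// => x _ /=.
  by rewrite ger0_norm// exprn_ge0.
- by move=> x; exact: cut_out.
- apply: le_lt_trans hN; apply: ge0_le_integral => //.
  + by apply: measurable_norm_expr; exact: measurable_cut.
  + exact: measurable_norm_expr.
  by move=> x _; rewrite lee_fin lerXn2r ?nnegrE// cut_le.
- by apply: filterS hg => x H Bx; rewrite cut_in//; exact: H.
Qed.

Lemma partial_eq0 (U : set V) (F : V -> R) s : open U -> (forall x, U x -> F x = 0) ->
  forall x, U x -> partial s F x = 0.
Proof.
move=> oU F0; elim: s => [//|i s IH] x Ux /=.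
rewrite (@near_eq_derive _ _ _ (partial s F) (cst 0)); first by rewrite derive_cst.
near=> y; apply: IH; near: y; exact: open_nbhs_nbhs.
Unshelve. all: by end_near. Qed.

Lemma bump_test_function Omega x0 r rho : cball x0 r `<=` Omega ->
  bump_alg rho -> (forall y, rho y != 0 -> `|y - x0| <= r) ->
  test_function Omega rho.
Proof.
move=> BO br rB.
have cB : closure [set x | rho x != 0] `<=` cball x0 r.
  rewrite [X in _ `<=` X](_ : _ = closure (cball x0 r)); last first.
    exact: (closure_id _).1 (@closed_cball R N x0 r).
  by apply: closureS => x; exact: rB.
split; first exact: bump_smooth.
  by apply: subclosed_compact cB; [exact: closed_closure|exact: compact_cball].
exact: subset_trans cB BO.
Qed.

Lemma Rintegral_cut Omega x0 r f h F : cball x0 r `<=` Omega ->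
  (forall x, ~ cball x0 r x -> h x = 0) ->
  {ae leb, forall x, cball x0 r x -> h x = f x} ->
  (forall x, ~ cball x0 r x -> F x = 0) ->
  \int[leb]_(x in Omega) (f x * F x) = \int[leb]_x (h x * F x).
Proof.
move=> BO h0 hf F0; rewrite Rintegral_mkcond /Rintegral; congr fine.
apply: eq_integral_ae_nonmeasurable; apply: filterS hf => x H.
rewrite /patch; have [Bx|Bx] := pselect (cball x0 r x).
  by rewrite mem_set ?H//; exact: BO.
by rewrite h0// mul0r; case: ifP => // _; rewrite F0// mulr0.
Qed.

(** A function of the bump algebra that vanishes off a closed ball of [Omega]
is an admissible test function, and both integrals only see the ball. *)
Lemma weak_partial_cut Omega x0 r s u g hu hg rho : cball x0 r `<=` Omega ->
  is_weak_partial Omega s u g ->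
  (forall x, ~ cball x0 r x -> hu x = 0) ->
  {ae leb, forall x, cball x0 r x -> hu x = u x} ->
  (forall x, ~ cball x0 r x -> hg x = 0) ->
  {ae leb, forall x, cball x0 r x -> hg x = g x} ->
  bump_alg rho -> (forall y, rho y != 0 -> `|y - x0| <= r) ->
  \int[leb]_x (hu x * partial s rho x) = (-1) ^+ size s * \int[leb]_x (hg x * rho x).
Proof.
move=> BO [_ _ wp] hu0 huE hg0 hgE br rB.
have r0 x : ~ cball x0 r x -> rho x = 0.
  by move=> Bx; apply/eqP/negPn/negP => /rB.
rewrite -(Rintegral_cut BO hg0 hgE r0).
rewrite -(wp _ (bump_test_function BO br rB)); apply/esym.
apply: (Rintegral_cut BO) => // x.
apply: (@partial_eq0 (~` cball x0 r)) => //.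
by rewrite openC; exact: closed_cball.
Qed.

(** Testing with translated mollifiers shows that the mollifications of both
candidates agree on the ball. *)
Lemma weak_partial_unique Omega x0 r s u g g' : 0 < r ->
  cball x0 (2 * r) `<=` Omega ->
  is_weak_partial Omega s u g -> is_weak_partial Omega s u g' ->
  {ae leb, forall x, cball x0 r x -> g x = g' x}.
Proof.
move=> r0 BO wg wg'.
have cK := @compact_cball R N x0 (2 * r).
have [Lu Lg _] := wg; have [_ Lg' _] := wg'.
have [hu hui [hu0 huE]] := Lp1_cut (Lu _ cK BO).
have [hg hgi [hg0 hgE]] := Lp1_cut (Lg _ cK BO).
have [hg' hg'i [hg'0 hg'E]] := Lp1_cut (Lg' _ cK BO).
pose d x := hg x + (-1) * hg' x.
have di : integrable d by apply: integrableD_EFin => //; exact: integrableZ.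
have dM : vanish_outside (`|x0| + 2 * r + 1) d.
  move=> x; have [Bx _|Bx] := pselect (cball x0 (2 * r) x); first exact: cball_cube Bx.
  by rewrite /d hg0// hg'0// mulr0 addr0 eqxx.
have d0 : {ae leb, forall x, cball x0 r x -> d x = 0}.
  apply: (ae_eq0_of_mollify_eq0 di dM (@measurable_cball x0 r) r0) => k rho x kr mr Bx.
  have [br _ rk _] := mr; have bs := bump_shift x br.
  have sB y : rho (y - x) != 0 -> `|y - x0| <= 2 * r.
    move=> /rk yx; rewrite -[y](subrK x) -addrA; apply: le_trans (ler_normD _ _) _.
    by move: yx kr Bx; rewrite /cball/=; lra.
  have h1 := weak_partial_cut BO wg hu0 huE hg0 hgE bs sB.
  have h2 := weak_partial_cut BO wg' hu0 huE hg'0 hg'E bs sB.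
  have /eqP : (-1) ^+ size s * mollify hg rho x = (-1) ^+ size s * mollify hg' rho x.
    by rewrite -h1 -h2.
  rewrite (inj_eq (mulfI _)) ?signr_eq0// -subr_eq0 mollifyB// => /eqP <-.
  by apply: eq_Rintegral => y _; rewrite /d mulN1r.
apply: filterS3 d0 hgE hg'E => x dx gx g'x Bx.
have B2 : cball x0 (2 * r) x by move: Bx r0; rewrite /cball/=; lra.
by rewrite -gx// -g'x//; have := dx Bx; rewrite /d; lra.
Qed.

Lemma weak_partialP Omega s u : W2N_loc Omega u -> (size s <= 2)%N ->
  is_weak_partial Omega s u (weak_partial Omega s u).
Proof.
move=> [_ H] s2; rewrite /weak_partial; have [g wg _] := H s s2.
by apply: (@xgetPex _ (fun=> 0) [set g | is_weak_partial Omega s u g]); exists g.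
Qed.

Lemma W2N_loc_cut Omega x0 r u : (0 < N)%N -> 0 < r -> cball x0 (2 * r) `<=` Omega ->
  W2N_loc Omega u -> forall s, (size s <= 2)%N ->
  exists h, [/\ integrable h, forall x, ~ cball x0 r x -> h x = 0,
    (\int[leb]_x (`|h x| ^+ N)%:E < +oo)%E &
    {ae leb, forall x, cball x0 r x -> h x = weak_partial Omega s u x}].
Proof.
move=> N0 r0 BO uW s s2; have [_ H] := uW; have [g wg gN] := H s s2.
have BO' : cball x0 r `<=` Omega.
  by move=> x Bx; apply: BO; move: Bx; rewrite /cball/=; lra.
have [h [hi h0 hN hg]] := LpN_cut N0 (ltW r0) (gN _ (@compact_cball R N x0 r) BO').
exists h; split => //.
have := weak_partial_unique r0 BO wg (weak_partialP uW s2).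
by apply: filterS2 hg => x hx gx Bx; rewrite hx// gx.
Qed.

Lemma W2N_loc_cut0 Omega x0 r u : cball x0 r `<=` Omega -> W2N_loc Omega u ->
  exists2 h, integrable h & (forall x, ~ cball x0 r x -> h x = 0) /\
    {ae leb, forall x, cball x0 r x -> h x = u x}.
Proof.
move=> BO [_ H]; have [g [Lu _ _] _] := H [::] isT.
exact: Lp1_cut (Lu _ (@compact_cball R N x0 r) BO).
Qed.

End localization.

(** * Necessity of the nonnegativity of the eigenvalue *)

Section essential_bounds.
Variables (R : realType) (N : nat).
Local Notation V := 'rV[R]_N.
Local Notation leb := (@lebesgue_rV R N).
Implicit Types (x y z : V) (f : V -> R) (Omega D : set V).

Lemma lebesgue_cball_gt0 x0 (r : R) : 0 < r -> (0 < leb (cball x0 r))%E.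
Proof.
move=> r0; pose B := open_box (fun i => x0 ord0 i - r) (fun i => x0 ord0 i + r).
apply: (@lt_le_trans _ _ (leb B)).
  rewrite (@lebesgue_rV_itv R N false true); first last.
    by move=> i /=; lra.
  by rewrite lte_fin; apply: prodr_gt0 => i _; lra.
apply: le_measure; rewrite ?inE.
- exact: measurable_open_box.
- exact: measurable_cball.
move=> x Bx; apply: rV_norm_le => [|i]; first exact: ltW.
have := Bx i; rewrite /= in_itv/= !mxE ler_norml => /andP[h1 h2].
by apply/andP; split; lra.
Qed.

(** Balls are not negligible, so pointwise information for continuous functions
can be recovered from information almost everywhere. *)
Lemma ae_cball_exists (P : V -> Prop) x0 (r : R) : 0 < r ->
  {ae leb, forall x, P x} -> exists2 x, `|x - x0| <= r & P x.
Proof.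
move=> r0 [Z [mZ Z0 PZ]]; apply: contrapT => H.
have : (leb (cball x0 r) <= leb Z)%E.
  apply: le_measure; rewrite ?inE//; first exact: measurable_cball.
  by move=> x Bx; apply: PZ => /= Px; apply: H; exists x.
by rewrite Z0 leNgt lebesgue_cball_gt0.
Qed.

Lemma ess_sup_lty_bound (f : V -> \bar R) : (ess_sup leb f < +oo)%E ->
  exists B : R, {ae leb, forall x, (f x <= B%:E)%E}.
Proof.
rewrite /ess_sup => /ereal_inf_lt[[y| |] /= Hy// _]; first by exists y.
by exists 0; apply: filterS Hy => x; rewrite leeNy_eq => /eqP ->; rewrite leNye.
Qed.

Lemma ess_sup_on_lty_bound D f : (ess_sup_on D f < +oo)%E ->
  exists B : R, {ae leb, forall x, D x -> f x <= B}.
Proof.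
move=> /ess_sup_lty_bound[B HB]; exists B; apply: filterS HB => x + Dx.
by rewrite mem_set// lee_fin.
Qed.

Lemma Lp_infty_bound D f : Lp +oo%E D f ->
  exists2 B : R, 0 <= B & {ae leb, forall x, D x -> `|f x| <= B}.
Proof.
move=> [g /andP[_]]; rewrite inE /= /finite_norm unlock => + gf.
have -> : (0 < leb [set: V])%E.
  apply: lt_le_trans (@lebesgue_cball_gt0 0 1 ltr01) _.
  by apply: le_measure; rewrite ?inE//; exact: measurable_cball.
move=> /ess_sup_lty_bound[B HB]; exists (Num.max B 0).
  by rewrite le_max lexx orbT.
apply: filterS2 HB gf => x /= gB gfx Dx; rewrite -gfx// le_max.
by rewrite -lee_fin gB.
Qed.

Lemma open_continuous_at Omega f : open Omega -> {within Omega, continuous f} ->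
  forall x, Omega x -> {for x, continuous f}.
Proof.
move=> oO; rewrite continuous_open_subspace// => cf x Ox.
by apply: cf; rewrite inE.
Qed.

Lemma open_cball_sub Omega (U : set V) x0 : open Omega -> Omega x0 -> nbhs x0 U ->
  exists2 r, 0 < r & cball x0 r `<=` Omega `&` U.
Proof.
move=> oO Ox0 Ux0.
have : nbhs x0 (Omega `&` U) by apply: filterI => //; exact: open_nbhs_nbhs.
move=> /nbhs_ballP[e /= e0 eU]; exists (e / 2); first by rewrite divr_gt0.
move=> x xe; apply: eU; rewrite mx_norm_ball /ball_/= distrC.
by apply: le_lt_trans xe _; rewrite ltr_pdivrMr// ltr_pMr// ltr1n.
Qed.

Lemma ae_le_continuous Omega f B : open Omega -> {within Omega, continuous f} ->
  {ae leb, forall x, Omega x -> f x <= B} -> forall x, Omega x -> f x <= B.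
Proof.
move=> oO cf fB x Ox; rewrite leNgt; apply/negP => Bf.
have /(open_cball_sub oO Ox)[r r0 rU] : nbhs x [set y | B < f y].
  have cx := open_continuous_at oO cf Ox.
  have Bn : nbhs (f x) [set t | B < t] by exact: lt_nbhsr.
  exact: (cx _ Bn).
have [y yx yB] := ae_cball_exists x r0 fB.
have [Oy] := rU _ yx; rewrite /= ltNge => /negP; apply; exact: yB.
Qed.

End essential_bounds.

Section necessary.
Variables (R : realType) (N : nat).
Local Notation V := 'rV[R]_N.
Local Notation leb := (@lebesgue_rV R N).

Lemma limf_esup_le0 (T : topologicalType) (F : set_system T) (FF : Filter F) (f : T -> R) :
  f x @[x --> F] --> (0 : R) -> (limf_esup (EFin \o f) F <= 0)%E.
Proof.
move=> f0; apply/lee_addgt0Pr => e e0; rewrite add0e.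
apply: (@le_trans _ _ (ereal_sup ((EFin \o f) @` [set x | f x <= e]))).
  apply: ereal_inf_lbound; exists [set x | f x <= e] => //.
  by have /cvgr_le := f0; apply.
by apply: ge_ereal_sup => _ [x /= fe <-]; rewrite lee_fin.
Qed.

(** If [l < 0] were admissible for [lambda1'], a function [phi] that
witnesses it would satisfy [L phi >= - l phi > 0] together with all the
other hypotheses of the maximum principle, while being positive. *)
Lemma maximum_principle_lambda1'_ge0 (Omega : set V) a b c :
  domain Omega -> maximum_principle Omega a b c -> (0 <= lambda1' Omega a b c)%E.
Proof.
move=> [oO _ [x1 Ox1]] MP; apply: le_ereal_inf_tmp => _ [l [phi [phiW phioo phi0 phiL phib]] <-].
rewrite lee_fin leNgt; apply/negP => l0.
have [B B0 phiB] := Lp_infty_bound phioo.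
have phi_le x : Omega x -> phi x <= B.
  have [cphi _] := phiW.
  apply: (ae_le_continuous oO cphi).
  by apply: filterS phiB => y H Oy; apply: le_trans (ler_norm _) (H Oy).
have : phi x1 <= 0; last by rewrite leNgt phi0.
apply: MP Ox1 => //.
- apply: filterS phiL => x H Ox; have := H Ox.
  have : l * phi x < 0 by rewrite nmulr_rlt0//; exact: phi0.
  lra.
- apply: (@le_lt_trans _ _ B%:E); last exact: ltry.
  by apply: ge_ereal_sup => _ [x Ox <-]; rewrite lee_fin; exact: phi_le.
- by move=> xi bxi; apply: limf_esup_le0; exact: phib.
Qed.

End necessary.

(** * The barrier at infinity *)

Section growth.
Variables (R : realType) (N : nat).
Local Notation V := 'rV[R]_N.
Local Notation leb := (@lebesgue_rV R N).
Implicit Types (x y z : V) (f : V -> R) (Omega D : set V).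

(** The function [1 + |x|^2]: its Hessian is twice the identity and its
gradient is [2 x], so that quadratic growth of the coefficients is exactly
what keeps [L chi / chi] bounded above. *)
Definition chi x : R := 1 + dotv x x.

Lemma chi_ge1 x : 1 <= chi x.
Proof. by rewrite lerDl dotvv_ge0. Qed.

Lemma sqr_euclid x : euclid x ^+ 2 = dotv x x.
Proof. by rewrite sqr_sqrtr// dotvv_ge0. Qed.

Lemma euclid_ge0 x : 0 <= euclid x.
Proof. exact: sqrtr_ge0. Qed.

Lemma euclid_ge_norm x : (0 < N)%N -> `|x| <= euclid x.
Proof.
move=> N0; rewrite -(@ler_pXn2r _ 2)// ?nnegrE ?euclid_ge0//.
by rewrite sqr_euclid dotvv_ge_norm.
Qed.

Lemma limsup_infty_bound Omega f : (limsup_infty Omega f < +oo)%E ->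
  exists r B : R, forall x, Omega x -> r < euclid x -> f x <= B.
Proof.
move=> /ereal_inf_lt[_ [r _ <-]]; set S := [set _ | _ in _].
case E : (ereal_sup S) => [B| |]//= _.
  exists r, B => x Ox rx.
  suff : ((f x)%:E <= B%:E)%E by rewrite lee_fin.
  by rewrite -E; apply: ereal_sup_ubound; exists x.
exists r, 0 => x Ox rx; suff : ((f x)%:E <= (-oo : \bar R))%E by rewrite leeNy_eq.
by rewrite -E; apply: ereal_sup_ubound; exists x.
Qed.

(** A continuous function is bounded on the compact part of the closure where
the limit superior says nothing. *)
Lemma limsup_growth Omega f : (0 < N)%N ->
  {within closure Omega, continuous f} ->
  (limsup_infty Omega (fun x => `|f x| / euclid x ^+ 2)%R < +oo)%E ->
  exists2 C, 0 <= C & forall x, Omega x -> `|f x| <= C * chi x.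
Proof.
move=> N0 cf /limsup_infty_bound[r [B HB]].
pose r1 := Num.max r 1.
pose S := closure Omega `&` cball 0 r1.
have cS : compact S.
  apply: subclosed_compact (@compact_cball R N 0 r1) _; last by move=> x [].
  by apply: closedI; [exact: closed_closure|exact: closed_cball].
have [B' HB'] : exists B', forall x, S x -> `|f x| <= B'.
  have [S0|S0] := pselect (S !=set0); last first.
    by exists 0 => x Sx; case: S0; exists x.
  have cfS : {within S, continuous (fun x => `|f x|)}.
    have : {within S, continuous f} by apply: continuous_subspaceW cf => x [].
    by move=> c x; apply: cvg_norm; exact: c.
  have [c cS' cmax] := EVT_max_rV S0 cS cfS.
  by exists `|f c| => x Sx; apply: cmax; rewrite inE.
exists (`|B| + `|B'|); first by rewrite addr_ge0.
move=> x Ox; have c1 := chi_ge1 x.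
have [xr|xr] := leP (euclid x) r1.
  apply: (@le_trans _ _ `|B'|).
    apply: le_trans (HB' x _) (ler_norm _); split.
      exact: subset_closure.
    by rewrite /cball/= subr0; apply: le_trans (euclid_ge_norm x N0) xr.
  rewrite -[leLHS]mulr1 ler_pM//; first by rewrite lerDr.
move: xr; rewrite gt_max => /andP[rx x1].
have e0 : 0 < euclid x ^+ 2 by rewrite exprn_gt0// (lt_trans ltr01).
have := HB x Ox rx; rewrite ler_pdivrMr// sqr_euclid => h.
apply: le_trans h _; apply: (@le_trans _ _ (`|B| * dotv x x)).
  by rewrite ler_wpM2r ?dotvv_ge0// ler_norm.
by rewrite ler_pM ?dotvv_ge0// ?lerDl// /chi lerDr.
Qed.

(** On bounded sets the drift is bounded by assumption; far away the limit
superior takes over. *)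
Lemma ess_limsup_growth Omega (b : V -> V) : (0 < N)%N ->
  (forall i, Linfty_loc_closure Omega (fun x => b x ord0 i)) ->
  (ess_limsup_infty Omega (fun x => dotv (b x) x / euclid x ^+ 2)%R < +oo)%E ->
  exists2 C, 0 <= C & {ae leb, forall x, Omega x -> dotv (b x) x <= C * chi x}.
Proof.
move=> N0 bloc /ereal_inf_lt[_ [r _ <-]] /ess_sup_on_lty_bound[B HB].
pose r1 := Num.max r 1.
have r10 : 0 < r1 by rewrite lt_max ltr01 orbT.
have /(_ _)/cid2-/all_sig2[beta beta0 Hb] :
    forall i, exists2 B : R, 0 <= B & {ae leb, forall x : V,
    (Omega `&` [set x | euclid x < r1 + 1]) x -> `|b x ord0 i| <= B}.
  by move=> i; apply: Lp_infty_bound; apply: bloc; rewrite addr_gt0.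
pose C := \sum_(i < N) beta i * r1.
have C0 : 0 <= C by apply: sumr_ge0 => i _; rewrite mulr_ge0// ltW.
exists (`|B| + C); first by rewrite addr_ge0.
have /filter_forall : forall i, {ae leb, forall x : V,
    (Omega `&` [set x | euclid x < r1 + 1]) x -> `|b x ord0 i| <= beta i} by [].
apply: filterS2 HB => x HBx Hbx Ox; have c1 := chi_ge1 x.
have [xr|xr] := leP (euclid x) r1.
  apply: (@le_trans _ _ C).
    apply: ler_sum => i _; apply: le_trans (ler_norm _) _; rewrite normrM.
    apply: ler_pM => //.
      by apply: Hbx; split => //=; apply: le_lt_trans xr _; rewrite ltrDl.
    apply: le_trans (coord_norm_le _ _) _.
    by apply: le_trans (euclid_ge_norm x N0) xr.
  by rewrite -[leLHS]mulr1 ler_pM//; rewrite lerDr.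
move: xr; rewrite gt_max => /andP[rx x1].
have e0 : 0 < euclid x ^+ 2 by rewrite exprn_gt0// (lt_trans ltr01).
have := HBx (conj Ox rx); rewrite ler_pdivrMr// sqr_euclid => h.
apply: le_trans h _; apply: (@le_trans _ _ (`|B| * dotv x x)).
  by rewrite ler_wpM2r ?dotvv_ge0// ler_norm.
by rewrite ler_pM ?dotvv_ge0// ?lerDl// /chi lerDr.
Qed.

(** The left-hand side is [L chi]. *)
Lemma chi_growth Omega (a : V -> 'M[R]_N) (b : V -> V) (c : V -> R) : (0 < N)%N ->
  elliptic_operator Omega a b c ->
  (ess_sup_on Omega c < +oo)%E ->
  (forall i j : 'I_N, (limsup_infty Omega (fun x => `|a x i j| / euclid x ^+ 2)%R < +oo)%E) ->
  (ess_limsup_infty Omega (fun x => dotv (b x) x / euclid x ^+ 2)%R < +oo)%E ->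
  exists2 C, 0 <= C & {ae leb, forall x, Omega x ->
    2 * (\sum_(i < N) a x i i) + 2 * dotv (b x) x + c x * chi x <= C * chi x}.
Proof.
move=> N0 [_ ca _ bloc _] /ess_sup_on_lty_bound[Cc Hc] aoo boo.
have [Cb Cb0 Hb] := ess_limsup_growth N0 bloc boo.
have /(_ _)/cid2-/all_sig2[Ca Ca0 Ha] :=
  fun i => limsup_growth N0 (ca i i) (aoo i i).
exists (2 * (\sum_(i < N) Ca i) + 2 * Cb + `|Cc|).
  by rewrite !addr_ge0// ?mulr_ge0// sumr_ge0.
apply: filterS2 Hc Hb => x Hcx Hbx Ox.
have c1 := chi_ge1 x; have c0 : 0 <= chi x := le_trans ler01 c1.
rewrite [leRHS]mulrDl [in leRHS]mulrDl; apply: lerD; first apply: lerD.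
- rewrite -mulrA ler_wpM2l// mulr_suml; apply: ler_sum => i _.
  by apply: le_trans (ler_norm _) _; exact: Ha.
- by rewrite -mulrA ler_wpM2l//; exact: Hbx.
- by rewrite ler_wpM2r//; apply: le_trans (Hcx Ox) (ler_norm _).
Qed.

End growth.

(** * Local representatives of Sobolev functions *)

Section sobolev_representatives.
Variables (R : realType) (n : nat).
Local Notation N := n.+1.
Local Notation V := 'rV[R]_N.
Local Notation leb := (@lebesgue_rV R N).
Local Notation integrable f := (leb.-integrable setT (EFin \o f)).
Implicit Types (x y z : V) (Omega : set V) (s : seq 'I_N).

(** Weak derivatives on a ball in a form free of the domain: [w] and [h s] are
integrable on the whole space, and tested against the bump algebra only. In
this form linear combinations are immediate. *)
Definition sobolev_rep x0 (r : R) (w : V -> R) (h : seq 'I_N -> V -> R) :=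
  integrable w /\ forall s, (size s <= 2)%N ->
  [/\ integrable (h s), forall x, ~ cball x0 r x -> h s x = 0,
      (\int[leb]_x (`|h s x| ^+ N)%:E < +oo)%E &
      forall rho, bump_alg rho -> (forall y, rho y != 0 -> `|y - x0| <= r) ->
      \int[leb]_y (w y * partial s rho y)
      = (-1) ^+ size s * \int[leb]_y (h s y * rho y)].

Lemma W2N_loc_rep Omega x0 (r : R) u : 0 < r -> cball x0 (2 * r) `<=` Omega ->
  W2N_loc Omega u -> exists w h, [/\ sobolev_rep x0 r w h,
    {ae leb, forall x, cball x0 r x -> w x = u x} &
    forall s, (size s <= 2)%N ->
    {ae leb, forall x, cball x0 r x -> h s x = weak_partial Omega s u x}].
Proof.
move=> r0 BO uW.
have BO' : cball x0 r `<=` Omega.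
  by move=> x Bx; apply: BO; move: Bx; rewrite /cball/=; lra.
have [w wi [w0 wu]] := W2N_loc_cut0 BO' uW.
have /choice[h Hh] : forall s, exists h, (size s <= 2)%N ->
  [/\ integrable h, forall x, ~ cball x0 r x -> h x = 0,
    (\int[leb]_x (`|h x| ^+ N)%:E < +oo)%E &
    {ae leb, forall x, cball x0 r x -> h x = weak_partial Omega s u x}].
  move=> s; case: (leqP (size s) 2) => s2; last by exists (fun=> 0).
  by have [h ?] := W2N_loc_cut (ltn0Sn n) r0 BO uW s2; exists h.
exists w, h; split => //; last by move=> s /Hh[].
split => // s s2; have [hi h0 hN hu] := Hh s s2; split => // rho brho rhor.
exact: (weak_partial_cut BO' (weak_partialP uW s2) w0 wu h0 hu brho rhor).
Qed.

Lemma sobolev_rep_lin x0 (r p q : R) w1 h1 w2 h2 :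
  sobolev_rep x0 r w1 h1 -> sobolev_rep x0 r w2 h2 ->
  sobolev_rep x0 r (fun x => p * w1 x + q * w2 x)
    (fun s x => p * h1 s x + q * h2 s x).
Proof.
have lin (f1 f2 K : V -> R) : integrable f1 -> integrable f2 -> bump_alg K ->
    \int[leb]_y ((p * f1 y + q * f2 y) * K y)
    = p * \int[leb]_y (f1 y * K y) + q * \int[leb]_y (f2 y * K y).
  move=> i1 i2 bK; have iK1 := integrable_mul_bump i1 bK.
  have iK2 := integrable_mul_bump i2 bK.
  rewrite -!RintegralZl// -RintegralD//; try exact: integrableZ.
  by apply: eq_Rintegral => y _; rewrite mulrDl !mulrA.
move=> [i1 H1] [i2 H2]; split; first by apply: integrableD_EFin; exact: integrableZ.
move=> s s2; have [hi1 z1 N1 p1] := H1 s s2; have [hi2 z2 N2 p2] := H2 s s2.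
split.
- by apply: integrableD_EFin; exact: integrableZ.
- by move=> x Bx; rewrite z1// z2// !mulr0 addr0.
- have m1 := integrable_meas hi1; have m2 := integrable_meas hi2.
  apply: (@le_lt_trans _ _ (\int[leb]_x (((2 * `|p|) ^+ N)%:E * (`|h1 s x| ^+ N)%:E
      + ((2 * `|q|) ^+ N)%:E * (`|h2 s x| ^+ N)%:E))%E).
    apply: ge0_le_integral => //.
    + by apply: measurable_norm_expr; apply: measurable_funD; apply: measurable_funM.
    + by apply: emeasurable_funD; apply: measurable_funeM; exact: measurable_norm_expr.
    + move=> x _; rewrite -!EFinM -EFinD lee_fin.
      have E (t z : R) : (2 * `|t|) ^+ N * `|z| ^+ N = 2 ^+ N * `|t * z| ^+ N.
        by rewrite normrM !exprMn mulrA.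
      rewrite !E -mulrDr; apply: le_trans (@exprD_le R _ _ N _ _ _) => //.
      apply: lerXn2r; rewrite ?nnegrE ?addr_ge0//.
      exact: ler_normD.
  have ge (t : R) (g : V -> R) x : (0 <= ((2 * `|t|) ^+ N)%:E * (`|g x| ^+ N)%:E)%E.
    by rewrite -EFinM lee_fin mulr_ge0 ?exprn_ge0 ?mulr_ge0.
  rewrite ge0_integralD//; try by apply: measurable_funeM; exact: measurable_norm_expr.
  rewrite (ge0_integralZl leb)//; try exact: measurable_norm_expr.
  rewrite (ge0_integralZl leb)//; try exact: measurable_norm_expr.
  by rewrite lte_add_pinfty// lte_mul_pinfty// lee_fin exprn_ge0 ?mulr_ge0.
- move=> rho brho rhor; have bs := bump_partial s brho.
  by rewrite lin// lin// p1// p2//; ring.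
Qed.

End sobolev_representatives.

(** * Comparison at a contact point *)

Section comparison.
Variables (R : realType) (n : nat).
Local Notation N := n.+1.
Local Notation V := 'rV[R]_N.
Local Notation leb := (@lebesgue_rV R N).
Local Notation integrable f := (leb.-integrable setT (EFin \o f)).
Implicit Types (x y z : V) (Omega : set V) (s : seq 'I_N).

Lemma continuous_at_lin (T : topologicalType) (f g : T -> R) (p q : R) (t : T) :
  {for t, continuous f} -> {for t, continuous g} ->
  {for t, continuous (fun k => p * f k + q * g k)}.
Proof.
move=> cf cg; apply: cvgD; (apply: cvgM; first exact: cvg_cst).
- exact: cf.
- exact: cg.
Qed.

Lemma continuous_chi : continuous (@chi R N).
Proof.
move=> x; have := @continuous_at_lin V (cst 1) (fun z => dotv (z - 0) (z - 0)) 1 1 x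
  (@cst_continuous V R 1 x) (@continuous_dotvv R N 0 x).
by congr continuous_at; apply/funext => z; rewrite !mul1r subr0.
Qed.

Lemma nbhs_lt (f : V -> R) x B : {for x, continuous f} -> f x < B ->
  nbhs x [set y | f y < B].
Proof.
move=> cx fB; have Bn : nbhs (f x) [set t | t < B] by exact: lt_nbhsl.
exact: (cx _ Bn).
Qed.

(** Local boundedness is stated on Euclidean balls around the origin; the ball
of radius one around [x0] is contained in one of them. *)
Lemma ball_coords_bound Omega (f : V -> R) x0 :
  Linfty_loc_closure Omega f ->
  exists2 B, 0 <= B & {ae leb, forall x, Omega x -> cball x0 1 x -> `|f x| <= B}.
Proof.
move=> fl; pose e := Num.sqrt (N%:R * (`|x0| + 1) ^+ 2).
have [|B B0 HB] := Lp_infty_bound (fl (e + 1) _); first by rewrite ltr_wpDl// sqrtr_ge0.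
exists B => //; apply: filterS HB => x H Ox Bx; apply: H; split => //=.
apply: (@le_lt_trans _ _ e); last by rewrite ltrDl.
rewrite /euclid ler_wsqrtr// (le_trans (dotvv_le_norm x))// ler_wpM2l//.
rewrite lerXn2r ?nnegrE ?addr_ge0//.
rewrite -[x](subrK x0) addrC; apply: le_trans (ler_normD _ _) _.
by rewrite lerD2l.
Qed.

(** Near [x0] the function [W = p phi + q chi - u] satisfies
[L W <= - l p phi + C q chi], which is negative. The zeroth-order
term [c W] is negligible close to [x0] since [c] is bounded and [W] is
continuous with [W x0 = 0], so [no_touching] applies to the part of [L]
without zeroth-order term. The term [q chi] is passed as the explicit
paraboloid; only [p phi - u] gets mollified. *)
Theorem subsolution_no_touching Omega (a : V -> 'M[R]_N) (b : V -> V) (c : V -> R)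
    phi u x0 (l p q C : R) :
  open Omega -> elliptic_operator Omega a b c ->
  W2N_loc Omega phi -> W2N_loc Omega u ->
  {ae leb, forall x, Omega x -> Lop Omega a b c phi x + l * phi x <= 0} ->
  {ae leb, forall x, Omega x -> 0 <= Lop Omega a b c u x} ->
  {ae leb, forall x, Omega x ->
    2 * (\sum_(i < N) a x i i) + 2 * dotv (b x) x + c x * chi x <= C * chi x} ->
  0 <= p -> 0 <= q -> Omega x0 ->
  (forall x, Omega x -> u x <= p * phi x + q * chi x) ->
  u x0 = p * phi x0 + q * chi x0 ->
  C * q * chi x0 < l * p * phi x0 -> False.
Proof.
move=> oO [asym ac aeig bloc cloc] phiW uW Lphi Lu growth p0 q0 Ox0 u_le u_eq strict.
have cphi := open_continuous_at oO phiW.1 Ox0.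
have cu := open_continuous_at oO uW.1 Ox0.
have cchi := @continuous_chi x0.
pose delta := (l * p * phi x0 - C * q * chi x0) / 3.
have delta0 : 0 < delta by rewrite /delta; move: strict; lra.
have Cx0 : closure Omega x0 by exact: subset_closure.
have [m m0 mcoer] := sym_eigenvalue_coercive (asym _ Cx0) (aeig _ Cx0).
have [Bc Bc0 HBc] := ball_coords_bound x0 cloc.
have /(_ _)/cid2-/all_sig2[beta beta0 Hb] := fun i => ball_coords_bound x0 (bloc i).
pose W y := p * phi y + q * chi y - u y.
have W0 : W x0 = 0 by rewrite /W u_eq subrr.
have W_ge0 x : Omega x -> 0 <= W x by move=> Ox; rewrite subr_ge0 u_le.
have cW : {for x0, continuous W}.
  have := @continuous_at_lin _ _ _ 1 (-1) x0 (@continuous_at_lin _ _ _ p q x0 cphi cchi) cu.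
  by congr continuous_at; apply/funext => z; rewrite mul1r mulN1r.
pose f y := - (l * p) * phi y + C * q * chi y.
have cf : {for x0, continuous f} by exact: continuous_at_lin.
pose e := m / (4 * N%:R ^+ 2).
have e0 : 0 < e by rewrite divr_gt0// mulr_gt0// exprn_gt0.
have Ua : nbhs x0 [set y | forall i j, `|a y i j - a x0 i j| <= e].
  suff /filter_forall : forall ij : 'I_N * 'I_N,
      nbhs x0 (fun y => `|a y ij.1 ij.2 - a x0 ij.1 ij.2| <= e).
    by apply: filterS => y H i j; exact: (H (i, j)).
  move=> [i j] /=.
  have cij : {for x0, continuous (fun x => a x i j)}.
    apply: (open_continuous_at oO) Ox0; apply: continuous_subspaceW (ac i j).
    exact: subset_closure.
  have := cij _ (nbhsx_ballx (a x0 i j) _ e0).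
  rewrite nbhs_simpl/=; by apply: filterS => y /= /ltW; rewrite distrC.
have U1 : nbhs x0 (cball x0 1).
  apply/nbhs_ballP; exists 1 => //= z; rewrite mx_norm_ball /ball_/= distrC.
  exact: ltW.
have UW : nbhs x0 [set y | W y < delta / (Bc + 1)].
  by apply: nbhs_lt cW _; rewrite W0 divr_gt0// ltr_wpDl.
have Uf : nbhs x0 [set y | f y < - 2 * delta].
  by apply: nbhs_lt cf _; rewrite /f; move: delta0; rewrite /delta; lra.
have [r' r'0 Br'] := open_cball_sub oO Ox0
  (filterI (filterI Ua U1) (filterI UW Uf)).
pose r := r' / 2; have r0 : 0 < r by rewrite divr_gt0.
have r2 : 2 * r = r' by rewrite /r mulrC divfK.
have BO2 : cball x0 (2 * r) `<=` Omega by rewrite r2 => x /Br'[].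
have BO x : `|x - x0| <= r -> [/\ Omega x, forall i j, `|a x i j - a x0 i j| <= e,
    cball x0 1 x, W x < delta / (Bc + 1) & f x < - 2 * delta].
  move=> xr; have /Br'[Ox [[ax x1] [Wx fx]]] : cball x0 r' x; last by [].
  by rewrite /cball/=; move: xr r0; rewrite /r; lra.
have [w1 [h1 [rep1 w1E h1E]]] := W2N_loc_rep r0 BO2 phiW.
have [w2 [h2 [rep2 w2E h2E]]] := W2N_loc_rep r0 BO2 uW.
have := sobolev_rep_lin p (-1) rep1 rep2.
set w := fun x => _; set h := fun s x => _ => -[wi hH].
have wE : {ae leb, forall x, `|x - x0| <= r -> w x + (q * dotv x x + q) = W x}.
  apply: filterS2 w1E w2E => x E1 E2 xr.
  by rewrite /w /W E1// E2// /chi; ring.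
have vO s : (size s <= 2)%N -> vanish_outside (`|x0| + r + 1) (h s).
  move=> s2 x; have [_ h0 _ _] := hH s s2.
  by move=> hx; apply: (@cball_cube R N x0 r); apply: contrapT => /h0 h0x; rewrite h0x eqxx in hx.
apply: (@no_touching R n w (fun i => h [:: i]) (fun i j => h [:: i; j])
  (fun x i j => a x i j) (fun x i => b x ord0 i) (fun i j => a x0 i j) x0
  (`|x0| + r + 1) r q q m delta (\sum_i beta i)) => //.
- exact: sumr_ge0.
- by move=> i; have [] := hH [:: i] isT.
- by move=> i j; have [] := hH [:: i; j] isT.
- by move=> i; apply: vO.
- by move=> i j; apply: vO.
- by move=> i; have [] := hH [:: i] isT.
- by move=> i j; have [] := hH [:: i; j] isT.
- move=> rho i brho rhor; have [_ _ _ ->//] := hH [:: i] isT.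
  by rewrite expr1 mulN1r.
- move=> rho i j brho rhor; have [_ _ _ ->//] := hH [:: i; j] isT.
  by rewrite sqrrN expr1n mul1r.
- by apply: filterS wE => x E xr; rewrite E//; apply: W_ge0; case: (BO x xr).
- move=> t t0; have UWt : nbhs x0 [set y | W y < t] by apply: nbhs_lt cW _; rewrite W0.
  have [k k0 Bk] := open_cball_sub oO Ox0 UWt.
  exists (Num.min k r); first by rewrite lt_min k0.
  apply: filterS wE => x E; rewrite le_min => /andP[xk xr].
  by rewrite E//; apply: ltW; case: (Bk x xk).
- move=> x xr i j; have [Ox _ _ _ _] := BO x xr.
  by rewrite -[in LHS](asym x (subset_closure Ox)) mxE.
- by move=> i j; rewrite -[in LHS](asym x0 Cx0) mxE.
- by move=> x /BO[].
have /filter_forall hb : forall i, {ae leb, forall x, Omega x -> cball x0 1 x -> `|b x ord0 i| <= beta i} by [].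
have /filter_forall d1 : forall i, {ae leb, forall x, cball x0 r x ->
    h [:: i] x = p * weak_partial Omega [:: i] phi x - weak_partial Omega [:: i] u x}.
  move=> i; apply: filterS2 (h1E [:: i] isT) (h2E [:: i] isT) => x E1 E2 xr.
  by rewrite /h E1// E2// mulN1r.
have /filter_forall d2 : forall ij : 'I_N * 'I_N, {ae leb, forall x, cball x0 r x ->
    h [:: ij.1; ij.2] x = p * weak_partial Omega [:: ij.1; ij.2] phi x
      - weak_partial Omega [:: ij.1; ij.2] u x}.
  move=> [i j]; apply: filterS2 (h1E [:: i; j] isT) (h2E [:: i; j] isT) => x E1 E2 xr.
  by rewrite /h E1// E2// mulN1r.
near=> x => xr.
have [Ox _ x1 Wx fx] := BO x xr.
have hbx : forall i, `|b x ord0 i| <= beta i.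
  by move=> i; move: i Ox x1; near: x; apply: filterS hb => x H i Ox x1; exact: H.
split.
  move=> i; apply: le_trans (hbx i) _.
  by rewrite (bigD1 i)//= lerDl sumr_ge0.
have E1 : forall i, h [:: i] x = p * weak_partial Omega [:: i] phi x - weak_partial Omega [:: i] u x.
  by move=> i; move: i xr; near: x; apply: filterS d1 => x H i xr; exact: H.
have E2 : forall i j, h [:: i; j] x = p * weak_partial Omega [:: i; j] phi x - weak_partial Omega [:: i; j] u x.
  by move=> i j; move: i j xr; near: x; apply: filterS d2 => x H i j xr; exact: (H (i, j)).
have gx : 2 * (\sum_(i < N) a x i i) + 2 * dotv (b x) x + c x * chi x <= C * chi x.
  by move: Ox; near: x.
have Lphix : Lop Omega a b c phi x + l * phi x <= 0 by move: Ox; near: x.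
have Lux : 0 <= Lop Omega a b c u x by move: Ox; near: x.
have cx : `|c x| <= Bc by move: Ox x1; near: x.
pose S2 (v : V -> R) := \sum_(i < N) \sum_(j < N) a x i j * weak_partial Omega [:: i; j] v x.
pose S1 (v : V -> R) := \sum_(i < N) b x ord0 i * weak_partial Omega [:: i] v x.
have -> : contract (fun i j => a x i j) (fun i j => h [:: i; j] x + 2 * q * (i == j)%:R)
    = p * S2 phi - S2 u + 2 * q * \sum_(i < N) a x i i.
  rewrite /contract /S2 !mulr_sumr -sumrB -big_split/=; apply: eq_bigr => i _.
  rewrite mulr_sumr -sumrB -[X in _ = _ + X](big_pred1_eq +%R i (fun j => 2 * q * a x i j)).
  rewrite [X in _ = _ + X]big_mkcond -big_split/=; apply: eq_bigr => j _.
  by rewrite E2 [i == j]eq_sym; case: ifP => _; rewrite ?mulr1 ?mulr0; ring.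
have -> : \sum_(i < N) b x ord0 i * (h [:: i] x + 2 * q * x ord0 i)
    = p * S1 phi - S1 u + 2 * q * dotv (b x) x.
  rewrite /S1 /dotv !mulr_sumr -sumrB -big_split/=; apply: eq_bigr => i _.
  by rewrite E1; ring.
have {}Lphix : S2 phi + S1 phi + c x * phi x + l * phi x <= 0 by [].
have {}Lux : 0 <= S2 u + S1 u + c x * u x by [].
have Wx0 := W_ge0 x Ox.
(* The sign of [c] is unknown; only the smallness of [W] is used. *)
have cW' : - (c x * W x) <= delta.
  apply: (@le_trans _ _ (Bc * W x)).
    rewrite -mulNr ler_wpM2r//; apply: le_trans cx; rewrite -normrN; exact: ler_norm.
  apply: (@le_trans _ _ ((Bc + 1) * W x)); first by rewrite ler_wpM2r// lerDl.
  by rewrite mulrC -ler_pdivlMr ?ltr_wpDl//; exact: ltW.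
have P1 := ler_wpM2l p0 Lphix.
have P2 := ler_wpM2l q0 gx.
move: P1 P2 Lux cW' fx; rewrite /W /f.
clear; move: (S2 phi) (S1 phi) (S2 u) (S1 u) (\sum_(i < N) _) => A1 A2 A3 A4 A5.
move: (dotv _ _) (chi x) (c x) (phi x) (u x) => A6 A7 A8 A9 A10.
clear; nra.
Unshelve. all: by end_near.
Qed.

End comparison.

(** * Sufficiency of the positivity of the eigenvalue *)

Section maximum_principle.
Variables (R : realType).

(** The tangent line of [t ^+ k.+1] at [s], evaluated at the weighted
mean. *)
Lemma weighted_AMGM (k : nat) (s t : R) : 0 <= s -> 0 <= t ->
  s ^+ k * t <= ((k%:R * s + t) / k.+1%:R) ^+ k.+1.
Proof.
move=> s0 t0; apply: le_trans (expr_tangent_le k s0 _); last first.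
  by rewrite divr_ge0// addr_ge0// mulr_ge0.
rewrite le_eqVlt; apply/orP; left; apply/eqP.
have k0 : k.+1%:R != 0 :> R by [].
rewrite exprS; move: k0; rewrite -natr1 => k0; by field.
Qed.

(** After division by the values at [x0], maximality of the ratio says that
[u^(k+1) <= phi^k psi]; extract the [k+1]-st root by [weighted_AMGM]. *)
Lemma le_combination_of_max_ratio T (Omega : set T) (phi psi u : T -> R) k x0 :
  (forall x, Omega x -> 0 < phi x) -> (forall x, Omega x -> 0 < psi x) ->
  Omega x0 -> 0 < u x0 ->
  (forall x, Omega x -> 0 < u x ->
    u x ^+ k.+1 / (phi x ^+ k * psi x) <= u x0 ^+ k.+1 / (phi x0 ^+ k * psi x0)) ->
  forall x, Omega x ->
    u x <= u x0 * k%:R / (k.+1%:R * phi x0) * phi x + u x0 / (k.+1%:R * psi x0) * psi x.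
Proof.
move=> phi0 psi0 Ox0 ux0 umax x Ox.
have := phi0 _ Ox0; have := phi0 _ Ox; have := psi0 _ Ox0; have := psi0 _ Ox.
have := umax x Ox; move: (u x) (u x0) (phi x) (phi x0) (psi x) (psi x0) ux0.
clear => v v0 s s0 t t0 v00 H t1 t01 s1 s01.
have k0 : 0 < k.+1%:R :> R by [].
have [v1|v1] := leP v 0.
  apply: le_trans v1 _; apply: addr_ge0; apply: mulr_ge0; try exact: ltW.
    by apply: divr_ge0; apply: mulr_ge0 => //; exact: ltW.
  by apply: divr_ge0; [exact: ltW|apply: mulr_ge0 => //; exact: ltW].
have -> : v0 * k%:R / (k.+1%:R * s0) * s + v0 / (k.+1%:R * t0) * t =
    v0 * ((k%:R * (s / s0) + t / t0) / k.+1%:R).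
  by field; rewrite !gt_eqF.
rewrite mulrC -ler_pdivrMr// -(@ler_pXn2r _ k.+1)// ?nnegrE; first last.
- by apply: divr_ge0 => //; apply: addr_ge0;
    [apply: mulr_ge0 => //|]; apply: divr_ge0; exact: ltW.
- by apply: divr_ge0; exact: ltW.
apply: le_trans (weighted_AMGM k _ _); try (by apply: divr_ge0; exact: ltW).
have {H} := H v1; rewrite ler_pdivrMr ?mulr_gt0 ?exprn_gt0// => H.
rewrite !expr_div_n ler_pdivrMr ?exprn_gt0//; apply: le_trans H _.
rewrite le_eqVlt; apply/orP; left; apply/eqP.
by field; rewrite !expf_neq0 ?gt_eqF.
Qed.

Lemma continuous_at_mul (T : topologicalType) (f g : T -> R) (t : T) :
  {for t, continuous f} -> {for t, continuous g} ->
  {for t, continuous (fun s => f s * g s)}.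
Proof. by move=> cf cg; apply: cvgM; [exact: cf|exact: cg]. Qed.

Lemma continuous_at_inv (T : topologicalType) (f : T -> R) (t : T) :
  f t != 0 -> {for t, continuous f} -> {for t, continuous (fun s => (f s)^-1)}.
Proof. by move=> ft cf; apply: cvgV => //; exact: cf. Qed.

Lemma continuous_at_pow (T : topologicalType) (f : T -> R) (t : T) k :
  {for t, continuous f} -> {for t, continuous (fun s => f s ^+ k)}.
Proof.
move=> cf; elim: k => [|k IH]; first exact: cvg_cst.
have -> : (fun s => f s ^+ k.+1) = (fun s => f s * f s ^+ k).
  by apply/funext => s; rewrite exprS.
exact: continuous_at_mul.
Qed.

Variable n : nat.
Local Notation N := n.+1.
Local Notation V := 'rV[R]_N.
Local Notation leb := (@lebesgue_rV R N).
Implicit Types (x y z : V) (Omega : set V).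

(** It suffices to maximize over the set where the ratio is at least its value
at [x1]. On that set [u] is bounded away from zero, which keeps it away from
the boundary, and [chi] is bounded, which keeps it away from infinity; so it is
compact. *)
Lemma exists_max_ratio Omega (phi u : V -> R) (m0 U : R) k x1 :
  open Omega -> {within Omega, continuous phi} -> {within Omega, continuous u} ->
  0 < m0 -> (forall x, Omega x -> m0 <= phi x) -> (forall x, Omega x -> u x <= U) ->
  (forall xi, bdry Omega xi ->
    (limf_esup (EFin \o u) (within Omega (nbhs xi)) <= 0)%E) ->
  Omega x1 -> 0 < u x1 ->
  exists x0, [/\ Omega x0, 0 < u x0 &
    forall x, Omega x -> 0 < u x ->
    u x ^+ k.+1 / (phi x ^+ k * chi x) <= u x0 ^+ k.+1 / (phi x0 ^+ k * chi x0)].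
Proof.
move=> oO cphi cu m00 phim uU ubd Ox1 ux1.
pose D x := phi x ^+ k * chi x; pose F x := u x ^+ k.+1 / D x.
have chi0 x : 0 < chi x by exact: lt_le_trans ltr01 (chi_ge1 x).
have phi0 x : Omega x -> 0 < phi x by move=> Ox; exact: lt_le_trans m00 (phim x Ox).
have D0 x : Omega x -> 0 < D x by move=> Ox; rewrite mulr_gt0// exprn_gt0// phi0.
have Dm x : Omega x -> m0 ^+ k * chi x <= D x.
  move=> Ox; rewrite ler_wpM2r// ?(ltW (chi0 x))// lerXn2r ?nnegrE ?phim ?ltW//.
  exact: phi0.
have F1 : 0 < F x1 by rewrite divr_gt0 ?exprn_gt0// D0.
have mk0 : 0 < m0 ^+ k by rewrite exprn_gt0.
have cD x : Omega x -> {for x, continuous D}.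
  move=> Ox; have cx := open_continuous_at oO cphi Ox.
  have := @continuous_at_mul V _ _ x (@continuous_at_pow V _ x k cx) (@continuous_chi R n x).
  exact.
have cup x : Omega x -> {for x, continuous (fun y => u y ^+ k.+1)}.
  by move=> Ox; have cx := open_continuous_at oO cu Ox; exact: continuous_at_pow.
pose K := [set x | [/\ Omega x, 0 <= u x & F x1 * D x <= u x ^+ k.+1]].
(* A lower bound for [u] on [K]: if [u x <= 1] then [u x ^+ k.+1 <= u x], while
   [F x1 * D x] is at least [F x1 * m0 ^+ k]. *)
pose e := Num.min 1 (F x1 * m0 ^+ k).
have e0 : 0 < e by rewrite lt_min ltr01 mulr_gt0.
have Ke x : K x -> e <= u x.
  move=> [Ox u0 Fu]; rewrite leNgt; apply/negP; rewrite lt_min => /andP[u1 uF].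
  have : u x ^+ k.+1 <= u x by rewrite exprS ler_piMr// exprn_ile1// ltW.
  have : F x1 * (m0 ^+ k * 1) <= F x1 * D x.
    by rewrite ler_pM2l//; apply: le_trans (Dm x Ox); rewrite ler_pM2l// chi_ge1.
  by move: Fu uF; rewrite mulr1; lra.
pose B := U ^+ k.+1 / (F x1 * m0 ^+ k).
have KB : K `<=` cball 0 (`|B| + 1).
  move=> x [Ox u0 Fu].
  have : chi x <= B.
    rewrite ler_pdivlMr; last exact: mulr_gt0.
    apply: (@le_trans _ _ (F x1 * D x)).
      by rewrite mulrCA ler_pM2l// mulrC Dm.
    apply: le_trans Fu _; rewrite lerXn2r ?nnegrE ?uU//.
    by apply: le_trans u0 _; exact: uU.
  have := dotvv_ge_norm x (ltn0Sn n); rewrite /chi /cball/= subr0 => h1 h2.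
  rewrite leNgt; apply/negP => h3; have := ler_norm B; have := normr_ge0 B.
  by move: h1 h2 h3; rewrite expr2; nra.
have cK : closed K.
  move=> x clKx.
  have Kx (W : set V) : nbhs x W -> exists2 y, K y & W y.
    by move=> /clKx[y []]; exists y.
  have [Ox|nOx] := pselect (Omega x); last first.
    have : bdry Omega x.
      split; last by move=> /interior_subset.
      by apply: closureS clKx => y [].
    move=> /ubd /(@le_lt_trans _ _ _ _ e%:E); rewrite lte_fin => /(_ e0).
    move=> /ereal_inf_lt[_ [A FA <-]] Ae.
    have [y Ky /(_ _)Ay] := Kx _ FA; have [Oy _ _] := Ky.
    have : (e%:E <= ereal_sup ((EFin \o u) @` A))%E.
      apply: (@le_trans _ _ (u y)%:E); first by rewrite lee_fin Ke.
      by apply: ereal_sup_ubound; exists y => //; exact: Ay.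
    by rewrite leNgt Ae.
  split => //.
    rewrite leNgt; apply/negP => ux0.
    have [y Ky] := Kx _ (nbhs_lt (open_continuous_at oO cu Ox) ux0).
    by rewrite /= ltNge (le_trans (ltW e0) (Ke y Ky)).
  rewrite leNgt; apply/negP => h.
  have c1 := @continuous_at_lin _ _ _ _ 1 (- F x1) x (cup x Ox) (cD x Ox).
  have h' : 1 * u x ^+ k.+1 + - F x1 * D x < 0 by move: h; lra.
  have [y [_ _ Ky]] := Kx _ (nbhs_lt c1 h').
  by rewrite /=; move: Ky; lra.
have cptK : compact K := subclosed_compact cK (@compact_cball R N 0 _) KB.
have cF : {within K, continuous F}.
  apply: continuous_in_subspaceT => x; rewrite inE => -[Ox _ _].
  have Dx : D x != 0 by rewrite gt_eqF// D0.
  exact: (@continuous_at_mul V _ _ x (cup x Ox) (@continuous_at_inv V D x Dx (cD x Ox))).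
have Kx1 : K x1.
  by split => //; [exact: ltW|rewrite /F divfK// gt_eqF// D0].
have [x0 + x0max] := EVT_max_rV (ex_intro _ x1 Kx1) cptK cF.
rewrite inE => Kx0; have [Ox0 _ _] := Kx0.
exists x0; split => //; first exact: lt_le_trans e0 (Ke _ Kx0).
move=> x Ox ux; have [Kx|nKx] := pselect (K x); first by apply: x0max; rewrite inE.
apply: (@le_trans _ _ (F x1)); last by apply: x0max; rewrite inE.
rewrite ler_pdivrMr; last exact: D0.
by rewrite leNgt; apply/negP => h; apply: nKx; split => //; exact: ltW.
Qed.

Theorem lambda1''_maximum_principle Omega (a : V -> 'M[R]_N) (b : V -> V) (c : V -> R) :
  open Omega -> elliptic_operator Omega a b c ->
  (0 < lambda1'' Omega a b c)%E ->
  (ess_sup_on Omega c < +oo)%E ->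
  (forall i j : 'I_N, (limsup_infty Omega (fun x => `|a x i j| / euclid x ^+ 2)%R < +oo)%E) ->
  (ess_limsup_infty Omega (fun x => dotv (b x) x / euclid x ^+ 2)%R < +oo)%E ->
  maximum_principle Omega a b c.
Proof.
move=> oO ell /ereal_sup_gt[_ [l [phi [phiW phi_inf Lphi]] <-]].
rewrite lte_fin => l0 coo aoo boo u uW Lu usup ubd x1 Ox1.
rewrite leNgt; apply/negP => ux1.
have [m0 m00 phim] : exists2 m0, 0 < m0 & forall x, Omega x -> m0 <= phi x.
  have lb x : Omega x -> (ereal_inf [set (phi x)%:E | x in Omega] <= (phi x)%:E)%E.
    by move=> Ox; apply: ereal_inf_lbound; exists x.
  move: phi_inf lb; case: (ereal_inf _) => [m| |]// m0 lb.
    by exists m => [|x /lb]; [rewrite -lte_fin|rewrite lee_fin].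
  by have := lb x1 Ox1; rewrite leye_eq.
have [U uU] : exists U, forall x, Omega x -> u x <= U.
  have ub x : Omega x -> ((u x)%:E <= ereal_sup [set (u x)%:E | x in Omega])%E.
    by move=> Ox; apply: ereal_sup_ubound; exists x.
  move: usup ub; case: (ereal_sup _) => [U| |]// _ ub.
    by exists U => x /ub; rewrite lee_fin.
  by have := ub x1 Ox1; rewrite leeNy_eq.
have [C C0 growth] := chi_growth (ltn0Sn n) ell coo aoo boo.
pose k := Num.bound (C / l).
have Ck : C < l * k%:R.
  rewrite mulrC -ltr_pdivrMr//; apply: archi_boundP; apply: divr_ge0 => //.
  exact: ltW.
have [x0 [Ox0 ux0 umax]] := @exists_max_ratio Omega phi u m0 U k x1 oO phiW.1 uW.1
  m00 phim uU ubd Ox1 ux1.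
have phi0 x : Omega x -> 0 < phi x by move=> Ox; exact: lt_le_trans m00 (phim x Ox).
have chi0 x : 0 < chi x by exact: lt_le_trans ltr01 (chi_ge1 x).
have phn0 : phi x0 != 0 by rewrite gt_eqF// phi0.
have chn0 : chi x0 != 0 by rewrite gt_eqF.
have kn0 : k.+1%:R != 0 :> R by [].
apply: (@subsolution_no_touching R n Omega a b c phi u x0 l
  (u x0 * k%:R / (k.+1%:R * phi x0)) (u x0 / (k.+1%:R * chi x0)) C) => //.
- by apply: divr_ge0; apply: mulr_ge0 => //; apply: ltW => //; exact: phi0.
- by apply: divr_ge0; [exact: ltW|apply: mulr_ge0 => //; exact: ltW].
- by apply: le_combination_of_max_ratio.
- by move: kn0; rewrite -natr1 => kn0; field; rewrite phn0 chn0 kn0.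
- have -> : C * (u x0 / (k.+1%:R * chi x0)) * chi x0 = u x0 / k.+1%:R * C.
    by field; rewrite chn0 kn0.
  have -> : l * (u x0 * k%:R / (k.+1%:R * phi x0)) * phi x0 = u x0 / k.+1%:R * (l * k%:R).
    by field; rewrite phn0 kn0.
  by rewrite ltr_pM2l// divr_gt0.
Qed.

End maximum_principle.

Theorem theorem1p6 (R : realType) (N : nat) (Omega : set 'rV[R]_N)
    (a : 'rV[R]_N -> 'M[R]_N) (b : 'rV[R]_N -> 'rV[R]_N) (c : 'rV[R]_N -> R)
    (hN : (0 < N)%N) (hOmega : domain Omega)
    (hL : elliptic_operator Omega a b c) :
  ((0 < lambda1'' Omega a b c)%E ->
   (ess_sup_on Omega c < +oo)%E ->
   (forall i j : 'I_N,
     (limsup_infty Omega (fun x => `|a x i j| / euclid x ^+ 2)%R < +oo)%E) ->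
   (ess_limsup_infty Omega (fun x => dotv (b x) x / euclid x ^+ 2)%R < +oo)%E ->
   maximum_principle Omega a b c)
  /\
  (maximum_principle Omega a b c -> (0 <= lambda1' Omega a b c)%E).
Proof.
have [oO _ _] := hOmega; split; last exact: maximum_principle_lambda1'_ge0.
case: N Omega a b c hN hOmega hL oO => // n Omega a b c _ _ hL oO.
exact: lambda1''_maximum_principle.
Qed.
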